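(* Let $\mathcal H,\widehat{\mathcal H}$ be separable Hilbert spaces, let $A$ be a self-adjoint operator in $\mathcal H$ with compact resolvent and bounded from below, $B:\widehat{\mathcal H}\to\mathcal H$ a non-zero bounded linear operator, and $c\in\mathbb R$. Put $N(A,c)=\dim\mathcal L_{(-\infty,c]}(A)\le\dim\mathcal H$ and let the eigenvalues $(\nu_j(A))_{j=1}^{\dim\mathcal H}$ of $A$, counted with multiplicities, be ordered non-decreasingly, i.e. $\nu_1(A)\le\dots\le\nu_{N(A,c)}(A)\le c<\nu_{N(A,c)+1}(A)\le\cdots$. Let $\mathcal S(\lambda)=A-\lambda-\frac{BB^*}{c-\lambda}$, $\operatorname{dom}\mathcal S(\lambda)=\operatorname{dom}A$, $\lambda\in\mathbb C\setminus\{c\}$. Then the spectrum of $\mathcal S$ consists of two (finite or infinite) eigenvalue sequences $(\lambda_{1,j})_{j=1}^{n_1}\subset(-\infty,c)$ and $(\lambda_{2,j})_{j=1}^{n_2}\subset(c,+\infty)$, $n_1,n_2\in\mathbb N_0\cup\{\infty\}$ (each ordered non-decreasingly and counted with multiplicities), which can be characterized as $$\lambda_{1,j}=\min_{\substack{\mathcal L\subset\operatorname{dom}A\\ \dim\mathcal L=j}}\ \max_{\substack{u\in\mathcal L\\ u\ne0}}p_1(u),\quad j=1,2,\dots,n_1,$$ $$\lambda_{2,j}=\min_{\substack{\mathcal L\subset\operatorname{dom}A\\ \dim\mathcal L=j+\kappa_2}}\ \max_{\substack{u\in\mathcal L\\ u\ne0}}p_2(u),\quad j=1,2,\dots,n_2,$$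 where, for $u\in\operatorname{dom}A$, $u\neq0$, $$p_{1,2}(u)=\frac12\Big(\frac{(Au,u)}{\|u\|^2}+c\Big)\mp\sqrt{\frac14\Big(\frac{(Au,u)}{\|u\|^2}-c\Big)^2+\frac{\|B^*u\|^2}{\|u\|^2}}$$ (minus sign for $p_1$, plus sign for $p_2$). The index shift $\kappa_2$ satisfies $\kappa_2\le N(A,c)$; in particular $\kappa_2=0$ if $A>c$. Moreover: (i) if $B$ has closed range and $P$ and $Q$ are the orthogonal projections onto $\mathcal L_{(-\infty,c]}(A)$ and $\ker B^*$, respectively, then $\kappa_2\le\operatorname{rank}(PQ)\le\min\{N(A,c),\dim\ker B^*\}$; (ii) $n_2=\infty$ if and only if $\dim\mathcal H=\infty$; in this case $(\lambda_{2,j})_{j=1}^\infty\subset(c,+\infty)$ accumulates (only) to $+\infty$; (iii) $n_1=\infty$ if and only if $\dim\overline{\operatorname{ran}B}=\infty$; in this case $(\lambda_{1,j})_{j=1}^\infty\subset(-\infty,c)$ accumulates (only) to $c$ from the left.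
   Context: For a self-adjoint operator $T$ and a Borel set $I\subset\mathbb R$, $\mathcal L_I(T)$ denotes the spectral subspace of $T$ corresponding to $I$. The spectrum of the operator function $\mathcal S$ is $\sigma(\mathcal S)=\{\lambda\in\mathbb C\setminus\{c\}:0\in\sigma(\mathcal S(\lambda))\}$, its point spectrum (eigenvalues) is $\sigma_{\rm p}(\mathcal S)=\{\lambda\in\mathbb C\setminus\{c\}:0\in\sigma_{\rm p}(\mathcal S(\lambda))\}$, the multiplicity of an eigenvalue $\lambda$ is $\dim\ker\mathcal S(\lambda)$, and $\rho(\mathcal S)=\{\lambda\in\mathbb C\setminus\{c\}:0\in\rho(\mathcal S(\lambda))\}$. The index shift is $\kappa_2:=\dim\mathcal L_{(-\infty,0)}(\mathcal S(\lambda))$ for $\lambda\in(c,\alpha_1)$, where $\alpha_1>c$ is such that $(c,\alpha_1)\subset\rho(\mathcal S)$; such $\alpha_1$ exists and this dimension is finite and independent of $\lambda\in(c,\alpha_1)$. *)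

(* Defs.v *)
From HB Require Import structures.
From mathcomp Require Import all_boot all_order all_algebra.
From mathcomp Require Import sesquilinear.
From mathcomp Require Import complex.
From mathcomp Require Import all_classical all_reals all_analysis.

Set Implicit Arguments.
Unset Strict Implicit.
Unset Printing Implicit Defensive.

Import Order.TTheory GRing.Theory Num.Theory.
Import numFieldNormedType.Exports.

Local Open Scope classical_set_scope.
Local Open Scope complex_scope.
Local Open Scope ring_scope.

Record hilbertType (R : realType) := HilbertType {
  hilbert_sort :> completeNormedModType R[i];
  (* [{dot _ for _}] is linear in the first argument and conjugate-linear in
     the second one *)
  hdot : {dot hilbert_sort for (@Num.conj R[i])};
  hdotE : forall u : hilbert_sort, `|u| ^+ 2 = hdot u u
}.

Notation "''[' u , v ]" := (hdot _ u v) : ring_scope.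

Section hilbert.
Context {R : realType}.
Implicit Types H : hilbertType R.

Definition hnorm H (u : H) : R := complex.Re `|u|.

Definition separable_space H := exists D : set H, countable D /\ dense D.

Definition lin_subspace H (L : set H) :=
  L 0 /\ forall (a : R[i]) (u v : H), L u -> L v -> L (a *: u + v).

Definition lin_indep H n (e : 'I_n -> H) :=
  forall a : 'I_n -> R[i], \sum_(i < n) a i *: e i = 0 -> forall i, a i = 0.

(* algebraic dimension, in [N \cup {+oo}]; on closed subspaces of a separable
   Hilbert space it agrees with the Hilbert dimension once all infinite values
   are identified *)
Definition hdim H (L : set H) : \bar R :=
  ereal_sup [set n%:R%:E | n in [set n |
    exists e : 'I_n -> H, (forall i, L (e i)) /\ lin_indep e]].

Definition orth_proj H (M : set H) (P : H -> H) :=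
  forall u, M (P u) /\ forall w, M w -> '[u - P u, w] = 0.

Definition bounded_op H1 H2 (B : H1 -> H2) :=
  exists M : R, forall x, hnorm (B x) <= M * hnorm x.

Definition adjoint H1 H2 (B : H1 -> H2) (y : H2) : H1 :=
  get [set z | forall x, '[B x, y] = '[x, z]].

End hilbert.

(* A possibly unbounded operator; the values of [oper] outside of [dom] are
   irrelevant *)
Record operator (R : realType) (H : hilbertType R) := Operator {
  dom : set H;
  oper :> H -> H
}.

Section operators.
Context {R : realType} {H : hilbertType R}.
Implicit Types T : operator H.

Definition linear_operator T :=
  lin_subspace (dom T) /\
  forall (a : R[i]) u v, dom T u -> dom T v -> T (a *: u + v) = a *: T u + T v.

(* densely defined, and equal to its adjoint: [(v, w)] is in the graph of the
   adjoint iff the right-hand side below holds *)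
Definition selfadjoint T :=
  [/\ linear_operator T, dense (dom T) &
      forall v w, (dom T v /\ T v = w) <->
                  (forall u, dom T u -> '[T u, v] = '[u, w])].

Definition bounded_below T :=
  exists g : R, forall u, dom T u -> g * hnorm u ^+ 2 <= complex.Re '[T u, u].

Definition sub_scalar T (z : R[i]) : operator H :=
  Operator (dom T) (fun u => T u - z *: u).

Definition bounded_inverse T (K : {linear H -> H}) :=
  [/\ bounded_op K, forall v, dom T (K v) /\ T (K v) = v &
      forall u, dom T u -> K (T u) = u].

Definition resolvent_set T : set R[i] :=
  [set z | exists K, bounded_inverse (sub_scalar T z) K].

Definition spectrum T : set R[i] := ~` resolvent_set T.

Definition point_spectrum T : set R[i] :=
  [set z | exists u, [/\ dom T u, u != 0 & T u = z *: u]].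

Definition ker_op T : set H := [set u | dom T u /\ T u = 0].

Definition compact_op (K : H -> H) := precompact (K @` [set u | hnorm u <= 1]).

Definition compact_resolvent T :=
  exists z (K : {linear H -> H}), bounded_inverse (sub_scalar T z) K /\ compact_op K.

(* [E] is a projection-valued Borel measure on the line, [mu u] is the scalar
   measure [I |-> (E(I)u, u)], and [T] is the integral of the identity with
   respect to [E]: its domain is the natural one, and [T] is determined there
   by its quadratic form (polarization) *)
Definition spectral_measure T (E : set (measurableTypeR R) -> H -> H)
    (mu : H -> {measure set (measurableTypeR R) -> \bar R}) :=
  [/\ forall I, measurable I ->
        exists M, [/\ lin_subspace M, closed M & orth_proj M (E I)],
      forall u, E setT u = u,
      forall u I, measurable I -> mu u I = (complex.Re '[E I u, u])%:E,
      forall u, dom T u <->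
        (\int[mu u]_(x in setT) ((x : R) ^+ 2)%:E < +oo)%E &
      forall u, dom T u ->
        (\int[mu u]_(x in setT) (x : R)%:E = (complex.Re '[T u, u])%:E)%E].

(* the spectral measure of a self-adjoint operator exists and is unique *)
Definition spectral_subspace (I : set R) T : set H :=
  [set u | exists E mu, spectral_measure T E mu /\ E I u = u].

End operators.

Section schur.
Context {R : realType} {H Hhat : hilbertType R}.
Variables (A : operator H) (B : Hhat -> H) (c : R).

Definition schur (z : R[i]) : operator H :=
  Operator (dom A)
    (fun u => A u - z *: u - (c%:C - z)^-1 *: B (adjoint B u)).

Definition schur_resolvent_set : set R[i] :=
  [set z | z <> c%:C /\ resolvent_set (schur z) 0].

Definition schur_spectrum : set R[i] :=
  [set z | z <> c%:C /\ spectrum (schur z) 0].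

Definition schur_point_spectrum : set R[i] :=
  [set z | z <> c%:C /\ point_spectrum (schur z) 0].

Definition is_index_shift (k : nat) :=
  exists2 alpha : R, c < alpha &
    (forall l : R, c < l < alpha -> schur_resolvent_set l%:C) /\
    (forall l : R, c < l < alpha ->
       hdim (spectral_subspace `]-oo, 0[ (schur l%:C)) = k%:R%:E).

Definition index_shift : nat := get is_index_shift.

Definition pm (sgn : R) (u : H) : R :=
  let a := complex.Re '[A u, u] / hnorm u ^+ 2 in
  2^-1 * (a + c) +
  sgn * Num.sqrt (4^-1 * (a - c) ^+ 2 +
                  hnorm (adjoint B u) ^+ 2 / hnorm u ^+ 2).

Definition p1 := pm (-1).
Definition p2 := pm 1.

End schur.

Section minmax.
Context {R : realType} {H : hilbertType R}.

Definition is_max (X : set R) (m : R) := X m /\ ubound X m.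

Definition is_minmax (D : set H) (d : nat) (p : H -> R) (m : R) :=
  let adm (L : set H) := [/\ lin_subspace L, L `<=` D & hdim L = d%:R%:E] in
  let vals (L : set H) := p @` [set u | L u /\ u != 0] in
  (exists2 L, adm L & is_max (vals L) m) /\
  (forall L, adm L -> exists2 M, is_max (vals L) M & m <= M).

End minmax.

(* Elements of [N \cup {+oo}], as extended reals *)
Definition is_enat {R : realType} (n : \bar R) :=
  n = +oo%E \/ exists k : nat, n = k%:R%:E.

(* the index set [{j | 1 <= j <= n}] *)
Definition index_range {R : realType} (n : \bar R) : set nat :=
  [set j | (0 < j)%N /\ (j%:R%:E <= n)%E].

Definition nondecr_on {R : realType} (J : set nat) (l : nat -> R) :=
  forall j k, J j -> J k -> (j <= k)%N -> l j <= l k.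

(* Main.v *)
(* Let [s_l(u) = (S(l)u, u)].  On each side of [c], [s_l(u)] is decreasing in
   [l], and [s_l(u) < 0] iff [p_i(u) < l], with [i = 1] on the left and [i = 2]
   on the right.  By the spectral theorem for the operator [S(l)], which is
   bounded below with compact resolvent, the maximal dimensions [k_-(l)] and
   [k_0(l)] of subspaces on which [s_l] is negative, resp. nonpositive, are
   finite, differ by [dim ker S(l)], and are one-sided limits of each other.
   Hence the eigenvalues are the jumps of a monotone integer-valued function;
   comparing [k_-] and [k_0] at the [j]-th jump gives the min-max formulas,
   and [kappa2] is the limit of [k_-] at [c] from the right.

   As [l] decreases to [c], [s_l(u)] is nonnegative for [u] orthogonal to the
   spectral subspace of [(-oo, c]], where [A >= c + d]; it is also nonnegative
   when [P Q u = 0] if [B] has closed range, because [|B^* u|^2 / (l - c)] then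
   dominates [|u - Q u|^2], hence [|P u|^2].  This bounds [kappa2].  As [l]
   increases to [c], [- |B^* u|^2 / (c - l)] makes [s_l] negative on
   finite-dimensional spaces on which [B^*] is injective, which gives (iii). *)

Require Import Defs.
From HB Require Import structures.
From mathcomp Require Import all_boot all_order all_algebra.
From mathcomp Require Import sesquilinear.
From mathcomp Require Import complex.
From mathcomp Require Import all_classical all_reals all_analysis.
From mathcomp Require Import ring lra zify measurable_realfun.

Set Implicit Arguments.
Unset Strict Implicit.
Unset Printing Implicit Defensive.

Import Order.TTheory GRing.Theory Num.Theory.
Import numFieldNormedType.Exports.

Local Open Scope classical_set_scope.
Local Open Scope complex_scope.
Local Open Scope ring_scope.

(** * Inner products *)

(** Compactness enters through one estimate. A shift makes [T + ga >= 1]; maximising the form of its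
    inverse on successive orthogonal complements produces eigenvectors, and on the complement of the
    first [m] of them the form of [T] exceeds any prescribed multiple of the squared norm once [m]
    is large. Every count therefore involves finitely many eigenvectors and a rest on which the form
    is large. [spectral_subspace] quantifies over all spectral measures. Identifying it with a space
    of eigenvectors takes two halves: building one such measure from the eigenvectors, and showing
    that an arbitrary one acts on eigenvectors in the expected way. The one-sided limits of the
    counts rest on the gap between 0 and the nonzero eigenvalues of S(l): the form depends on l
    continuously, uniformly relative to the squared norm, so a small change of l cannot use up the
    gap. [adjoint] and [index_shift] are choices by [get], so existence has to be shown for both,
    and uniqueness for the shift. With a closed range, [B^*] is bounded below on the complement of
    its kernel; this comes from the uniform boundedness principle. *)

Section complex_facts.
Context {R : realType}.
Implicit Types a b z : R[i].

Lemma ReD a b : complex.Re (a + b) = complex.Re a + complex.Re b.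
Proof. by case: a => ? ?; case: b. Qed.

Lemma ReN a : complex.Re (- a) = - complex.Re a.
Proof. by case: a. Qed.

Lemma ReZ (t : R) a : complex.Re (t%:C * a) = t * complex.Re a.
Proof. by case: a => ? ? /=; rewrite mul0r subr0. Qed.

Lemma ReJ a : complex.Re (Num.conj a) = complex.Re a.
Proof. by case: a. Qed.

(** Since Im a = - Re (i a), a complex identity that is linear in a vector follows from its real
    part, tested at the vector and at i times it. *)
Lemma complex_eq0 a : complex.Re a = 0 -> complex.Re ('i%C * a) = 0 -> a = 0.
Proof.
case: a => x y /= ->; rewrite mul0r mul1r sub0r => /eqP.
by rewrite oppr_eq0 => /eqP ->.
Qed.

Lemma Re_sum I (r : seq I) (P : pred I) (F : I -> R[i]) :
  complex.Re (\sum_(i <- r | P i) F i) = \sum_(i <- r | P i) complex.Re (F i).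
Proof. by elim/big_rec2: _ => // i x y _ <-; rewrite ReD. Qed.

End complex_facts.

Section inner_product.
Context {R : realType} {H : hilbertType R}.
Implicit Types (u v w : H) (a : R[i]).

(** The underlying real scalar product: estimates and quadratic forms then live in the ordered field
    [R], and [dot_rdot0] recovers the complex product. *)
Definition rdot u v : R := complex.Re '[u, v].

Lemma dotDl u v w : '[u + v, w] = '[u, w] + '[v, w].
Proof. by rewrite linearDl. Qed.

Lemma dotZl a u v : '[a *: u, v] = a * '[u, v].
Proof. by rewrite linearZl_LR. Qed.

Lemma dotC u v : '[u, v] = Num.conj '[v, u].
Proof. by rewrite hermC /= expr0 mul1r. Qed.

Lemma dotDr u v w : '[w, u + v] = '[w, u] + '[w, v].
Proof. by rewrite linearDr. Qed.

Lemma dotZr a u v : '[u, a *: v] = Num.conj a * '[u, v].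
Proof. by rewrite linearZr_LR. Qed.

Lemma dotNl u v : '[- u, v] = - '[u, v].
Proof. by rewrite linearNl. Qed.

Lemma dotNr u v : '[u, - v] = - '[u, v].
Proof. by rewrite linearNr. Qed.

Lemma dot0l u : '[0, u] = 0.
Proof. by rewrite linear0l. Qed.

Lemma dot0r u : '[u, 0] = 0.
Proof. by rewrite linear0r. Qed.

Lemma dotBl u v w : '[u - v, w] = '[u, w] - '[v, w].
Proof. by rewrite dotDl dotNl. Qed.

Lemma dotBr u v w : '[w, u - v] = '[w, u] - '[w, v].
Proof. by rewrite dotDr dotNr. Qed.

Lemma dot_suml I (r : seq I) (P : pred I) (F : I -> H) v :
  '[\sum_(i <- r | P i) F i, v] = \sum_(i <- r | P i) '[F i, v].
Proof. by rewrite linear_sumlz. Qed.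

Lemma dot_sumr I (r : seq I) (P : pred I) (F : I -> H) v :
  '[v, \sum_(i <- r | P i) F i] = \sum_(i <- r | P i) '[v, F i].
Proof. by rewrite linear_sumr. Qed.

Lemma dot_eq0C u v : '[u, v] = 0 -> '[v, u] = 0.
Proof. by move=> h; rewrite dotC h rmorph0. Qed.

Lemma dotuu u : '[u, u] = (hnorm u ^+ 2)%:C.
Proof.
rewrite -hdotE /hnorm rmorphXn; congr (_ ^+ _).
by rewrite /= RRe_real // normr_real.
Qed.

Lemma normC_hnorm u : `|u| = (hnorm u)%:C.
Proof. by rewrite /hnorm RRe_real // normr_real. Qed.

Lemma hnorm_ge0 u : 0 <= hnorm u.
Proof. by have := normr_ge0 u; rewrite normC_hnorm ler0c. Qed.

Lemma hnorm_eq0 u : hnorm u = 0 -> u = 0.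
Proof. by move=> h; apply/eqP; rewrite -normr_eq0 normC_hnorm h. Qed.

Lemma hnorm_gt0 u : u != 0 -> 0 < hnorm u.
Proof.
move=> u0; rewrite lt_neqAle hnorm_ge0 andbT eq_sym.
by apply: contra u0 => /eqP/hnorm_eq0 ->.
Qed.

Lemma hnorm0 : hnorm (0 : H) = 0.
Proof. by rewrite /hnorm normr0. Qed.

Lemma hnormN u : hnorm (- u) = hnorm u.
Proof. by rewrite /hnorm normrN. Qed.

Lemma hnormB u v : hnorm (u - v) = hnorm (v - u).
Proof. by rewrite -hnormN opprB. Qed.

Lemma hnormD u v : hnorm (u + v) <= hnorm u + hnorm v.
Proof.
by have := ler_normD u v; rewrite !normC_hnorm -rmorphD lecR.
Qed.

Lemma hnorm_triangle u v w : hnorm (u - w) <= hnorm (u - v) + hnorm (v - w).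
Proof. by have := hnormD (u - v) (v - w); rewrite addrA subrK. Qed.

Definition cabs a : R := complex.Re `|a|.

Lemma normC_cabs a : `|a| = (cabs a)%:C.
Proof. by rewrite /cabs RRe_real // normr_real. Qed.

Lemma cabs_ge0 a : 0 <= cabs a.
Proof. by have := normr_ge0 a; rewrite normC_cabs ler0c. Qed.

Lemma hnormZC a u : hnorm (a *: u) = cabs a * hnorm u.
Proof. by rewrite /hnorm normrZ normC_hnorm normC_cabs -rmorphM. Qed.

Lemma cabs_eq0 a : cabs a = 0 -> a = 0.
Proof. by move=> h; apply/eqP; rewrite -normr_eq0 normC_cabs h. Qed.

Lemma cabs2 a : cabs a ^+ 2 = complex.Re a ^+ 2 + complex.Im a ^+ 2.
Proof.
apply: (@complexI R); rewrite rmorphXn /= -normC_cabs.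
by rewrite -add_Re2_Im2.
Qed.

Lemma mulJ_cabs a : a * Num.conj a = (cabs a ^+ 2)%:C.
Proof. by rewrite -normCK rmorphXn /= normC_cabs. Qed.

Lemma cabsM a b : cabs (a * b) = cabs a * cabs b.
Proof. by rewrite /cabs normrM normC_cabs (normC_cabs b) -rmorphM. Qed.

Lemma cabsJ a : cabs (Num.conj a) = cabs a.
Proof. by rewrite /cabs norm_conjC. Qed.

Lemma cabsR (t : R) : cabs t%:C = `|t|.
Proof. by rewrite /cabs normc_def /= expr0n addr0 sqrtr_sqr. Qed.

Lemma hnormZ (t : R) u : hnorm (t%:C *: u) = `|t| * hnorm u.
Proof. by rewrite hnormZC cabsR. Qed.

Lemma rdotDl u v w : rdot (u + v) w = rdot u w + rdot v w.
Proof. by rewrite /rdot dotDl ReD. Qed.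

Lemma rdotDr u v w : rdot w (u + v) = rdot w u + rdot w v.
Proof. by rewrite /rdot dotDr ReD. Qed.

Lemma rdotNl u v : rdot (- u) v = - rdot u v.
Proof. by rewrite /rdot dotNl ReN. Qed.

Lemma rdotNr u v : rdot u (- v) = - rdot u v.
Proof. by rewrite /rdot dotNr ReN. Qed.

Lemma rdotBl u v w : rdot (u - v) w = rdot u w - rdot v w.
Proof. by rewrite rdotDl rdotNl. Qed.

Lemma rdotBr u v w : rdot w (u - v) = rdot w u - rdot w v.
Proof. by rewrite rdotDr rdotNr. Qed.

Lemma rdotZl (t : R) u v : rdot (t%:C *: u) v = t * rdot u v.
Proof. by rewrite /rdot dotZl ReZ. Qed.

Lemma rdotC u v : rdot u v = rdot v u.
Proof. by rewrite /rdot dotC ReJ. Qed.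

Lemma rdotZr (t : R) u v : rdot u (t%:C *: v) = t * rdot u v.
Proof. by rewrite rdotC rdotZl rdotC. Qed.

Lemma rdotuu u : rdot u u = hnorm u ^+ 2.
Proof. by rewrite /rdot dotuu. Qed.

Lemma rdot0l u : rdot 0 u = 0.
Proof. by rewrite /rdot dot0l. Qed.

Lemma rdot0r u : rdot u 0 = 0.
Proof. by rewrite /rdot dot0r. Qed.

Lemma rdot_suml I (r : seq I) (P : pred I) (F : I -> H) v :
  rdot (\sum_(i <- r | P i) F i) v = \sum_(i <- r | P i) rdot (F i) v.
Proof. by rewrite /rdot dot_suml Re_sum. Qed.

Lemma dot_rdot0 u v : rdot u v = 0 -> rdot ('i%C *: u) v = 0 -> '[u, v] = 0.
Proof. by move=> h1; rewrite /rdot dotZl; exact: complex_eq0. Qed.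

Lemma hnormD2 u v :
  hnorm (u + v) ^+ 2 = hnorm u ^+ 2 + hnorm v ^+ 2 + 2 * rdot u v.
Proof. by rewrite -!rdotuu !rdotDl !rdotDr (rdotC v u); ring. Qed.

Lemma hnormB2 u v :
  hnorm (u - v) ^+ 2 = hnorm u ^+ 2 + hnorm v ^+ 2 - 2 * rdot u v.
Proof. by rewrite hnormD2 hnormN rdotNr; ring. Qed.

Lemma parallelogram u v : hnorm (u + v) ^+ 2 + hnorm (u - v) ^+ 2 =
  2 * hnorm u ^+ 2 + 2 * hnorm v ^+ 2.
Proof. by rewrite hnormD2 hnormB2; ring. Qed.

Lemma pythagoras u v : '[u, v] = 0 ->
  hnorm (u + v) ^+ 2 = hnorm u ^+ 2 + hnorm v ^+ 2.
Proof. by move=> h; rewrite hnormD2 /rdot h mulr0 addr0. Qed.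

Lemma rdot_cauchy u v : `|rdot u v| <= hnorm u * hnorm v.
Proof.
have [->|v0] := eqVneq v 0; first by rewrite rdot0r normr0 hnorm0 mulr0.
have nv := hnorm_gt0 v0.
rewrite -ler_sqr ?nnegrE ?mulr_ge0 ?hnorm_ge0 // real_normK ?num_real // exprMn.
(* The coefficient of the projection of [u] on [v], which minimises [|u - t v|]. *)
pose t := rdot u v / hnorm v ^+ 2.
have := exprn_ge0 2 (hnorm_ge0 (u - t%:C *: v)).
rewrite hnormB2 hnormZ rdotZr exprMn real_normK ?num_real // /t.
have -> : hnorm u ^+ 2 + (rdot u v / hnorm v ^+ 2) ^+ 2 * hnorm v ^+ 2 -
   2 * (rdot u v / hnorm v ^+ 2 * rdot u v) =
   hnorm u ^+ 2 - rdot u v ^+ 2 / hnorm v ^+ 2.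
  by field; rewrite gt_eqF.
by rewrite subr_ge0 ler_pdivrMr ?exprn_gt0.
Qed.

(** Rotating [u] by this phase makes the product with [v] real and nonnegative; the complex
    Cauchy-Schwarz inequality then follows from the real one. *)
Lemma unit_phase a : exists b, cabs b = 1 /\ b * a = (cabs a)%:C.
Proof.
have [->|a0] := eqVneq a 0.
  by exists 1; rewrite -[1 : R[i]]/(1%:C) !cabsR normr1 mulr0 normr0.
have ca : cabs a != 0 by apply: contra a0 => /eqP/cabs_eq0 ->.
exists ((cabs a)^-1%:C * Num.conj a); split.
  by rewrite cabsM cabsJ cabsR ger0_norm ?invr_ge0 ?cabs_ge0 // mulVf.
rewrite -mulrA (mulrC _ a) mulJ_cabs -rmorphM; congr _%:C.
by rewrite expr2 mulrA mulVf // mul1r.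
Qed.

Lemma dot_cauchy u v : cabs '[u, v] <= hnorm u * hnorm v.
Proof.
have [b [b1 hb]] := unit_phase '[u, v].
have := rdot_cauchy (b *: u) v.
by rewrite hnormZC b1 mul1r /rdot dotZl hb /= ger0_norm ?cabs_ge0.
Qed.

End inner_product.

(** * Convergence, projections and adjoints *)

Section convergence.
Context {R : realType} {H : hilbertType R}.
Implicit Types (u v w l : H) (S : set H).

Definition hcvg (u : nat -> H) l := hnorm (u n - l) @[n --> \oo] --> (0 : R).

Lemma squeeze0 (a b : nat -> R) (l : R) :
  (forall n, `|a n - l| <= b n) -> b n @[n --> \oo] --> (0 : R) ->
  a n @[n --> \oo] --> l.
Proof.
move=> h hb; apply/cvgrPdist_le => e e0.
move/cvgrPdist_le : hb => /(_ e e0); apply: filterS => n.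
rewrite sub0r normrN => hn; rewrite distrC.
by apply: le_trans (h n) (le_trans _ hn); rewrite ler_norm.
Qed.

Lemma hcvgP (u : nat -> H) l : hcvg u l <->
  forall e : R, 0 < e -> exists N, forall n, (N <= n)%N -> hnorm (u n - l) < e.
Proof.
split=> [/cvgrPdist_lt h e e0|h].
  have [N _ hN] := h e e0; exists N => n /hN /=.
  by rewrite sub0r normrN ger0_norm ?hnorm_ge0.
apply/cvgrPdist_lt => e /h[N hN]; exists N => // n /= /hN.
by rewrite sub0r normrN ger0_norm ?hnorm_ge0.
Qed.

Lemma harmonic_lt (e : R) : 0 < e ->
  exists N, forall n, (N <= n)%N -> n.+1%:R^-1 < e.
Proof.
move=> e0; have /cvgrPdist_lt /(_ e e0)[N _ hN] := @cvg_harmonic R.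
exists N => n /hN /=; rewrite sub0r normrN ger0_norm //.
Qed.

Lemma ball_hnorm u v (e : R) : ball u (e%:C : R[i]) v = (hnorm (u - v) < e) :> Prop.
Proof. by rewrite -ball_normE /= normC_hnorm ltcR. Qed.

(** The normed space is over [R[i]], so radii of balls are complex numbers; positivity forces them
    to be real, which allows real epsilons everywhere else. *)
Lemma posC_real (e : R[i]) : 0 < e -> e = (complex.Re e)%:C /\ 0 < complex.Re e.
Proof.
move=> e0; have er : e = (complex.Re e)%:C by rewrite RRe_real // gtr0_real.
by split => //; rewrite er ltcR in e0.
Qed.

Lemma hcomplete (u : nat -> H) :
  (forall e : R, 0 < e -> exists N, forall m n, (N <= m)%N -> (N <= n)%N ->
     hnorm (u m - u n) < e) ->
  exists l, hcvg u l.
Proof.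
move=> cu; have : cvg (u @ \oo).
  apply/cauchy_cvgP/cauchy_ballP => e /posC_real [-> e0].
  have [N hN] := cu _ e0.
  exists (u @` [set n | (N <= n)%N], u @` [set n | (N <= n)%N]).
    by split; exists N => // n /= Nn; exists n.
  by move=> [_ _] /= [[m Nm <-] [n Nn <-]]; rewrite ball_hnorm; exact: hN.
move=> /cvg_ex[l hl]; exists l; apply/hcvgP => e e0.
have : nbhs l (ball l (e%:C : R[i])) by apply: nbhsx_ballx; rewrite ltcR.
move=> /hl [N _ hN]; exists N => n /hN /=.
by rewrite ball_hnorm hnormB.
Qed.

Lemma closureP S u : closure S u <->
  forall e : R, 0 < e -> exists2 v, S v & hnorm (u - v) < e.
Proof.
split=> [h e e0|h A /nbhs_ballP [e /= /posC_real [-> e0] hA]].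
  have /h[v [Sv]] : nbhs u (ball u (e%:C : R[i])) by apply: nbhsx_ballx; rewrite ltcR.
  by rewrite ball_hnorm => ?; exists v.
by have [v Sv uv] := h _ e0; exists v; split => //; apply: hA; rewrite ball_hnorm.
Qed.

Lemma closedP S : closed S <-> forall u,
  (forall e : R, 0 < e -> exists2 v, S v & hnorm (u - v) < e) -> S u.
Proof.
split=> [cS u /closureP|h]; first by rewrite -(closure_id S).1.
by apply/closure_id/seteqP; split; [exact: subset_closure|move=> u /closureP/h].
Qed.

Lemma closed_hcvg S (u : nat -> H) l :
  closed S -> (forall n, S (u n)) -> hcvg u l -> S l.
Proof.
move=> /closedP cS Su /hcvgP ul; apply: cS => e /ul[N hN].
by exists (u N) => //; rewrite hnormB; exact: hN.
Qed.

Lemma approx_hcvg S u :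
  (forall e : R, 0 < e -> exists2 v, S v & hnorm (u - v) < e) ->
  exists v : nat -> H, (forall n, S (v n)) /\ hcvg v u.
Proof.
move=> h.
have /choice[v hv] : forall n, exists v, S v /\ hnorm (u - v) < n.+1%:R^-1.
  by move=> n; have [|v] := h n.+1%:R^-1; [rewrite invr_gt0|exists v].
exists v; split=> [n|]; first by have [] := hv n.
apply: (@squeeze0 _ (fun n => n.+1%:R^-1)); last exact: cvg_harmonic.
move=> n; rewrite subr0 ger0_norm ?hnorm_ge0 // hnormB.
by have [_ /ltW] := hv n.
Qed.

Lemma denseP S : dense S -> forall u (e : R), 0 < e ->
  exists2 v, S v & hnorm (u - v) < e.
Proof.
move=> dS u e e0.
have [||v [/= uv Sv]] := dS (ball u (e%:C : R[i])).
- by exists u; rewrite /= ball_hnorm subrr hnorm0.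
- by apply: ball_open; rewrite ltcR.
- by exists v => //; rewrite ball_hnorm in uv.
Qed.

(** A cluster point is approached within every tail, which yields [phi n] beyond [n]. Monotonicity
    of [phi] is not asked for: [n <= phi n] already transfers limits of the full sequence. *)
Lemma precompact_subseq S (u : nat -> H) : precompact S -> (forall n, S (u n)) ->
  exists l (phi : nat -> nat), (forall n, (n <= phi n)%N) /\ hcvg (u \o phi) l.
Proof.
rewrite precompactE => cS Su.
have FS : (u @ \oo) (closure S) by exists 0%N => // n _; exact: subset_closure.
have [l [_ hl]] := cS (u @ \oo) _ FS.
have /choice[phi hphi] : forall n, exists m, (n <= m)%N /\
    hnorm (l - u m) < n.+1%:R^-1.
  move=> n.
  have hb : nbhs l (ball l ((n.+1%:R^-1 : R)%:C : R[i])).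
    by apply: nbhsx_ballx; rewrite ltcR invr_gt0.
  have hi : (u @ \oo) [set u m | m in [set m | (n <= m)%N]].
    by exists n => // m /= nm; exists m.
  have [_ [[m /= nm <-]]] := hl _ _ hi hb.
  by rewrite ball_hnorm => hm; exists m.
exists l, phi; split=> [n|]; first by have [] := hphi n.
apply: (@squeeze0 _ (fun n => n.+1%:R^-1)); last exact: cvg_harmonic.
move=> n; rewrite subr0 ger0_norm ?hnorm_ge0 //= hnormB.
by have [_ /ltW] := hphi n.
Unshelve. all: by end_near.
Qed.

Lemma hcvg_norm (u : nat -> H) l : hcvg u l -> hnorm (u n) @[n --> \oo] --> hnorm l.
Proof.
move=> h; apply: squeeze0 h => n.
rewrite ler_norml lerBrDr addrC lerBlDr.
apply/andP; split.
  by have := hnormD (l - u n) (u n); rewrite subrK hnormB; lra.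
by have := hnormD (u n - l) l; rewrite subrK; lra.
Qed.

Lemma hcvg_rdot (u : nat -> H) l v : hcvg u l ->
  rdot (u n) v @[n --> \oo] --> rdot l v.
Proof.
move=> h; apply: (@squeeze0 _ (fun n => hnorm (u n - l) * hnorm v)).
  by move=> n; rewrite -rdotBl; exact: rdot_cauchy.
by rewrite -[X in _ --> X](mul0r (hnorm v)); apply: cvgMl.
Qed.

Lemma hcvg_rdotr (u : nat -> H) l v : hcvg u l ->
  rdot v (u n) @[n --> \oo] --> rdot v l.
Proof.
move=> /(@hcvg_rdot _ _ v); rewrite (rdotC l).
by under eq_fun do rewrite rdotC.
Qed.

Lemma hcvg_unique (u : nat -> H) l m : hcvg u l -> hcvg u m -> l = m.
Proof.
move=> /hcvgP hl /hcvgP hm; apply/eqP; rewrite -subr_eq0; apply/eqP/hnorm_eq0.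
apply/eqP; rewrite eq_le hnorm_ge0 andbT; apply/ler_addgt0Pl => e e0.
rewrite addr0; have e2 : 0 < e / 2 by rewrite divr_gt0.
have [N hN] := hl _ e2; have [M hM] := hm _ e2.
have := hnorm_triangle l (u (maxn N M)) m; rewrite (hnormB l (u _)).
have := hN _ (leq_maxl N M); have := hM _ (leq_maxr N M); lra.
Qed.

Lemma hcvgD (u v : nat -> H) l m : hcvg u l -> hcvg v m ->
  hcvg (fun n => u n + v n) (l + m).
Proof.
move=> hu hv; apply: (@squeeze0 _ (fun n => hnorm (u n - l) + hnorm (v n - m))).
  move=> n; rewrite subr0 ger0_norm ?hnorm_ge0 // opprD addrACA.
  exact: hnormD.
by rewrite -[X in _ --> X](addr0 0); apply: cvgD.
Qed.

Lemma hcvgZ (u : nat -> H) l (a : R[i]) : hcvg u l -> hcvg (fun n => a *: u n) (a *: l).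
Proof.
move=> hu; apply: (@squeeze0 _ (fun n => cabs a * hnorm (u n - l))).
  by move=> n; rewrite subr0 ger0_norm ?hnorm_ge0 // -scalerBr hnormZC.
by rewrite -[X in _ --> X](mulr0 (cabs a)); apply: cvgMr.
Qed.

Lemma hcvg_cst l : hcvg (fun=> l) l.
Proof. by rewrite /hcvg; under eq_fun do rewrite subrr hnorm0; exact: cvg_cst. Qed.

Lemma hcvg_lipschitz (K : H -> H) (M : R) (u : nat -> H) l :
  (forall v w, hnorm (K v - K w) <= M * hnorm (v - w)) ->
  hcvg u l -> hcvg (K \o u) (K l).
Proof.
move=> hK hu; apply: (@squeeze0 _ (fun n => M * hnorm (u n - l))).
  by move=> n; rewrite subr0 ger0_norm ?hnorm_ge0 //=; exact: hK.
by rewrite -[X in _ --> X](mulr0 M); apply: cvgMr.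
Qed.

Lemma rdot0_dense S u : dense S -> (forall v, S v -> rdot v u = 0) -> u = 0.
Proof.
move=> /denseP dS h; apply: hnorm_eq0.
have [v [Sv vu]] := approx_hcvg (dS u).
have : rdot (v n) u @[n --> \oo] --> (0 : R).
  by under eq_fun do rewrite h //; exact: cvg_cst.
move=> /(cvg_unique (@norm_hausdorff _ _) (hcvg_rdot (v := u) vu)) /eqP.
by rewrite rdotuu sqrf_eq0 => /eqP.
Qed.

End convergence.

Section subspaces.
Context {R : realType} {H : hilbertType R}.
Implicit Types (u v w : H) (L M : set H).

Lemma subspD L u v : lin_subspace L -> L u -> L v -> L (u + v).
Proof. by move=> [_ h] Lu Lv; have := h 1 u v Lu Lv; rewrite scale1r. Qed.

Lemma subspZ L a u : lin_subspace L -> L u -> L (a *: u).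
Proof. by move=> [L0 h] Lu; have := h a u 0 Lu L0; rewrite addr0. Qed.

Lemma subspB L u v : lin_subspace L -> L u -> L v -> L (u - v).
Proof. by move=> hL Lu Lv; rewrite -scaleN1r; apply: subspD => //; exact: subspZ. Qed.

Lemma subsp_sum L I (r : seq I) (P : pred I) (F : I -> H) : lin_subspace L ->
  (forall i, P i -> L (F i)) -> L (\sum_(i <- r | P i) F i).
Proof.
move=> hL hF; apply: big_ind => //; first by case: hL.
by move=> x y; exact: subspD.
Qed.

Lemma rdot_subsp0 L u : lin_subspace L -> (forall w, L w -> rdot u w = 0) ->
  forall w, L w -> '[u, w] = 0.
Proof.
move=> hL h w Lw; apply: dot_eq0C; apply: dot_rdot0.
  by rewrite rdotC h.
by rewrite rdotC h //; exact: subspZ.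
Qed.

(** A minimising sequence for the distance to [u] is Cauchy by the parallelogram law, because
    midpoints stay in [M]; minimality of the limit gives orthogonality. *)
Lemma projection_ex M u : lin_subspace M -> closed M ->
  exists2 p, M p & forall w, M w -> '[u - p, w] = 0.
Proof.
move=> hM cM; pose D := [set hnorm (u - w) ^+ 2 | w in M].
have hD : has_inf D.
  split; first by exists (hnorm (u - 0) ^+ 2); exists 0 => //; case: hM.
  by exists 0 => _ [w _ <-]; rewrite exprn_ge0 ?hnorm_ge0.
set d := inf D; pose h (n : nat) : R := n.+1%:R^-1.
have dle w : M w -> d <= hnorm (u - w) ^+ 2.
  by move=> Mw; apply: ge_inf; [case: hD|exists w].
have /choice[w hw] : forall n, exists w, M w /\ hnorm (u - w) ^+ 2 < d + h n.
  move=> n; have [|_ [w Mw <-] hw] := @inf_adherent R D (h n) _ hD.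
    by rewrite invr_gt0.
  by exists w.
have ww m n : hnorm (w m - w n) ^+ 2 <= 2 * h m + 2 * h n.
  have [Mm hm] := hw m; have [Mn hn] := hw n.
  have := parallelogram (u - w m) (u - w n).
  have -> : u - w m - (u - w n) = - (w m - w n).
    by rewrite !opprB addrC addrA subrK.
  rewrite hnormN.
  have -> : u - w m + (u - w n) = (2 : R)%:C *: (u - (2^-1 : R)%:C *: (w m + w n)).
    rewrite scalerBr scalerA -rmorphM divff // scale1r.
    rewrite rmorphD /= scalerDl scale1r.
    by rewrite addrACA opprD.
  rewrite hnormZ exprMn ger0_norm //.
  have := dle _ (subspZ (2^-1 : R)%:C hM (subspD hM Mm Mn)).
  have -> : (2 : R) ^+ 2 = 4 by ring.
  by move: hm hn; lra.
have [e e0|p wp] := @hcomplete _ _ w.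
  have [|N hN] := @harmonic_lt R (e ^+ 2 / 4); first by rewrite divr_gt0 ?exprn_gt0.
  exists N => m n /hN hm /hN hn.
  rewrite -ltr_sqr ?nnegrE ?hnorm_ge0 ?(ltW e0) //.
  by have := ww m n; move: hm hn; rewrite -/(h m) -/(h n); lra.
have Mp : M p by apply: closed_hcvg cM _ wp => n; have [] := hw n.
exists p => //; apply: rdot_subsp0 => // v Mv.
have dp : hnorm (u - p) ^+ 2 <= d.
  have uw : hcvg (fun n => u - w n) (u - p).
    by apply: hcvgD (hcvg_cst u) _; have := hcvgZ (-1) wp; under eq_fun do rewrite scaleN1r; rewrite scaleN1r.
  have h1 : hnorm (u - w n) ^+ 2 @[n --> \oo] --> hnorm (u - p) ^+ 2.
    by rewrite !expr2; apply: cvgM; exact: hcvg_norm.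
  have h2 : d + h n @[n --> \oo] --> d + 0.
    by apply: cvgD; [exact: cvg_cst|exact: cvg_harmonic].
  rewrite addr0 in h2.
  apply: ler_cvg_to h1 h2 _; near=> n.
  by have [_ /ltW] := hw n.
(* Minimality of [p] compared with the competitor [p + t v]; the best [t] is
   [(u - p, v) / |v|^2]. *)
have key (t : R) : 2 * t * rdot (u - p) v <= t ^+ 2 * hnorm v ^+ 2.
  have := dle _ (subspD hM Mp (subspZ t%:C hM Mv)).
  rewrite opprD addrA hnormB2 hnormZ exprMn real_normK ?num_real // rdotZr.
  by move: dp; lra.
have [->|v0] := eqVneq v 0; first by rewrite rdot0r.
have nv := exprn_gt0 2 (hnorm_gt0 v0).
have := key (rdot (u - p) v / hnorm v ^+ 2).
set r := rdot _ _; set n2 := hnorm v ^+ 2.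
have -> : 2 * (r / n2) * r = 2 * (r ^+ 2 / n2) by ring.
have -> : (r / n2) ^+ 2 * n2 = r ^+ 2 / n2 by field; rewrite gt_eqF.
move=> hr; have : r ^+ 2 / n2 <= 0 by move: hr; lra.
by rewrite pmulr_lle0 ?invr_gt0 // => h'; apply/eqP; rewrite -sqrf_eq0 eq_le h' sqr_ge0.
Unshelve. all: by end_near.
Qed.

(** The kernel of [f] is closed, and the component [q] orthogonal to it of any vector outside spans
    its complement; [z] is a multiple of [q]. *)
Lemma riesz (f : H -> R[i]) (M : R) :
  (forall a u v, f (a *: u + v) = a * f u + f v) ->
  (forall u, cabs (f u) <= M * hnorm u) ->
  exists z, forall u, f u = '[u, z].
Proof.
move=> fl fb.
have f0 : f 0 = 0 by apply: cabs_eq0; have := fb 0; rewrite hnorm0 mulr0 => h; apply/eqP; rewrite eq_le h cabs_ge0.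
have fZ a u : f (a *: u) = a * f u by rewrite -[a *: u]addr0 fl f0 addr0.
have fB u v : f (u - v) = f u - f v by rewrite addrC -scaleN1r fl mulN1r addrC.
pose K := [set u | f u = 0].
have sK : lin_subspace K.
  by split=> // a u v; rewrite /K /= fl => -> ->; rewrite mulr0 addr0.
have cK : closed K.
  apply/closedP => u hu; apply: cabs_eq0; apply/eqP; rewrite eq_le cabs_ge0 andbT.
  apply/ler_addgt0Pl => e e0; rewrite addr0.
  have M0 : 0 < `|M| + 1 by rewrite ltr_wpDl.
  have [|v Kv uv] := hu (e / (`|M| + 1)); first by rewrite divr_gt0.
  have -> : f u = f (u - v) by rewrite fB Kv subr0.
  apply: le_trans (fb _) _.
  apply: (@le_trans _ _ ((`|M| + 1) * hnorm (u - v))).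
    by apply: ler_wpM2r; [exact: hnorm_ge0|have := ler_norm M; lra].
  by rewrite mulrC -ler_pdivlMr // ltW.
have [[x0 fx0]|h] := pselect (exists x, f x != 0); last first.
  exists 0 => u; rewrite dot0r; apply/eqP; apply: contra_notT h => fu.
  by exists u.
have [p Kp hp] := projection_ex x0 sK cK; set q := x0 - p in hp.
have fq : f q != 0 by rewrite fB Kp subr0.
have q0 : q != 0 by apply: contraNneq fq => ->; rewrite f0.
have nq : (hnorm q ^+ 2)%:C != 0 :> R[i].
  by rewrite (inj_eq (@complexI R)) sqrf_eq0 gt_eqF ?hnorm_gt0.
exists (Num.conj (f q / (hnorm q ^+ 2)%:C) *: q) => u.
rewrite dotZr conjCK.
(* This combination is killed by [f], hence orthogonal to [q], which expresses [f u] through the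
   product of [u] and [q]. *)
have : K (f u *: q - f q *: u) by rewrite /K /= fB !fZ mulrC subrr.
move=> /hp /dot_eq0C; rewrite dotBl !dotZl dotuu => /eqP.
rewrite subr_eq0 => /eqP h; apply: (mulIf nq); rewrite h.
by rewrite mulrAC divfK.
Qed.

Lemma dot_inj u v : (forall w, '[w, u] = '[w, v]) -> u = v.
Proof.
move=> h; apply/eqP; rewrite -subr_eq0; apply/eqP/hnorm_eq0/eqP.
by rewrite -sqrf_eq0 -rdotuu /rdot dotBr h subrr.
Qed.

Lemma orth_projP M (P : H -> H) u p : lin_subspace M -> orth_proj M P ->
  M p -> (forall w, M w -> '[u - p, w] = 0) -> P u = p.
Proof.
move=> hM hP Mp h; have [MP h'] := hP u.
apply/eqP; rewrite -subr_eq0; apply/eqP/hnorm_eq0/eqP; rewrite -sqrf_eq0 -rdotuu /rdot.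
have Md : M (P u - p) by exact: subspB.
have -> : '[P u - p, P u - p] = '[u - p, P u - p] - '[u - P u, P u - p].
  by rewrite -dotBl opprB [u - p + _]addrC addrA subrK.
by rewrite h // h' // subrr.
Qed.

Section orthogonal_projection.
Variables (M : set H) (P : H -> H).
Hypotheses (hM : lin_subspace M) (hP : orth_proj M P).

Lemma projM u : M (P u). Proof. by case: (hP u). Qed.

Lemma projE u w : M w -> '[P u, w] = '[u, w].
Proof.
move=> Mw; have [_ /(_ w Mw)] := hP u.
by rewrite dotBl => /eqP; rewrite subr_eq0 => /eqP.
Qed.

Lemma proj_id u : M u -> P u = u.
Proof. by move=> Mu; apply: (orth_projP hM hP) => // w _; rewrite subrr dot0l. Qed.

Lemma proj_sym u v : '[P u, v] = '[u, P v].
Proof. by rewrite -(projE u (projM v)) dotC -(projE v (projM u)) -dotC. Qed.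

Lemma projP a u v : P (a *: u + v) = a *: P u + P v.
Proof.
apply: (orth_projP hM hP) => //.
  by case: hM => _ h; apply: h; exact: projM.
by move=> w Mw; rewrite dotBl !dotDl !dotZl !projE // subrr.
Qed.

Lemma proj_rdot u : rdot (P u) u = hnorm (P u) ^+ 2.
Proof. by rewrite rdotC -rdotuu /rdot (projE u (projM u)). Qed.

Lemma proj_pyth u : hnorm u ^+ 2 = hnorm (P u) ^+ 2 + hnorm (u - P u) ^+ 2.
Proof. by rewrite hnormB2 rdotC proj_rdot; ring. Qed.

Lemma proj_le u : hnorm (P u) <= hnorm u.
Proof.
rewrite -ler_sqr ?nnegrE ?hnorm_ge0 // (proj_pyth u) lerDl.
by rewrite exprn_ge0 ?hnorm_ge0.
Qed.

End orthogonal_projection.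

Lemma orth_proj_ex M : lin_subspace M -> closed M -> exists P : H -> H, orth_proj M P.
Proof.
move=> hM cM.
have /choice[P hP] : forall u, exists p, M p /\ forall w, M w -> '[u - p, w] = 0.
  by move=> u; have [p] := projection_ex u hM cM; exists p.
by exists P.
Qed.

End subspaces.

Section adjoints.
Context {R : realType} {H1 H2 : hilbertType R}.
Variable B : {linear H1 -> H2}.
Hypothesis bB : bounded_op B.

Lemma bounded_nonneg : exists2 M : R, 0 < M & forall x, hnorm (B x) <= M * hnorm x.
Proof.
case: bB => M hM; exists (`|M| + 1) => [|x]; first by rewrite ltr_wpDl.
apply: le_trans (hM x) _; apply: ler_wpM2r; first exact: hnorm_ge0.
by have := ler_norm M; lra.
Qed.

(** [adjoint] is a choice by [get]; Riesz representation of the bounded functional [x |-> (B x, y)]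
    makes the set chosen from non-empty. *)
Lemma adjointE x y : '[B x, y] = '[x, adjoint B y].
Proof.
have [M M0 hM] := bounded_nonneg.
have [||z hz] := @riesz _ _ (fun x => '[B x, y]) (M * hnorm y).
- by move=> a u v; rewrite linearP dotDl dotZl.
- move=> u; apply: le_trans (dot_cauchy _ _) _.
  by rewrite mulrAC; apply: ler_wpM2r; [exact: hnorm_ge0|exact: hM].
have : [set z | forall x, '[B x, y] = '[x, z]] (adjoint B y) by apply: (@getPex _ [set z | forall x, '[B x, y] = '[x, z]]); exists z.
exact.
Qed.

Lemma adjointEr x y : '[y, B x] = '[adjoint B y, x].
Proof. by rewrite dotC adjointE -dotC. Qed.

Lemma adjointP a u v : adjoint B (a *: u + v) = a *: adjoint B u + adjoint B v.
Proof.
by apply: dot_inj => w; rewrite -adjointE !dotDr !dotZr !adjointE.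
Qed.

Lemma adjoint0 : adjoint B 0 = 0.
Proof. by apply: dot_inj => w; rewrite -adjointE !dot0r. Qed.

Lemma adjointB u v : adjoint B (u - v) = adjoint B u - adjoint B v.
Proof. by rewrite addrC -scaleN1r adjointP scaleN1r addrC. Qed.

Lemma adjoint_bound (M : R) : 0 < M -> (forall x, hnorm (B x) <= M * hnorm x) ->
  forall y, hnorm (adjoint B y) <= M * hnorm y.
Proof.
move=> M0 hM y; have [h0|a0] := eqVneq (adjoint B y) 0.
  by rewrite h0 hnorm0 mulr_ge0 ?hnorm_ge0 // ltW.
rewrite -(ler_pM2r (hnorm_gt0 a0)) -expr2 -rdotuu /rdot -adjointE -/(rdot _ _).
apply: le_trans (ler_norm _) _; apply: le_trans (rdot_cauchy _ _) _.
by rewrite mulrAC; apply: ler_wpM2r; [exact: hnorm_ge0|exact: hM].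
Qed.

End adjoints.

(** * Finite families and dimension *)

Section finite_families.
Context {R : realType} {H : hilbertType R}.
Implicit Types (u v w : H) (L M : set H).

(** Dimension at least [n], as a proposition: the arguments compare natural numbers, and [hdim_geP]
    translates to extended reals. *)
Definition has_fam L n := exists e : 'I_n -> H, (forall i, L (e i)) /\ lin_indep e.

Definition orthonormal_fam n (g : 'I_n -> H) :=
  forall i j, '[g i, g j] = (i == j)%:R.

Definition span n (e : 'I_n -> H) : set H :=
  [set u | exists a : 'I_n -> R[i], u = \sum_(i < n) a i *: e i].

(** A matrix with more rows than columns has a nonzero vector in its left kernel. *)
Lemma nontrivial_relation m n (A : 'I_n -> 'I_m -> R[i]) : (m < n)%N ->
  exists a : 'I_n -> R[i], (exists i, a i != 0) /\
    forall j, \sum_(i < n) a i * A i j = 0.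
Proof.
move=> mn; pose M := \matrix_(i < n, j < m) A i j.
have : kermx M != 0.
  rewrite kermx_eq0 /row_free; apply/negP => /eqP h.
  by have := rank_leq_col M; rewrite h leqNgt mn.
move=> /rowV0Pn[v /sub_kermxP vM v0]; exists (v ord0); split.
  apply/existsP; apply: contraNT v0; rewrite negb_exists => /forallP h.
  apply/eqP/rowP => i; rewrite mxE; apply/eqP.
  by have := h i; rewrite negbK.
move=> j; have /matrixP/(_ ord0 j) := vM; rewrite !mxE => h; rewrite -[RHS]h.
by apply: eq_bigr => i _; rewrite mxE.
Qed.

Lemma lin_indep_neq0 n (e : 'I_n -> H) (a : 'I_n -> R[i]) : lin_indep e ->
  (exists i, a i != 0) -> \sum_(i < n) a i *: e i != 0.
Proof. by move=> he [i ai]; apply: contra_neqN ai => /eqP /he ->. Qed.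

(** The dimension count behind most upper bounds below: [m] orthogonality conditions are [m] linear
    equations in [n > m] coefficients. *)
Lemma exists_orthogonal m n (e : 'I_n -> H) (g : 'I_m -> H) : (m < n)%N ->
  lin_indep e ->
  exists u, [/\ span e u, u != 0 & forall j, '[u, g j] = 0].
Proof.
move=> mn he; have [a [a0 ha]] := nontrivial_relation (fun i j => '[e i, g j]) mn.
exists (\sum_(i < n) a i *: e i); split; [by exists a|exact: lin_indep_neq0|].
move=> j; rewrite dot_suml -[RHS](ha j).
by apply: eq_bigr => i _; rewrite dotZl.
Qed.

Lemma span_subspace n (e : 'I_n -> H) : lin_subspace (span e).
Proof.
split.
  by exists (fun=> 0); rewrite big1 // => i _; rewrite scale0r.
move=> a _ _ [x ->] [y ->]; exists (fun i => a * x i + y i).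
rewrite scaler_sumr -big_split /=; apply: eq_bigr => i _.
by rewrite scalerDl scalerA.
Qed.

Lemma span_mem n (e : 'I_n -> H) i : span e (e i).
Proof.
exists (fun j => (i == j)%:R); rewrite (bigD1 i) //= eqxx scale1r big1 ?addr0 //.
by move=> j /negbTE ij; rewrite eq_sym ij scale0r.
Qed.

Lemma span_sub L n (e : 'I_n -> H) : lin_subspace L -> (forall i, L (e i)) ->
  span e `<=` L.
Proof.
by move=> hL he _ [a ->]; apply: subsp_sum => // i _; exact: subspZ.
Qed.

Definition snoc_fam n (e : 'I_n -> H) u : 'I_n.+1 -> H :=
  fun i => if unlift ord0 i is Some j then e j else u.

Lemma snoc_fam0 n (e : 'I_n -> H) u : snoc_fam e u ord0 = u.
Proof. by rewrite /snoc_fam unlift_none. Qed.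

Lemma snoc_famS n (e : 'I_n -> H) u j : snoc_fam e u (lift ord0 j) = e j.
Proof. by rewrite /snoc_fam liftK. Qed.

Lemma snoc_fam_mem L n (e : 'I_n -> H) u : L u -> (forall i, L (e i)) ->
  forall i, L (snoc_fam e u i).
Proof. by move=> Lu he i; rewrite /snoc_fam; case: unlift. Qed.

Lemma has_famS L n : has_fam L n.+1 -> has_fam L n.
Proof.
case=> e [Le he]; exists (e \o lift ord0); split=> [i|a ha i]; first exact: Le.
pose b (i : 'I_n.+1) := if unlift ord0 i is Some j then a j else 0.
have := he b; rewrite big_ord_recl /b unlift_none scale0r add0r.
under eq_bigr do rewrite liftK.
by move=> /(_ ha) /(_ (lift ord0 i)); rewrite liftK.
Qed.

Lemma has_fam_le L m n : (m <= n)%N -> has_fam L n -> has_fam L m.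
Proof.
move=> /subnK <-; elim: (n - m)%N => // k IH; rewrite addSn.
by move=> /has_famS /IH.
Qed.

Lemma has_fam_sub L M n : L `<=` M -> has_fam L n -> has_fam M n.
Proof. by move=> LM [e [Le he]]; exists e; split => // i; apply: LM. Qed.

Lemma has_fam0 L : has_fam L 0.
Proof. by exists (fun=> 0); split => [[]|a _ []]. Qed.

(** Dropping vectors keeps independence, so the admissible sizes form an initial segment; a missing
    size [n] bounds the supremum by [n.-1]. *)
Lemma hdim_geP L n : (n%:R%:E <= hdim L)%E <-> has_fam L n.
Proof.
split=> [h|hn]; last by apply: ereal_sup_ubound; exists n.
apply: contrapT => hn.
have n0 : (0 < n)%N by case: n hn {h} => // /(_ (has_fam0 L)).
suff : (hdim L <= n.-1%:R%:E)%E.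
  by move=> /(le_trans h); rewrite lee_fin ler_nat leqNgt prednK // leqnn.
apply: ub_ereal_sup => _ [m hm <-]; rewrite lee_fin ler_nat.
rewrite -ltnS prednK // ltnNge; apply/negP => nm; apply: hn.
exact: has_fam_le nm hm.
Qed.

Lemma hdimP L k : hdim L = k%:R%:E <-> has_fam L k /\ ~ has_fam L k.+1.
Proof.
split=> [h|[h1 h2]].
  split; first by apply/hdim_geP; rewrite h.
  by move=> /hdim_geP; rewrite h lee_fin ler_nat ltnn.
apply/eqP; rewrite eq_le; apply/andP; split; last exact/hdim_geP.
apply: ub_ereal_sup => _ [m hm <-]; rewrite lee_fin ler_nat leqNgt.
by apply/negP => km; apply: h2; exact: has_fam_le km hm.
Qed.

Lemma hdim_infty L : hdim L = +oo%E <-> forall n, has_fam L n.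
Proof.
split=> [h n|h]; first by apply/hdim_geP; rewrite h leey.
have h0 : (0%:R%:E <= hdim L)%E by apply/hdim_geP.
case E : (hdim L) h0 => [r| |] // _.
have := (hdim_geP L (Num.truncn r).+1).2 (h _); rewrite E lee_fin leNgt.
by rewrite truncnS_gt.
Qed.

Lemma hdim_sub L M : L `<=` M -> (hdim L <= hdim M)%E.
Proof.
move=> LM; apply: ub_ereal_sup => _ [n hn <-]; apply/hdim_geP.
exact: has_fam_sub hn.
Qed.

Lemma no_fam_orthogonal L k (g : 'I_k -> H) : lin_subspace L ->
  (forall u, L u -> (forall i, '[u, g i] = 0) -> u = 0) -> ~ has_fam L k.+1.
Proof.
move=> hL h [e [Le he]]; have [u [su u0 hu]] := exists_orthogonal g (ltnSn k) he.
by move/eqP: u0; apply; apply: h => //; exact: span_sub su.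
Qed.

Lemma dot_orthonormal n (g : 'I_n -> H) (a : 'I_n -> R[i]) j : orthonormal_fam g ->
  '[\sum_(i < n) a i *: g i, g j] = a j.
Proof.
move=> hg; rewrite dot_suml (bigD1 j) //= dotZl hg eqxx mulr1 big1 ?addr0 //.
by move=> i /negbTE ij; rewrite dotZl hg ij mulr0.
Qed.

Lemma orthonormal_lin_indep n (g : 'I_n -> H) : orthonormal_fam g -> lin_indep g.
Proof. by move=> hg a h i; rewrite -(dot_orthonormal a i hg) h dot0l. Qed.

Lemma hdim_orthonormal L k (g : 'I_k -> H) : lin_subspace L ->
  orthonormal_fam g -> (forall i, L (g i)) ->
  (forall u, L u -> (forall i, '[u, g i] = 0) -> u = 0) -> hdim L = k%:R%:E.
Proof.
move=> hL hg Lg h; apply/hdimP; split; last exact: no_fam_orthogonal h.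
by exists g; split => //; exact: orthonormal_lin_indep.
Qed.

Lemma hnorm_orthonormal n (g : 'I_n -> H) (a : 'I_n -> R[i]) : orthonormal_fam g ->
  hnorm (\sum_(i < n) a i *: g i) ^+ 2 = \sum_(i < n) cabs (a i) ^+ 2.
Proof.
move=> hg; rewrite -rdotuu rdot_suml; apply: eq_bigr => i _.
by rewrite /rdot dotZl dotC dot_orthonormal // mulJ_cabs.
Qed.

Lemma orthonormal_snoc n (g : 'I_n -> H) u : orthonormal_fam g -> u != 0 ->
  (forall i, '[u, g i] = 0) ->
  orthonormal_fam (snoc_fam g ((hnorm u)^-1%:C *: u)).
Proof.
move=> hg u0 hu i j; rewrite /snoc_fam.
case: unliftP => [i' ->|->]; case: unliftP => [j' ->|->].
- by rewrite hg (inj_eq lift_inj).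
- by rewrite dotZr (dot_eq0C (hu _)) mulr0 eq_sym (negbTE (neq_lift _ _)).
- by rewrite dotZl hu mulr0 (negbTE (neq_lift _ _)).
- rewrite eqxx dotuu hnormZ ger0_norm ?invr_ge0 ?hnorm_ge0 //.
  by rewrite mulVf ?expr1n // gt_eqF // hnorm_gt0.
Qed.

(** Instead of Gram-Schmidt formulas: the next vector is a normalised element of the span orthogonal
    to the earlier ones, found by counting dimensions. *)
Lemma has_fam_orthonormal L n : lin_subspace L -> has_fam L n ->
  exists g : 'I_n -> H, (forall i, L (g i)) /\ orthonormal_fam g.
Proof.
move=> hL; elim: n => [|n IH] h.
  by exists (fun=> 0); split => [[]|[]].
have [g [Lg hg]] := IH (has_famS h); case: h => e [Le he].
have [u [su u0 hu]] := exists_orthogonal g (ltnSn n) he.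
exists (snoc_fam g ((hnorm u)^-1%:C *: u)); split.
  by apply: snoc_fam_mem => //; apply: subspZ => //; exact: span_sub su.
exact: orthonormal_snoc.
Qed.

Lemma finite_dim_span L k : lin_subspace L -> has_fam L k -> ~ has_fam L k.+1 ->
  exists e : 'I_k -> H, [/\ lin_indep e, forall i, L (e i) & L = span e].
Proof.
move=> hL [e [Le he]] h; exists e; split => //; apply/seteqP; split; last exact: span_sub.
move=> u Lu; apply: contrapT => hu; apply: h.
exists (snoc_fam e u); split=> [|a]; first exact: snoc_fam_mem.
rewrite big_ord_recl snoc_fam0.
under eq_bigr do rewrite snoc_famS.
have [a0|a0] := eqVneq (a ord0) 0.
  rewrite a0 scale0r add0r => /he ha i.
  by case: (unliftP ord0 i) => [j ->|->].
move=> /eqP; rewrite addrC addr_eq0 => /eqP h; exfalso; apply: hu.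
exists (fun j => - (a ord0)^-1 * a (lift ord0 j)).
under eq_bigr do rewrite -scalerA.
by rewrite -scaler_sumr h scalerN scaleNr opprK scalerA mulVf // scale1r.
Qed.

Lemma span_no_fam n (e : 'I_n -> H) : ~ has_fam (span e) n.+1.
Proof.
case=> f [/choice[c hc] hf].
have [a [a0 ha]] := nontrivial_relation c (ltnSn n).
have := lin_indep_neq0 hf a0.
under eq_bigr do rewrite hc scaler_sumr.
rewrite exchange_big /= big1 ?eqxx // => j _.
under eq_bigr do rewrite scalerA.
by rewrite -scaler_suml ha scale0r.
Qed.

Lemma hdim_span n (e : 'I_n -> H) : lin_indep e -> hdim (span e) = n%:R%:E.
Proof.
move=> he; apply/hdimP; split; last exact: span_no_fam.
by exists e; split => // i; exact: span_mem.
Qed.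

End finite_families.

(** Each coefficient is at most the norm of the orthonormal combination, so the map sending [g i] to
    [e i] is bounded. This controls the unbounded operator [A] on a finite-dimensional space. *)
Lemma span_hnorm_le {R : realType} (H1 H2 : hilbertType R) n (e : 'I_n -> H1)
    (g : 'I_n -> H2) : orthonormal_fam g ->
  exists2 C : R, 0 < C & forall a : 'I_n -> R[i],
    hnorm (\sum_(i < n) a i *: e i) <= C * hnorm (\sum_(i < n) a i *: g i).
Proof.
move=> hg; pose C := 1 + \sum_(i < n) hnorm (e i); exists C.
  by rewrite ltr_pwDl // sumr_ge0 // => i _; exact: hnorm_ge0.
move=> a; set v := \sum_(i < n) a i *: g i.
have ha i : cabs (a i) <= hnorm v.
  rewrite -ler_sqr ?nnegrE ?cabs_ge0 ?hnorm_ge0 // hnorm_orthonormal //.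
  by rewrite (bigD1 i) //= lerDl sumr_ge0 // => j _; rewrite exprn_ge0 ?cabs_ge0.
apply: (@le_trans _ _ (\sum_(i < n) cabs (a i) * hnorm (e i))).
  elim/big_rec2: _ => [|i x y _ h]; first by rewrite hnorm0.
  by apply: le_trans (hnormD _ _) _; rewrite hnormZC lerD2l.
apply: (@le_trans _ _ (\sum_(i < n) hnorm v * hnorm (e i))).
  by apply: ler_sum => i _; apply: ler_wpM2r; [exact: hnorm_ge0|exact: ha].
rewrite -mulr_sumr mulrC; apply: ler_wpM2r; first exact: hnorm_ge0.
by rewrite /C lerDr.
Qed.

(** * Rayleigh quotients on finite-dimensional subspaces *)

Section linear_operators.
Context {R : realType} {H : hilbertType R}.
Variable T : operator H.
Hypothesis lT : linear_operator T.
Implicit Types (u v w : H).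

Lemma dom_subspace : lin_subspace (dom T). Proof. by case: lT. Qed.

Lemma operP (a : R[i]) u v : dom T u -> dom T v -> T (a *: u + v) = a *: T u + T v.
Proof. by case: lT => _; exact. Qed.

Lemma oper0 : T 0 = 0.
Proof.
have [d0 _] := dom_subspace.
by have := operP (-1) d0 d0; rewrite !scaleN1r oppr0 addr0 addNr.
Qed.

Lemma operZ (a : R[i]) u : dom T u -> T (a *: u) = a *: T u.
Proof.
move=> du; have [d0 _] := dom_subspace.
by have := operP a du d0; rewrite oper0 !addr0.
Qed.

Lemma operD u v : dom T u -> dom T v -> T (u + v) = T u + T v.
Proof. by move=> du dv; have := operP 1 du dv; rewrite !scale1r. Qed.

Lemma operB u v : dom T u -> dom T v -> T (u - v) = T u - T v.
Proof.
by move=> du dv; rewrite addrC -scaleN1r operP // scaleN1r addrC.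
Qed.

Lemma oper_sum I (r : seq I) (P : pred I) (F : I -> H) :
  (forall i, P i -> dom T (F i)) ->
  T (\sum_(i <- r | P i) F i) = \sum_(i <- r | P i) T (F i).
Proof.
move=> dF; have : dom T (\sum_(i <- r | P i) F i) /\
    T (\sum_(i <- r | P i) F i) = \sum_(i <- r | P i) T (F i).
  elim/big_rec2: _ => [|i y x Pi [dx Tx]].
    by split; [case: dom_subspace|exact: oper0].
  by split; [apply: subspD => //; [exact: dom_subspace|exact: dF]|
             rewrite operD ?Tx //; exact: dF].
by case.
Qed.

End linear_operators.

Section rayleigh_max.
Context {R : realType} {H Hhat : hilbertType R}.
Variables (A : operator H) (B : {linear Hhat -> H}) (c : R).
Hypotheses (lA : linear_operator A) (bB : bounded_op B).
Implicit Types (u v w : H).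

Lemma pmZ sgn (t : R) u : dom A u -> t != 0 ->
  pm A B c sgn (t%:C *: u) = pm A B c sgn u.
Proof.
move=> du t0; have [->|u0] := eqVneq u 0; first by rewrite scaler0.
have nu : hnorm u != 0 by rewrite gt_eqF // hnorm_gt0.
have aZ : adjoint B (t%:C *: u) = t%:C *: adjoint B u.
  by have := adjointP bB t%:C u 0; rewrite !addr0 adjoint0 // addr0.
rewrite /pm operZ // aZ -/(rdot _ _) -/(rdot _ _) rdotZl rdotZr !hnormZ.
rewrite !exprMn !real_normK ?num_real //.
have -> : t * (t * rdot (A u) u) / (t ^+ 2 * hnorm u ^+ 2) = rdot (A u) u / hnorm u ^+ 2.
  by field; rewrite t0 nu.
have -> : t ^+ 2 * hnorm (adjoint B u) ^+ 2 / (t ^+ 2 * hnorm u ^+ 2) =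
  hnorm (adjoint B u) ^+ 2 / hnorm u ^+ 2 by field; rewrite t0 nu.
by [].
Qed.

Section real_coordinates.
Variables (m : nat) (g : 'I_m -> H).

Definition rcomb (x : 'rV[R]_m) : H := \sum_(i < m) (x ord0 i)%:C *: g i.

Lemma rcombZ (t : R) x : rcomb (t *: x) = t%:C *: rcomb x.
Proof.
rewrite /rcomb scaler_sumr; apply: eq_bigr => i _.
by rewrite mxE rmorphM scalerA.
Qed.

Lemma quadratic_continuous (Q : 'I_m -> 'I_m -> R) :
  continuous (fun x : 'rV[R]_m => \sum_i \sum_j x ord0 i * x ord0 j * Q i j).
Proof.
move=> x; have FF : Filter (nbhs x) := nbhs_filter x.
apply: (@cvg_big _ _ +%R) => [|i _]; first exact: add_continuous.
apply: (@cvg_big _ _ +%R) => [|j _]; first exact: add_continuous.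
apply: cvgMl; apply: cvgM; exact: coord_continuous.
Qed.

Lemma rdot_rcomb (K : hilbertType R) (f h : H -> K) x :
  f (rcomb x) = \sum_(i < m) (x ord0 i)%:C *: f (g i) ->
  h (rcomb x) = \sum_(i < m) (x ord0 i)%:C *: h (g i) ->
  rdot (f (rcomb x)) (h (rcomb x)) =
  \sum_i \sum_j x ord0 i * x ord0 j * rdot (f (g i)) (h (g j)).
Proof.
move=> -> ->; rewrite rdot_suml; apply: eq_bigr => i _.
rewrite rdotC rdot_suml; apply: eq_bigr => j _.
by rewrite rdotZl rdotC rdotZl; ring.
Qed.

Hypothesis dg : forall i, dom A (g i).
Hypothesis gI : forall x, rcomb x = 0 -> x = 0.

Lemma rcomb_dom x : dom A (rcomb x).
Proof.
by apply: subsp_sum => [|i _]; [exact: dom_subspace|apply: subspZ => //; exact: dom_subspace].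
Qed.

Lemma pm_rcomb_continuous sgn (x : 'rV[R]_m) : x != 0 ->
  {for x, continuous (fun x => pm A B c sgn (rcomb x))}.
Proof.
move=> x0.
have c1 : (fun x => complex.Re '[A (rcomb x), rcomb x]) =
   fun x => \sum_i \sum_j x ord0 i * x ord0 j * rdot (A (g i)) (g j).
  apply/funext => y; apply: (@rdot_rcomb H A id) => //.
  rewrite oper_sum //; first by apply: eq_bigr => i _; rewrite operZ.
  by move=> i _; apply: subspZ => //; exact: dom_subspace.
have c2 : (fun x => hnorm (rcomb x) ^+ 2) =
   fun x => \sum_i \sum_j x ord0 i * x ord0 j * rdot (g i) (g j).
  by apply/funext => y; rewrite -rdotuu; apply: (@rdot_rcomb H id id).
have c3 : (fun x => hnorm (adjoint B (rcomb x)) ^+ 2) =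
   fun x => \sum_i \sum_j x ord0 i * x ord0 j * rdot (adjoint B (g i)) (adjoint B (g j)).
  apply/funext => y; rewrite -rdotuu; apply: (@rdot_rcomb Hhat (adjoint B) (adjoint B)).
    rewrite /rcomb; elim/big_rec2: _ => [|i u v _ <-]; first by rewrite adjoint0.
    by rewrite adjointP.
  rewrite /rcomb; elim/big_rec2: _ => [|i u v _ <-]; first by rewrite adjoint0.
  by rewrite adjointP.
have k1 : {for x, continuous (fun x => complex.Re '[A (rcomb x), rcomb x])}.
  by rewrite c1; exact: quadratic_continuous.
have k2 : {for x, continuous (fun x => hnorm (rcomb x) ^+ 2)}.
  by rewrite c2; exact: quadratic_continuous.
have k3 : {for x, continuous (fun x => hnorm (adjoint B (rcomb x)) ^+ 2)}.
  by rewrite c3; exact: quadratic_continuous.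
have n0 : hnorm (rcomb x) ^+ 2 != 0.
  rewrite sqrf_eq0; apply: contra x0 => /eqP /hnorm_eq0 /gI ->.
  exact: eqxx.
have FF : Filter (nbhs x) := nbhs_filter x.
have k2V : {for x, continuous (fun x => (hnorm (rcomb x) ^+ 2)^-1)} by exact: cvgV.
have k4 := cvgM k1 k2V.
have k5 := cvgM k3 k2V.
rewrite /pm; apply: cvgD.
  by apply: cvgMr; apply: cvgD; [exact: k4|exact: cvg_cst].
apply: cvgMr; apply: continuous_cvg; first exact: sqrt_continuous.
apply: cvgD; last exact: k5.
apply: cvgMr; rewrite !expr2.
by apply: cvgM; (apply: cvgB; [exact: k4|exact: cvg_cst]).
Qed.

(** [pm] is homogeneous of degree 0 under real scaling, so its maximum over the compact unit sphere
    of coordinates is a maximum over all nonzero vectors. *)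
Lemma rcomb_pm_max sgn : (0 < m)%N ->
  exists x0 : 'rV[R]_m, x0 != 0 /\
    forall x : 'rV[R]_m, x != 0 -> pm A B c sgn (rcomb x) <= pm A B c sgn (rcomb x0).
Proof.
move=> m0; pose S := [set x : 'rV[R]_m | `|x| = 1].
have S0 : S !=set0.
  have d0 : const_mx 1 != 0 :> 'rV[R]_m.
    by apply/eqP => /matrixP/(_ ord0 (Ordinal m0)) /eqP; rewrite !mxE oner_eq0.
  exists (`|const_mx 1 : 'rV[R]_m|^-1 *: const_mx 1).
  by rewrite /S /= normrZ normfV normr_id mulVf // normr_eq0.
have Sn0 x : S x -> x != 0.
  by move=> Sx; apply/eqP => h; move: Sx; rewrite h /S /= normr0 => /eqP; rewrite eq_sym oner_eq0.
have cS : compact S.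
  apply: bounded_closed_compact.
    by exists 1; split => // M M1 x Sx; rewrite /= Sx ltW.
  have -> : S = (fun x : 'rV[R]_m => `|x|) @^-1` [set 1] by [].
  by apply: closed_comp; [move=> y _; exact: norm_continuous|exact: closed_eq].
have cp x : x \in S -> {for x, continuous (fun x => pm A B c sgn (rcomb x))}.
  by move=> /set_mem/Sn0; exact: pm_rcomb_continuous.
have [x0 x0S hmax] := compact_EVT_max S0 cS (continuous_in_subspaceT cp).
exists x0; split; first exact: Sn0 (set_mem x0S).
move=> x xn0; have nx : `|x| != 0 by rewrite normr_eq0.
have := hmax (`|x|^-1 *: x); rewrite rcombZ pmZ ?invr_eq0 //; last exact: rcomb_dom.
apply.
by apply/mem_set; rewrite /S /= normrZ normfV normr_id mulVf.
Qed.

End real_coordinates.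

(** [is_minmax] requires an attained maximum on every admissible subspace; compactness in finite
    dimension supplies it. *)
Lemma pm_has_max sgn k (L : set H) : lin_subspace L -> L `<=` dom A ->
  hdim L = k.+1%:R%:E ->
  exists M, is_max (pm A B c sgn @` [set u | L u /\ u != 0]) M.
Proof.
move=> hL LA /hdimP[hk hk1]; have [e [he Le Lspan]] := finite_dim_span hL hk hk1.
(* The vectors [e j] and [i e j] form a real basis: complex coordinates become twice as many real
   ones, where spheres are compact. *)
pose g (i : 'I_(k.+1 + k.+1)) : H :=
  match fintype.split i with inl j => e j | inr j => 'i%C *: e j end.
have gl j : g (lshift _ j) = e j by rewrite /g (unsplitK (inl _ j)).
have gr j : g (rshift _ j) = 'i%C *: e j by rewrite /g (unsplitK (inr _ j)).
have combE (x : 'rV[R]_(k.+1 + k.+1)) : rcomb g x =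
   \sum_(j < k.+1) (x ord0 (lshift _ j) +i* x ord0 (rshift _ j)) *: e j.
  rewrite /rcomb big_split_ord /= -big_split; apply: eq_bigr => j _ /=.
  rewrite gl gr scalerA -scalerDl; congr (_ *: _).
  by rewrite [RHS]complexE /= mulrC.
have dg i : dom A (g i).
  apply: LA; rewrite /g; case: fintype.split => j; first exact: Le.
  by apply: subspZ.
have gI x : rcomb g x = 0 -> x = 0.
  rewrite combE => /he h; apply/rowP => i; rewrite mxE.
  by rewrite -(splitK i); case: (fintype.split i) => j /=; have [h1 h2] := h j.
have [x0 [x00 hx0]] := rcomb_pm_max dg gI sgn isT.
exists (pm A B c sgn (rcomb g x0)); split.
  exists (rcomb g x0) => //; split; last by apply: contra_neq x00 => /gI.
  by rewrite combE Lspan; eexists.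
move=> _ [u [Lu u0] <-]; move: Lu; rewrite Lspan => -[a ua].
pose x : 'rV[R]_(k.+1 + k.+1) := \row_i match fintype.split i with
  | inl j => complex.Re (a j) | inr j => complex.Im (a j) end.
have -> : u = rcomb g x.
  rewrite combE ua; apply: eq_bigr => j _; congr (_ *: _).
  by rewrite !mxE (unsplitK (inl _ j)) (unsplitK (inr _ j)); case: (a j).
apply: hx0; apply: contraNneq u0 => x0'.
rewrite ua; suff a0 j : a j = 0 by rewrite big1 // => j _; rewrite a0 scale0r.
have /rowP hx := x0'.
have := hx (lshift _ j); have := hx (rshift _ j).
rewrite !mxE (unsplitK (inl _ j)) (unsplitK (inr _ j)).
by case: (a j) => ? ? /= -> ->.
Qed.

End rayleigh_max.

(** * Perturbation and compactness of self-adjoint operators *)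

Section inverse_operator.
Context {R : realType} {H : hilbertType R}.
Variable T : operator H.
Implicit Types (u v w : H).

Lemma bounded_inverse_ex (d : R) : linear_operator T -> 0 < d ->
  (forall u, dom T u -> d * hnorm u <= hnorm (T u)) ->
  (forall v, exists2 u, dom T u & T u = v) ->
  exists K : {linear H -> H}, bounded_inverse T K.
Proof.
move=> lT d0 hd hs.
have inj u v : dom T u -> dom T v -> T u = T v -> u = v.
  move=> du dv Tuv; apply/eqP; rewrite -subr_eq0; apply/eqP/hnorm_eq0.
  have := hd (u - v) (subspB (dom_subspace lT) du dv).
  rewrite operB // Tuv subrr hnorm0 => h; apply/eqP; rewrite eq_le hnorm_ge0 andbT.
  by rewrite -(ler_pM2l d0) mulr0.
have /choice[K hK] : forall v, exists u, dom T u /\ T u = v.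
  by move=> v; have [u] := hs v; exists u.
have Klin : linear K.
  move=> a u v; have [d1 e1] := hK (a *: u + v); have [d2 e2] := hK u.
  have [d3 e3] := hK v; apply: inj => //.
    by apply: (dom_subspace lT).2.
  by rewrite operP // e1 e2 e3.
pose lK := GRing.isLinear.Build _ _ _ _ K Klin.
pose KL : {linear H -> H} := HB.pack K lK.
exists KL; split => //.
  exists d^-1 => v; have [dK TK] := hK v.
  by rewrite mulrC ler_pdivlMr // mulrC -{2}TK; exact: hd.
by move=> u du; have [dK TK] := hK (T u); exact: inj.
Qed.

Lemma bounded_inverse_sub0 (K : {linear H -> H}) :
  bounded_inverse T K -> resolvent_set T 0.
Proof.
case=> [bK h1 h2]; exists K; split => //=.
  by move=> v; have [? ?] := h1 v; rewrite scale0r subr0.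
by move=> u du; rewrite scale0r subr0 h2.
Qed.

End inverse_operator.

Section selfadjoint_operators.
Context {R : realType} {H : hilbertType R}.
Variable T : operator H.
Hypothesis saT : selfadjoint T.
Implicit Types (u v w : H).

Let lT : linear_operator T. Proof. by case: saT. Qed.

Lemma sa_sym u v : dom T u -> dom T v -> '[T u, v] = '[u, T v].
Proof. by case: saT => _ _ /(_ v (T v)) [h _] du dv; apply: h. Qed.

Lemma sa_rdot u v : dom T u -> dom T v -> rdot (T u) v = rdot u (T v).
Proof. by move=> du dv; rewrite /rdot sa_sym. Qed.

Lemma sa_real u : dom T u -> '[T u, u] = (rdot (T u) u)%:C.
Proof.
move=> du; rewrite /rdot RRe_real //.
by apply/CrealP; rewrite -dotC sa_sym.
Qed.

(** Real parts suffice because [dom T] is stable under multiplication by i. Membership in the domain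
    is the real gain: it is obtained from weak identities. *)
Lemma sa_dom v w : (forall u, dom T u -> rdot (T u) v = rdot u w) ->
  dom T v /\ T v = w.
Proof.
case: saT => _ _ /(_ v w) [_ h] hv; apply: h => u du.
have du' : dom T ('i%C *: u) by apply: subspZ => //; exact: dom_subspace.
apply/eqP; rewrite -subr_eq0; apply/eqP/complex_eq0.
  by rewrite ReD ReN -/(rdot _ _) -/(rdot _ _) hv // subrr.
rewrite mulrBr ReD ReN -!dotZl -operZ // -/(rdot _ _) -/(rdot _ _) hv //.
by rewrite subrr.
Qed.

(** A self-adjoint operator is closed: the symmetry identity passes to the limit, and [sa_dom] reads
    it back. *)
Lemma sa_closed (u : nat -> H) l m : (forall n, dom T (u n)) ->
  hcvg u l -> hcvg (fun n => T (u n)) m -> dom T l /\ T l = m.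
Proof.
move=> du ul um; apply: sa_dom => v dv.
have h1 := hcvg_rdotr (v := T v) ul; have h2 := hcvg_rdotr (v := v) um.
move: h2; under eq_fun do rewrite -sa_rdot //.
by move=> h2; apply: cvg_unique h1 h2; exact: norm_hausdorff.
Qed.

Section perturbation.
Variables (D D' : H -> H) (M : R).
Hypotheses (Dlin : forall a u v, D (a *: u + v) = a *: D u + D v)
  (DD' : forall u v, '[D u, v] = '[u, D' v])
  (DM : forall u, hnorm (D u) <= M * hnorm u).

Definition perturb : operator H := Operator (dom T) (fun u => T u + D u).

Lemma perturb_linear : linear_operator perturb.
Proof.
split=> [|a u v du dv /=]; first exact: (dom_subspace lT).
by rewrite operP // Dlin scalerDr addrACA.
Qed.

Let DB u v : D (u - v) = D u - D v.
Proof. by rewrite addrC -scaleN1r Dlin scaleN1r addrC. Qed.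

(** The lower bound and closedness of [T] make the range closed; a vector orthogonal to the range
    lies in the kernel of the adjoint [T + D'], hence vanishes. *)
Lemma perturb_surjective (d : R) : 0 < d ->
  (forall u, dom T u -> d * hnorm u <= hnorm (T u + D u)) ->
  (forall u, dom T u -> T u + D' u = 0 -> u = 0) ->
  forall v, exists2 u, dom T u & T u + D u = v.
Proof.
move=> d0 hd hk v.
pose Rg := [set w | exists2 u, dom T u & T u + D u = w].
have sR : lin_subspace Rg.
  split=> [|a _ _ [x dx <-] [y dy <-]].
    exists 0; first by case: (dom_subspace lT).
    by rewrite oper0 // add0r; have := DB 0 0; rewrite !subrr.
  exists (a *: x + y); first by apply: (dom_subspace lT).2.
  exact: (perturb_linear.2).
have cR : closed Rg.
  apply/closedP => w hw; have [z [Rz zw]] := approx_hcvg hw.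
  have /choice[u hu] : forall n, exists u, dom T u /\ T u + D u = z n.
    by move=> n; have [u] := Rz n; exists u.
  have [e e0|l ul] := @hcomplete _ _ u.
    have de0 : 0 < d * e / 2 by rewrite divr_gt0 // mulr_gt0.
    have /hcvgP/(_ _ de0)[N hN] := zw.
    exists N => m n mN nN; rewrite -(ltr_pM2l d0).
    have [d1 e1] := hu m; have [d2 e2] := hu n.
    apply: le_lt_trans (hd _ (subspB (dom_subspace lT) d1 d2)) _.
    rewrite operB // DB addrACA -opprD e1 e2.
    apply: le_lt_trans (hnorm_triangle _ w _) _; rewrite (hnormB w).
    by have := hN _ mN; have := hN _ nN; lra.
  have Du : hcvg (fun n => D (u n)) (D l).
    by apply: (hcvg_lipschitz (M := M) _ ul) => x y; rewrite -DB; exact: DM.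
  have Tu : hcvg (fun n => T (u n)) (w - D l).
    have := hcvgD zw (hcvgZ (-1) Du); rewrite scaleN1r.
    congr (_ _ _); apply/funext => n; have [_ <-] := hu n.
    by rewrite scaleN1r addrK.
  have [dl Tl] := sa_closed (fun n => (hu n).1) ul Tu.
  by exists l => //; rewrite Tl subrK.
have [p Rp hp] := projection_ex v sR cR.
(* Orthogonality to the range says [(T u, v - p) = (u, - D' (v - p))] in real parts for all [u] in
   the domain. *)
have [dw Tw] : dom T (v - p) /\ T (v - p) = - D' (v - p).
  apply: sa_dom => u du; apply/eqP; rewrite -subr_eq0 /rdot dotNr ReN opprK.
  rewrite -DD' -ReD -dotDl -/(rdot _ _) rdotC /rdot hp //.
  by exists u.
have := hk _ dw; rewrite Tw addNr => /(_ erefl) /eqP.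
by rewrite subr_eq0 => /eqP ->.
Qed.

Lemma perturb_selfadjoint : (forall u, D' u = D u) -> selfadjoint perturb.
Proof.
move=> D'D; split; [exact: perturb_linear|by case: saT|].
move=> v w /=; split=> [[dv <-] u du|h].
  by rewrite dotDl dotDr sa_sym // DD' D'D.
case: saT => _ _ /(_ v (w - D v)) [_ h'].
have [|dv ->] := h'; last by rewrite subrK.
move=> u du; apply/eqP; rewrite dotBr -subr_eq0 opprB addrA subr_eq0.
by rewrite -D'D -DD' -dotDl h.
Qed.

Lemma perturb_bounded_below : bounded_below T -> bounded_below perturb.
Proof.
case=> g hg; exists (g - M) => u du /=.
rewrite dotDl ReD mulrBl; apply: lerD; first exact: hg.
rewrite lerNl; apply: le_trans (ler_norm _) _; rewrite normrN.
apply: le_trans (rdot_cauchy _ _) _.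
by rewrite expr2 mulrA; apply: ler_wpM2r; [exact: hnorm_ge0|exact: DM].
Qed.

End perturbation.

(* every graph-bounded sequence has a convergent subsequence: an
   inverse-free form of compactness of the resolvent, stable under bounded
   perturbations *)
Definition graph_compact (S : operator H) := forall (C : R) (u : nat -> H),
  (forall n, dom S (u n)) -> (forall n, hnorm (u n) <= C) ->
  (forall n, hnorm (S (u n)) <= C) ->
  exists l (phi : nat -> nat), (forall n, (n <= phi n)%N) /\ hcvg (u \o phi) l.

Lemma compact_resolvent_graph : compact_resolvent T -> graph_compact T.
Proof.
case=> z [K [[bK K1 K2] cK]] C u du uC TC.
(* A bound for [|T (u n) - z u n|], made positive by the final 1, so that [w n] lies in the unit
   ball and [K (w n) = u n / C']. *)
pose C' := `|C| + cabs z * `|C| + 1.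
have C'0 : 0 < C' by rewrite ltr_wpDl // addr_ge0 // mulr_ge0 // cabs_ge0.
pose w n := C'^-1%:C *: (T (u n) - z *: u n).
have [|l [phi [hphi hl]]] := precompact_subseq (u := fun n => K (w n)) cK.
  move=> n; exists (w n) => //=; rewrite /w hnormZ ger0_norm; last by rewrite invr_ge0 ltW.
  rewrite ler_pdivrMl // mulr1; apply: le_trans (hnormD _ _) _.
  rewrite hnormN hnormZC; apply: (@le_trans _ _ (C + cabs z * C)).
    by apply: lerD => //; apply: ler_wpM2l; [exact: cabs_ge0|].
  rewrite /C' ler_wpDr // lerD ?ler_norm //.
  by apply: ler_wpM2l; [exact: cabs_ge0|exact: ler_norm].
exists (C'%:C *: l), phi; split => //.
have := hcvgZ C'%:C hl; congr (_ _ _); apply/funext => n /=.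
rewrite /w linearZ /= scalerA -rmorphM mulfV ?gt_eqF // scale1r.
by have := K2 (u (phi n)) (du _).
Qed.

Lemma perturb_graph_compact (D : H -> H) (M : R) :
  (forall u, hnorm (D u) <= M * hnorm u) ->
  graph_compact T -> graph_compact (perturb D).
Proof.
move=> DM cT C u du uC TC.
have M0 : 0 <= `|M| by [].
have C0 : 0 <= C by apply: le_trans (uC 0%N); exact: hnorm_ge0.
apply: (cT (C + `|M| * C)) => // n.
  by apply: le_trans (uC n) _; rewrite lerDl mulr_ge0.
have -> : T (u n) = (T (u n) + D (u n)) - D (u n) by rewrite addrK.
apply: le_trans (hnormD _ _) _; rewrite hnormN; apply: lerD; first exact: TC.
apply: le_trans (DM _) _; apply: (@le_trans _ _ (`|M| * hnorm (u n))).
  by apply: ler_wpM2r; [exact: hnorm_ge0|exact: ler_norm].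
by apply: ler_wpM2l.
Qed.

End selfadjoint_operators.

Lemma const_lim {R : realType} (a : nat -> R) (x l : R) : (forall n, a n = x) ->
  a n @[n --> \oo] --> l -> l = x.
Proof.
move=> ax al; apply: (cvg_unique (@norm_hausdorff _ _) al).
by have -> : a = fun=> x by [apply/funext]; exact: cvg_cst.
Qed.

(** * Extremal eigenvectors of a compact positive operator *)

Section compact_positive.
Context {R : realType} {H : hilbertType R}.
Variable K : {linear H -> H}.
Hypotheses (Ksym : forall u v, '[K u, v] = '[u, K v])
  (Kinj : forall u, K u = 0 -> u = 0)
  (Kpos : forall u, hnorm (K u) ^+ 2 <= rdot (K u) u)
  (Kle : forall u, hnorm (K u) <= hnorm u)
  (Kcpt : forall u : nat -> H, (forall n, hnorm (u n) <= 1) ->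
     exists l (phi : nat -> nat), (forall n, (n <= phi n)%N) /\
       hcvg (fun n => K (u (phi n))) l).
Implicit Types (u v w : H) (s : seq H).

Definition orthog s : set H := [set v | forall f, f \in s -> '[v, f] = 0].

Lemma orthog_subspace s : lin_subspace (orthog s).
Proof.
split=> [f _|a u v hu hv f fs]; first by rewrite dot0l.
by rewrite dotDl dotZl hu // hv // mulr0 addr0.
Qed.

Lemma orthog_closed s : closed (orthog s).
Proof.
apply/closedP => u hu f fs; have [v [vs vu]] := approx_hcvg hu.
have e1 n : rdot (v n) f = 0 by rewrite /rdot vs.
have e2 n : rdot ('i%C *: v n) f = 0 by rewrite /rdot dotZl vs // mulr0.
by apply: dot_rdot0; [apply: const_lim e1 _|apply: const_lim e2 _];
  apply: hcvg_rdot => //; exact: hcvgZ.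
Qed.

(* Cauchy-Schwarz for the semi-inner product (K u, v) *)
Lemma K_cauchy (sg : R) v : 0 < sg ->
  rdot (K (K v)) (K v) <= sg * hnorm (K v) ^+ 2 ->
  hnorm (K v) ^+ 2 <= sg * rdot (K v) v.
Proof.
move=> sg0 h.
have pos u : 0 <= rdot (K u) u.
  by apply: le_trans (Kpos u); rewrite exprn_ge0 ?hnorm_ge0.
have := pos (v - sg^-1%:C *: K v).
rewrite linearB linearZ /= rdotBl !rdotBr rdotZl !rdotZr rdotZl rdotuu.
have -> : rdot (K (K v)) v = hnorm (K v) ^+ 2 by rewrite /rdot Ksym -/(rdot _ _) rdotuu.
set a := rdot (K v) v; set n2 := hnorm (K v) ^+ 2; set b := rdot _ _ => h'.
rewrite -ler_pdivrMl // mulrC.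
have : sg^-1 * (sg^-1 * b) <= sg^-1 * n2.
  by apply: ler_wpM2l; [rewrite invr_ge0 ltW|rewrite ler_pdivrMl].
by move: h'; lra.
Qed.

(** For a maximising sequence [v n] of unit vectors, [K (v n) - sg v n] tends to 0; compactness
    makes [K (v n)] converge along a subsequence, hence also [v n], as [sg > 0]. The complement of
    [s] is invariant because [s] consists of eigenvectors. *)
Lemma K_max s : (forall f, f \in s -> exists sg : R, K f = sg%:C *: f) ->
  (exists2 v, orthog s v & v != 0) ->
  exists e (sg : R), [/\ orthog s e, hnorm e = 1, 0 < sg, K e = sg%:C *: e &
    forall v, orthog s v -> rdot (K v) v <= sg * hnorm v ^+ 2].
Proof.
move=> hs [v0 sv0 v00].
have Ks v : orthog s v -> orthog s (K v).
  move=> sv f fs; have [sg Kf] := hs f fs.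
  by rewrite Ksym Kf dotZr sv // mulr0.
pose E := [set rdot (K v) v | v in [set v | orthog s v /\ hnorm v = 1]].
pose nrm v := (hnorm v)^-1%:C *: v.
have nrm1 v : v != 0 -> hnorm (nrm v) = 1.
  move=> v1; rewrite hnormZ ger0_norm ?invr_ge0 ?hnorm_ge0 // mulVf //.
  by rewrite gt_eqF // hnorm_gt0.
have snrm v : orthog s v -> orthog s (nrm v) by apply: subspZ; exact: orthog_subspace.
have hE : has_sup E.
  split; first by exists (rdot (K (nrm v0)) (nrm v0)); exists (nrm v0) => //; split; [exact: snrm|exact: nrm1].
  exists 1 => _ [v [_ v1] <-]; apply: le_trans (ler_norm _) _.
  apply: le_trans (rdot_cauchy _ _) _; rewrite v1 mulr1 -v1; exact: Kle.
set sg := sup E.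
have sgE v : orthog s v -> rdot (K v) v <= sg * hnorm v ^+ 2.
  have [->|v1] := eqVneq v 0; first by rewrite linear0 rdot0l hnorm0 expr0n mulr0.
  move=> sv; have nv := hnorm_gt0 v1.
  have : rdot (K (nrm v)) (nrm v) <= sg.
    by apply: ub_le_sup; [case: hE|exists (nrm v) => //; split; [exact: snrm|exact: nrm1]].
  rewrite /nrm linearZ /= rdotZl rdotZr mulrA -expr2 exprVn mulrC.
  by rewrite ler_pdivrMr ?exprn_gt0.
have sg0 : 0 < sg.
  have := sgE _ sv0; have : 0 < rdot (K v0) v0.
    apply: lt_le_trans (Kpos v0); rewrite exprn_gt0 // hnorm_gt0 //.
    by apply: contra v00 => /eqP/Kinj ->.
  move=> h1 h2; have := lt_le_trans h1 h2.
  by rewrite pmulr_lgt0 // exprn_gt0 // hnorm_gt0.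
pose h (n : nat) : R := n.+1%:R^-1.
have /choice[v hv] : forall n, exists v, [/\ orthog s v, hnorm v = 1 &
    sg - h n < rdot (K v) v].
  move=> n; have [|_ [v [sv v1] <-] hlt] := @sup_adherent R E (h n) _ hE.
    by rewrite invr_gt0.
  by exists v.
(* With a = (K v, v), [K_cauchy] gives [|K v|^2 <= sg a], hence [|K v - sg v|^2 <= sg (sg - a)]. *)
have kv n : hnorm (K (v n) - sg%:C *: v n) ^+ 2 <= sg * h n.
  have [sv v1 hlt] := hv n.
  have := K_cauchy sg0 (sgE _ (Ks _ sv)).
  rewrite hnormB2 rdotZr hnormZ v1 mulr1 real_normK ?num_real //.
  have : sg * (sg - h n) <= sg * rdot (K (v n)) (v n) by rewrite ler_pM2l // ltW.
  by lra.
have [n|y [phi [hphi hy]]] := Kcpt (u := v); first by have [_ -> _] := hv n.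
have h0 : hcvg (fun n => K (v (phi n)) - sg%:C *: v (phi n)) 0.
  apply/hcvgP => e e0.
  have [|N hN] := @harmonic_lt R (e ^+ 2 / sg); first by rewrite divr_gt0 ?exprn_gt0.
  exists N => n nN; rewrite subr0 -ltr_sqr ?nnegrE ?hnorm_ge0 ?(ltW e0) //.
  apply: le_lt_trans (kv _) _; rewrite mulrC -ltr_pdivlMr //.
  by apply: hN; exact: leq_trans (hphi n).
pose e := sg^-1%:C *: y.
have ve : hcvg (fun n => v (phi n)) e.
  have := hcvgZ sg^-1%:C (hcvgD hy (hcvgZ (-1) h0)).
  rewrite scaleN1r oppr0 addr0; congr (_ _ _); apply/funext => n.
  by rewrite scaleN1r opprB addrC subrK scalerA -rmorphM mulVf ?gt_eqF // scale1r.
have Ke : hcvg (fun n => K (v (phi n))) (K e).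
  apply: (hcvg_lipschitz (M := 1) _ ve) => x z; rewrite mul1r -linearB; exact: Kle.
exists e, sg; split => //.
- by apply: (closed_hcvg (@orthog_closed s) _ ve) => n; have [] := hv (phi n).
- have v1 n : hnorm (v (phi n)) = 1 by have [] := hv (phi n).
  exact: const_lim v1 (hcvg_norm ve).
- rewrite (hcvg_unique Ke hy) /e scalerA -rmorphM mulfV ?gt_eqF //.
  by rewrite scale1r.
Qed.

End compact_positive.

(** * The spectral theorem *)

Lemma dotZRr {R : realType} {H : hilbertType R} (t : R) (u v : H) :
  '[u, t%:C *: v] = t%:C * '[u, v].
Proof.
rewrite dotZr; congr (_ * _); apply/eqP.
by rewrite eq_complex /= oppr0 !eqxx.
Qed.

Section eigenbasis_compact.
Context {R : realType} {H : hilbertType R}.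
Variable K : {linear H -> H}.
Hypotheses (Ksym : forall u v, '[K u, v] = '[u, K v])
  (Kinj : forall u, K u = 0 -> u = 0)
  (Kpos : forall u, hnorm (K u) ^+ 2 <= rdot (K u) u)
  (Kle : forall u, hnorm (K u) <= hnorm u)
  (Kcpt : forall u : nat -> H, (forall n, hnorm (u n) <= 1) ->
     exists l (phi : nat -> nat), (forall n, (n <= phi n)%N) /\
       hcvg (fun n => K (u (phi n))) l).
Implicit Types (u v w : H) (s : seq H).

(** The first alternative covers the exhausted space: a zero vector still satisfies the eigenvalue
    equation, so the sequence never stops. *)
Definition next_spec s (p : H * R) :=
  [/\ orthog s p.1, K p.1 = p.2%:C *: p.1, 0 < p.2 &
     p.1 = 0 /\ (forall v, orthog s v -> v = 0) \/
     hnorm p.1 = 1 /\ forall v, orthog s v -> rdot (K v) v <= p.2 * hnorm v ^+ 2].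

Lemma next_ex s : (forall f, f \in s -> exists sg : R, K f = sg%:C *: f) ->
  exists p, next_spec s p.
Proof.
move=> hs; have [h|h] := pselect (exists2 v, orthog s v & v != 0).
  have [e [sg [h1 h2 h3 h4 h5]]] := K_max Ksym Kinj Kpos Kle Kcpt hs h.
  by exists (e, sg); split => //=; right.
exists (0, 1); split => //=; first by case: (orthog_subspace s).
  by rewrite linear0 scaler0.
left; split => // v sv; apply/eqP; apply: contra_notT h => v0; by exists v.
Qed.

Lemma eigensequence : exists (e : nat -> H) (sg : nat -> R),
  [/\ forall i j, i != j -> '[e i, e j] = 0,
      forall n, 0 < sg n /\ K (e n) = (sg n)%:C *: e n,
      forall n, e n = 0 \/ hnorm (e n) = 1 &
      forall n v, (forall i, (i < n)%N -> '[v, e i] = 0) ->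
        (e n = 0 -> v = 0) /\
        (e n != 0 -> rdot (K v) v <= sg n * hnorm v ^+ 2)].
Proof.
(* [nx] is total on lists, its specification conditional on [s] consisting of eigenvectors; [goodE]
   discharges the condition along the recursion. *)
have /choice[nx hnx] : forall s, exists p : H * R,
    (forall f, f \in s -> exists sg : R, K f = sg%:C *: f) -> next_spec s p.
  move=> s; have [h|h] := pselect (forall f, f \in s -> exists sg : R, K f = sg%:C *: f).
    by have [p hp] := next_ex h; exists p.
  by exists (0, 0).
pose E := fix E n : seq H := if n is m.+1 then rcons (E m) (nx (E m)).1 else [::].
have goodE n f : f \in E n -> exists sg : R, K f = sg%:C *: f.
  elim: n f => //= n IH f; rewrite mem_rcons inE => /orP[/eqP ->|]; last exact: IH.
  by have [_ h _ _] := hnx _ IH; exists (nx (E n)).2.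
have spec n := hnx _ (goodE n).
pose e n := (nx (E n)).1; pose sg n := (nx (E n)).2.
have EP n f : f \in E n <-> exists2 i, (i < n)%N & f = e i.
  elim: n => [|n IH] /=; first by split => // -[].
  rewrite mem_rcons inE; split.
    move=> /orP[/eqP ->|/IH [i hi ->]]; first by exists n.
    by exists i => //; exact: ltn_trans hi _.
  move=> [j]; rewrite ltnS leq_eqVlt => /orP[/eqP -> ->|hi fe].
    by rewrite eqxx.
  by apply/orP; right; apply/IH; exists j.
have orthE n v : orthog (E n) v <-> forall i, (i < n)%N -> '[v, e i] = 0.
  split=> [h i hi|h f /EP[i hi ->]]; last exact: h.
  by apply: h; apply/EP; exists i.
have lt0 i j : (i < j)%N -> '[e j, e i] = 0.
  by move=> ij; have [/orthE h _ _ _] := spec j; exact: h.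
exists e, sg; split.
- move=> i j; rewrite neq_ltn => /orP[]/lt0 //; exact: dot_eq0C.
- by move=> n; have [_ h1 h2 _] := spec n.
- by move=> n; have [_ _ _ [[h _]|[h _]]] := spec n; [left|right].
move=> n v /orthE hv; have [_ _ _ [[h1 h2]|[h1 h2]]] := spec n.
  by split=> [_|]; [exact: h2|rewrite /e h1 eqxx].
split=> [e0|_]; last exact: h2.
by move: h1; rewrite -/(e n) e0 hnorm0 => /eqP; rewrite eq_sym oner_eq0.
Qed.

(** Otherwise the [e n] are orthonormal and Pythagoras keeps the vectors [K (e n)] more than [d]
    apart, so no subsequence converges. *)
Lemma eigensequence_small (e : nat -> H) (sg : nat -> R) :
  (forall i j, i != j -> '[e i, e j] = 0) ->
  (forall n, 0 < sg n /\ K (e n) = (sg n)%:C *: e n) ->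
  (forall n, e n = 0 \/ hnorm (e n) = 1) ->
  forall d : R, 0 < d -> exists n, e n = 0 \/ sg n <= d.
Proof.
move=> he hK h1 d d0; apply: contrapT => /forallNP hn.
have e1 n : hnorm (e n) = 1.
  by case: (h1 n) => // e0; case: (hn n); left.
have sgd n : d < sg n by rewrite ltNge; apply/negP => h; case: (hn n); right.
have [n|l [phi [hphi hl]]] := Kcpt (u := e); first by rewrite e1.
have /hcvgP/(_ (d / 2)) := hl; rewrite divr_gt0 // => /(_ isT)[N hN].
pose i := phi N; pose j := phi i.+1.
have ij : (i < j)%N by exact: hphi.
have ineq : hnorm (K (e i) - K (e j)) < d.
  have Ni : (N <= i.+1)%N by apply: leq_trans (hphi N) _; exact: leqnSn.
  apply: le_lt_trans (hnorm_triangle _ l _) _; rewrite (hnormB l).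
  have := hN _ (leqnn N); have := hN _ Ni; rewrite -/i -/j; lra.
have : d ^+ 2 < hnorm (K (e i) - K (e j)) ^+ 2.
  have [si ->] := hK i; have [sj ->] := hK j.
  rewrite hnormB2 !hnormZ !e1 !mulr1 rdotZl rdotZr /rdot he; last by rewrite neq_ltn ij.
  rewrite /= !mulr0 subr0 !real_normK ?num_real //.
  by rewrite ltr_wpDr ?sqr_ge0 // ltr_pXn2r ?nnegrE ?ltW.
by rewrite ltr_pXn2r ?nnegrE ?hnorm_ge0 ?(ltW d0) // ltNge ltW.
Qed.

End eigenbasis_compact.

(* vanishing [e n] pad the sequence when the space is finite-dimensional *)
Definition eigenbasis {R : realType} {H : hilbertType R} (T : operator H)
    (e : nat -> H) (nu : nat -> R) :=
  [/\ forall i j, i != j -> '[e i, e j] = 0,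
      forall n, e n = 0 \/ hnorm (e n) = 1,
      forall n, dom T (e n) /\ T (e n) = (nu n)%:C *: e n,
      forall u, (forall n, '[u, e n] = 0) -> u = 0 &
      forall t : R, exists m, forall u, dom T u ->
        (forall i, (i < m)%N -> '[u, e i] = 0) ->
        t * hnorm u ^+ 2 <= rdot (T u) u].

Section spectral_theorem.
Context {R : realType} {H : hilbertType R}.
Variable T : operator H.
Hypotheses (saT : selfadjoint T) (bbT : bounded_below T) (gcT : graph_compact T).
Implicit Types (u v w : H).

(** The shift [ga = |g| + 1] gives [T + ga >= 1]. Its inverse [K] is symmetric, injective, compact
    and a contraction with [|K u|^2 <= (K u, u)]; an eigenvalue [sg] of [K] becomes [1 / sg - ga]
    for [T]. *)
Lemma spectral_theorem : exists e nu, eigenbasis T e nu.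
Proof.
have lT : linear_operator T by case: saT.
case: bbT => g hg; pose ga := `|g| + 1.
have hga u : dom T u -> hnorm u ^+ 2 <= rdot (T u + ga%:C *: u) u.
  move=> du; rewrite rdotDl rdotZl rdotuu; have := hg u du; rewrite -/(rdot _ _).
  have : - `|g| * hnorm u ^+ 2 <= g * hnorm u ^+ 2.
    by apply: ler_wpM2r; [rewrite exprn_ge0 ?hnorm_ge0|have := ler_norm (- g); rewrite normrN; lra].
  by rewrite /ga; lra.
have lower u : dom T u -> 1 * hnorm u <= hnorm (T u + ga%:C *: u).
  move=> du; rewrite mul1r; have [->|u0] := eqVneq u 0; first by rewrite hnorm0 hnorm_ge0.
  rewrite -(ler_pM2r (hnorm_gt0 u0)) -expr2; apply: le_trans (hga u du) _.
  by apply: le_trans (ler_norm _) _; exact: rdot_cauchy.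
pose D u := ga%:C *: u.
have Dlin a u v : D (a *: u + v) = a *: D u + D v.
  by rewrite /D scalerDr !scalerA mulrC.
have DD u v : '[D u, v] = '[u, D v].
  by rewrite /D dotZl dotZRr.
have DM u : hnorm (D u) <= ga * hnorm u.
  by rewrite hnormZ ger0_norm // addr_ge0.
have sj := perturb_surjective saT Dlin DD DM ltr01 lower.
have [||K [bK K1 K2]] := @bounded_inverse_ex _ _ (perturb T D) 1 _ ltr01 lower.
- exact: perturb_linear.
- apply: sj => u du Tu0; apply: hnorm_eq0; apply/eqP.
  by rewrite eq_le hnorm_ge0 andbT; have := lower u du; rewrite mul1r Tu0 hnorm0.
have Kdom v : dom T (K v) by have [] := K1 v.
have KT v : T (K v) + D (K v) = v by have [] := K1 v.
have Ksym u v : '[K u, v] = '[u, K v].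
  rewrite -{1}(KT v) -{2}(KT u) dotDr dotDl -DD.
  by rewrite sa_sym.
have Kinj u : K u = 0 -> u = 0.
  by move=> Ku; rewrite -(KT u) Ku oper0 // add0r /D scaler0.
have Kpos u : hnorm (K u) ^+ 2 <= rdot (K u) u.
  by rewrite rdotC -{2}(KT u); exact: hga.
have Kle u : hnorm (K u) <= hnorm u.
  by have := lower _ (Kdom u); rewrite mul1r KT.
have Kcpt (u : nat -> H) : (forall n, hnorm (u n) <= 1) ->
     exists l (phi : nat -> nat), (forall n, (n <= phi n)%N) /\
       hcvg (fun n => K (u (phi n))) l.
  move=> u1; have Ku1 n : hnorm (K (u n)) <= 1 by apply: le_trans (Kle _) _.
  have ga0 : 0 <= ga by rewrite addr_ge0.
  apply: (gcT (C := 1 + ga) (u := fun n => K (u n))) => n //.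
    by apply: le_trans (Ku1 n) _; rewrite lerDl.
  have -> : T (K (u n)) = u n - D (K (u n)) by rewrite -{2}(KT (u n)) addrK.
  apply: le_trans (hnormD _ _) _; rewrite hnormN; apply: lerD => //.
  by apply: le_trans (DM _) _; rewrite -{2}[ga]mulr1; apply: ler_wpM2l.
have [e [sg [h1 h2 h3 h4]]] := eigensequence Ksym Kinj Kpos Kle Kcpt.
have hsmall := eigensequence_small Kcpt h1 h2 h3.
have sgn0 n : sg n != 0 by have [h _] := h2 n; rewrite gt_eqF.
have eK n : e n = K ((sg n)^-1%:C *: e n).
  have [_ h] := h2 n; rewrite linearZ /= h scalerA -rmorphM mulVf // ?scale1r //.
have de n : dom T (e n) by rewrite eK.
have Te n : T (e n) + D (e n) = (sg n)^-1%:C *: e n by rewrite {1 2}eK KT.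
(* The tail estimate implies completeness: if [u] is orthogonal to all [e n], so is [K u], and a [t]
   above the Rayleigh quotient of a nonzero [K u] is contradictory. *)
suff thr t : exists m, forall u, dom T u ->
    (forall i, (i < m)%N -> '[u, e i] = 0) -> t * hnorm u ^+ 2 <= rdot (T u) u.
  exists e, (fun n => (sg n)^-1 - ga); split => //.
    by move=> n; split => //; rewrite rmorphB scalerBl -Te /D addrK.
  move=> u hu; apply: Kinj; apply: hnorm_eq0; apply/eqP.
  have Ku n : '[K u, e n] = 0.
    by have [_ h] := h2 n; rewrite Ksym h dotZr hu mulr0.
  rewrite -sqrf_eq0 eq_le sqr_ge0 andbT leNgt; apply/negP => n0.
  have [m hm] := thr ((rdot (T (K u)) (K u) + 1) / hnorm (K u) ^+ 2).
  have := hm _ (Kdom u) (fun i _ => Ku i).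
  by rewrite divfK ?gt_eqF // gerDl leNgt ltr01.
(* For [u = K f] orthogonal to the first [m] eigenvectors, [K_cauchy] reads
   [|u|^2 <= sg m ((T u, u) + ga |u|^2)]; an [sg m] below this threshold forces
   [(T u, u) >= t |u|^2]. If [e m = 0], then [u = 0]. *)
have t0 : 0 < (`|t + ga| + 1)^-1 by rewrite invr_gt0 ltr_wpDl.
have [m hm] := hsmall _ t0; exists m => u du hu.
pose f := T u + D u.
have Kf : K f = u by exact: K2.
have hf i : (i < m)%N -> '[f, e i] = 0.
  by move=> im; rewrite /f dotDl DD sa_sym // -dotDr Te dotZr hu // mulr0.
have [e0|e0] := eqVneq (e m) 0.
  have [/(_ e0) f0 _] := h4 m f hf.
  by rewrite -Kf f0 linear0 rdot0r hnorm0 expr0n mulr0.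
have sm : sg m <= (`|t + ga| + 1)^-1.
  by case: hm => // h; rewrite h eqxx in e0.
have [sg0 _] := h2 m.
have hKf i : (i < m)%N -> '[K f, e i] = 0 by move=> im; rewrite Kf hu.
have [_ /(_ e0) hKK] := h4 m _ hKf.
have := K_cauchy Ksym Kpos sg0 hKK.
rewrite Kf rdotC /f rdotDl /D rdotZl rdotuu => hh.
have : (`|t + ga| + 1) * hnorm u ^+ 2 <= (sg m)^-1 * hnorm u ^+ 2.
  apply: ler_wpM2r; first by rewrite exprn_ge0 ?hnorm_ge0.
  by rewrite -[leLHS]invrK lef_pV2 // posrE.
have : (sg m)^-1 * hnorm u ^+ 2 <= rdot (T u) u + ga * hnorm u ^+ 2.
  by rewrite ler_pdivrMl.
have : (t + ga) * hnorm u ^+ 2 <= `|t + ga| * hnorm u ^+ 2.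
  by apply: ler_wpM2r; [rewrite exprn_ge0 ?hnorm_ge0|exact: ler_norm].
have := exprn_ge0 2 (hnorm_ge0 u).
by lra.
Qed.

End spectral_theorem.

Section eigenbasis_theory.
Context {R : realType} {H : hilbertType R}.
Variables (T : operator H) (e : nat -> H) (nu : nat -> R).
Hypotheses (saT : selfadjoint T) (eb : eigenbasis T e nu).
Implicit Types (u v w : H) (P : R -> Prop).

Let lT : linear_operator T. Proof. by case: saT. Qed.

Let eo i j : i != j -> '[e i, e j] = 0. Proof. by case: eb => h ? ? ? ?; exact: h. Qed.

Let e01 n : e n = 0 \/ hnorm (e n) = 1. Proof. by case: eb. Qed.

Let de n : dom T (e n). Proof. by case: eb => _ _ /(_ n)[]. Qed.

Let Te n : T (e n) = (nu n)%:C *: e n. Proof. by case: eb => _ _ /(_ n)[]. Qed.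

Lemma eig_complete u : (forall n, '[u, e n] = 0) -> u = 0.
Proof. by case: eb => _ _ _ h _; exact: h. Qed.

Lemma eig_dot_oper u n : dom T u -> '[T u, e n] = (nu n)%:C * '[u, e n].
Proof. by move=> du; rewrite sa_sym // Te dotZRr. Qed.

Lemma eig_dotZ (a : R[i]) n : '[a *: e n, e n] = 0 -> a *: e n = 0.
Proof.
case: (e01 n) => [->|e1]; first by rewrite scaler0.
by rewrite dotZl dotuu e1 expr1n mulr1 => ->; rewrite scale0r.
Qed.

Definition epart m u := \sum_(i < m) '[u, e i] *: e i.

Lemma epart_dot m u j : (j < m)%N -> '[epart m u, e j] = '[u, e j].
Proof.
move=> jm; rewrite /epart dot_suml (bigD1 (Ordinal jm)) //= big1 ?addr0.
  rewrite dotZl; case: (e01 j) => [->|e1]; first by rewrite !dot0r mulr0.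
  by rewrite dotuu e1 expr1n mulr1.
by move=> i ij; rewrite dotZl eo ?mulr0.
Qed.

Lemma epart_dom m u : dom T (epart m u).
Proof. by apply: subsp_sum => [|i _]; [exact: dom_subspace|apply: subspZ => //; exact: dom_subspace]. Qed.

Lemma epart_oper m u : T (epart m u) = \sum_(i < m) ((nu i)%:C * '[u, e i]) *: e i.
Proof.
rewrite /epart oper_sum //.
  by apply: eq_bigr => i _; rewrite operZ // Te scalerA mulrC.
by move=> i _; apply: subspZ => //; exact: dom_subspace.
Qed.

Lemma epart_rdot m u v : rdot (epart m u) v = \sum_(i < m) complex.Re ('[u, e i] * '[e i, v]).
Proof. by rewrite rdot_suml; apply: eq_bigr => i _; rewrite /rdot dotZl. Qed.

Lemma epart_norm m u : hnorm (epart m u) ^+ 2 = \sum_(i < m) cabs '[u, e i] ^+ 2.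
Proof.
rewrite -rdotuu epart_rdot; apply: eq_bigr => i _.
by rewrite [X in _ * X]dotC epart_dot // mulJ_cabs.
Qed.

Lemma epart_form m u :
  rdot (T (epart m u)) (epart m u) = \sum_(i < m) nu i * cabs '[u, e i] ^+ 2.
Proof.
rewrite epart_oper rdot_suml; apply: eq_bigr => i _.
by rewrite /rdot dotZl [X in _ * X]dotC epart_dot // -mulrA mulJ_cabs ReZ.
Qed.

Lemma epart_rest m u j : (j < m)%N -> '[u - epart m u, e j] = 0.
Proof. by move=> jm; rewrite dotBl epart_dot // subrr. Qed.

Lemma epart_orth m u v : (forall j, (j < m)%N -> '[v, e j] = 0) -> '[epart m u, v] = 0.
Proof.
by move=> hv; rewrite /epart dot_suml big1 // => i _; rewrite dotZl (dot_eq0C (hv _ _)) ?mulr0.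
Qed.

Lemma epart_operE m u : dom T u -> T (epart m u) = epart m (T u).
Proof.
by move=> du; rewrite epart_oper; apply: eq_bigr => i _; rewrite eig_dot_oper.
Qed.

Lemma form_split m u : dom T u -> rdot (T u) u =
  rdot (T (epart m u)) (epart m u) +
  rdot (T (u - epart m u)) (u - epart m u).
Proof.
move=> du; have dp := epart_dom m u.
have dr : dom T (u - epart m u) by apply: subspB => //; exact: dom_subspace.
have cr : rdot (T (epart m u)) (u - epart m u) = 0.
  by rewrite epart_operE // /rdot epart_orth // => j; exact: epart_rest.
have cr' : rdot (T (u - epart m u)) (epart m u) = 0 by rewrite sa_rdot // rdotC.
have gen p r : dom T p -> dom T r -> rdot (T p) r = 0 -> rdot (T r) p = 0 ->
    rdot (T (p + r)) (p + r) = rdot (T p) p + rdot (T r) r.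
  by move=> hp hr h1 h2; rewrite operD // rdotDl !rdotDr h1 h2 addr0 add0r.
by rewrite -gen // addrC subrK.
Qed.

Lemma norm_split m u : hnorm u ^+ 2 =
  hnorm (epart m u) ^+ 2 + hnorm (u - epart m u) ^+ 2.
Proof.
rewrite -pythagoras; first by rewrite addrC subrK.
by apply: epart_orth => j; exact: epart_rest.
Qed.

(** The expansion is cut at the index [m] of the tail estimate: the first part is a finite sum whose
    terms with [nu i < t] vanish, the rest obeys the estimate. *)
Lemma form_ge (t : R) u : dom T u ->
  (forall n, nu n < t -> '[u, e n] = 0) -> t * hnorm u ^+ 2 <= rdot (T u) u.
Proof.
move=> du hu; have [_ _ _ _ /(_ t)[m hm]] := eb.
rewrite (form_split m) // (norm_split m u) mulrDr; apply: lerD; last first.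
  by apply: hm; [apply: subspB => //; [exact: dom_subspace|exact: epart_dom]|move=> j; exact: epart_rest].
rewrite epart_form epart_norm mulr_sumr; apply: ler_sum => i _.
have [ti|it] := leP t (nu i); first by apply: ler_wpM2r; rewrite ?exprn_ge0 ?cabs_ge0.
rewrite hu // (_ : cabs 0 = 0) ?expr0n ?mulr0 //.
by rewrite -[0 : R[i]]/(0%:C) cabsR normr0.
Qed.

(** The upper bound [t] makes the family finite: by the tail estimate, a nonzero [e n] with [n >= m]
    has [nu n >= t]. *)
Lemma eig_fam P (t : R) : (forall x, P x -> x < t) ->
  exists k (g : 'I_k -> H) (mu : 'I_k -> R), [/\ orthonormal_fam g,
    forall i, P (mu i), forall i, dom T (g i) /\ T (g i) = (mu i)%:C *: g i,
    forall i, exists n, g i = e n /\ mu i = nu n &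
    forall n, P (nu n) -> e n != 0 -> exists i, e n = g i].
Proof.
move=> Pt; have [_ _ _ _ /(_ t)[m hm]] := eb.
pose s := [seq n <- iota 0 m | (e n != 0) && `[< P (nu n) >]].
pose idx (i : 'I_(size s)) := nth 0%N s i.
have idxs i : idx i \in s by apply: mem_nth.
have idxP i : e (idx i) != 0 /\ P (nu (idx i)).
  by have := idxs i; rewrite mem_filter => /andP[/andP[? /asboolP]].
have us : uniq s by rewrite filter_uniq // iota_uniq.
exists (size s), (e \o idx), (nu \o idx); split.
- move=> i j /=; have [->|ij] := eqVneq i j.
    have [ej _] := idxP j; case: (e01 (idx j)) => [h|h]; first by rewrite h eqxx in ej.
    by rewrite dotuu h expr1n.
  by rewrite eo // /idx nth_uniq.
- by move=> i; have [] := idxP i.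
- by move=> i /=; rewrite Te.
- by move=> i; exists (idx i).
move=> n Pn en; have nm : (n < m)%N.
  rewrite ltnNge; apply/negP => mn.
  have := hm (e n) (de n); case: (e01 n) => [h|h]; first by rewrite h eqxx in en.
  rewrite Te rdotZl rdotuu h expr1n !mulr1 => h'.
  have := Pt _ Pn; rewrite ltNge h' // => i im.
  by rewrite eo // neq_ltn (leq_trans im mn) orbT.
have ns : n \in s.
  by rewrite mem_filter en mem_iota nm /= andbT; apply/asboolP.
have hi : (index n s < size s)%N by rewrite index_mem.
by exists (Ordinal hi); rewrite /= /idx /= nth_index.
Qed.

(** The closed span of the [e n] with [P (nu n)], described by orthogonality to the other
    eigenvectors so that closedness is immediate in infinite dimension too. *)
Definition espace P : set H := [set u | forall n, ~ P (nu n) -> '[u, e n] = 0].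

Lemma espace_subspace P : lin_subspace (espace P).
Proof.
split=> [n _|a u v hu hv n nP]; first by rewrite dot0l.
by rewrite dotDl dotZl hu // hv // mulr0 addr0.
Qed.

Lemma espace_closed P : closed (espace P).
Proof.
have -> : espace P = \bigcap_(n in [set n | ~ P (nu n)]) orthog [:: e n].
  apply/seteqP; split=> [u hu n nP f|u hu n nP].
    by rewrite inE => /eqP ->; exact: hu.
  by apply: (hu n nP); rewrite inE.
by apply: closed_bigI => n _; exact: orthog_closed.
Qed.

Lemma espace_mem P n : P (nu n) -> espace P (e n).
Proof.
by move=> Pn j nPj; apply: eo; apply: contra_notN nPj => /eqP <-.
Qed.

Section family.
Variables (P : R -> Prop) (k : nat) (g : 'I_k -> H) (mu : 'I_k -> R).
Hypotheses (og : orthonormal_fam g) (Pmu : forall i, P (mu i))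
  (Tg : forall i, dom T (g i) /\ T (g i) = (mu i)%:C *: g i)
  (ge : forall i, exists n, g i = e n /\ mu i = nu n)
  (eg : forall n, P (nu n) -> e n != 0 -> exists i, e n = g i).

Lemma family_orth u : (forall i, '[u, g i] = 0) -> forall n, P (nu n) -> '[u, e n] = 0.
Proof.
move=> hu n Pn; have [->|en] := eqVneq (e n) 0; first by rewrite dot0r.
by have [i ->] := eg Pn en.
Qed.

Lemma hdim_espace : hdim (espace P) = k%:R%:E.
Proof.
apply: (hdim_orthonormal (espace_subspace P) og).
  by move=> i; have [n [-> hn]] := ge i; apply: espace_mem; rewrite -hn.
move=> u hu hg; apply: eig_complete => n.
by have [Pn|nP] := pselect (P (nu n)); [exact: family_orth|exact: hu].
Qed.

Lemma span_family_dom : span g `<=` dom T.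
Proof. by apply: span_sub; [exact: dom_subspace|move=> i; have [] := Tg i]. Qed.

Lemma span_family_form (t : R) : (forall i, mu i <= t) ->
  forall u, span g u -> rdot (T u) u <= t * hnorm u ^+ 2.
Proof.
move=> mut _ [a ->]; rewrite hnorm_orthonormal // mulr_sumr.
rewrite oper_sum //; last first.
  by move=> i _; apply: subspZ; [exact: dom_subspace|have [] := Tg i].
rewrite rdot_suml; apply: ler_sum => i _; have [dg Tgi] := Tg i.
rewrite operZ // Tgi.
rewrite scalerA mulrC -scalerA rdotZl /rdot dotZl dotC dot_orthonormal // mulJ_cabs /=.
by apply: ler_wpM2r; rewrite ?exprn_ge0 ?cabs_ge0.
Qed.

Lemma span_family_oper u : span g u -> span g (T u).
Proof.
move=> [a ->]; exists (fun i => (mu i)%:C * a i).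
rewrite oper_sum //; last first.
  by move=> i _; apply: subspZ; [exact: dom_subspace|have [] := Tg i].
apply: eq_bigr => i _; have [dg Tgi] := Tg i.
by rewrite operZ // Tgi scalerA mulrC.
Qed.

End family.

(** The cap 1 handles the empty family, and lets [d] also bound the eigenvalues outside a window of
    length 1. *)
Lemma min_positive k (mu : 'I_k -> R) : (forall i, 0 < mu i) ->
  exists2 d : R, 0 < d <= 1 & forall i, d <= mu i.
Proof.
elim: k mu => [|k IH] mu hmu; first by exists 1; [rewrite ltr01 lexx|case].
have [d /andP[d0 d1] hd] := IH (mu \o lift ord0) (fun i => hmu _).
exists (Num.min d (mu ord0)).
  by rewrite lt_min d0 hmu /= ge_min d1.
move=> i; case: (unliftP ord0 i) => [j ->|->]; last by rewrite ge_min lexx orbT.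
by rewrite ge_min hd.
Qed.

Lemma spectral_gap : exists2 d : R, 0 < d <= 1 &
  (forall n, e n != 0 -> nu n < 0 -> nu n <= - d) /\
  (forall n, e n != 0 -> 0 < nu n -> d <= nu n).
Proof.
have [k [g [mu [_ Pmu _ ge eg]]]] := @eig_fam (fun x => x < 0) 0 (fun _ h => h).
have [k' [g' [mu' [_ Pmu' _ ge' eg']]]] :=
   @eig_fam (fun x => 0 < x /\ x < 1) 1 (fun _ h => h.2).
have [i|d /andP[d0 d1] hd] := @min_positive _ (fun i => - mu i); first by rewrite oppr_gt0.
have [i|d' /andP[d0' d1'] hd'] := @min_positive _ mu'; first by have [] := Pmu' i.
(* Nonzero eigenvectors of distinct indices are orthogonal, so equal vectors have equal indices and
   hence equal eigenvalues. *)
have same n m : e n != 0 -> e n = e m -> n = m.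
  move=> en nm; apply/eqP; apply: contraNT en => /eo.
  by rewrite -nm => h; rewrite -(scale1r (e n)) eig_dotZ // scale1r.
exists (Num.min d d'); first by rewrite lt_min d0 d0' /= ge_min d1.
split=> n en hn.
  have [i ei] := eg n hn en; have [m [gm mum]] := ge i.
  rewrite lerNr (le_trans _ (_ : d <= _)) ?ge_min ?lexx //.
  by rewrite (same n m en) -?mum ?hd // ei.
have [n1|n1] := ltP (nu n) 1; last first.
  by apply: le_trans n1; rewrite ge_min d1.
have [i ei] := eg' n (conj hn n1) en; have [m [gm mum]] := ge' i.
rewrite (le_trans _ (_ : d' <= _)) ?ge_min ?lexx ?orbT //.
by rewrite (same n m en) -?mum ?hd' // ei.
Qed.

(** A vector of the right-hand side is a combination of finitely many eigenvectors, which is what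
    places it in the domain. *)
Lemma ker_espace : ker_op T = espace (fun x => x = 0).
Proof.
apply/seteqP; split=> [u [du Tu] n nun|u hu].
  have /eqP := eig_dot_oper n du; rewrite Tu dot0l eq_sym mulf_eq0.
  by rewrite (inj_eq (@complexI R)) => /orP[/eqP //|/eqP].
have [k [g [mu [og Pmu Tg ge eg]]]] := @eig_fam (fun x => x = 0) 1 (fun x x0 => ltac:(by rewrite x0)).
have up : u = \sum_(i < k) '[u, g i] *: g i.
  apply/eqP; rewrite -subr_eq0; apply/eqP/eig_complete => n.
  have [Pn|nP] := pselect (nu n = 0); last first.
    rewrite dotBl hu // dot_suml big1 ?subrr // => i _; rewrite dotZl.
    have [j [-> muj]] := ge i; rewrite eo ?mulr0 //.
    by apply/eqP => jn; apply: nP; rewrite -jn -muj.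
  apply: (family_orth (P := fun x => x = 0) eg) Pn => i.
  by rewrite dotBl dot_orthonormal // subrr.
have sp : dom T (\sum_(i < k) '[u, g i] *: g i).
  by apply: (span_family_dom Tg); eexists.
rewrite /ker_op /= up; split => //; rewrite oper_sum //; last first.
  by move=> i _; apply: subspZ; [exact: dom_subspace|have [] := Tg i].
rewrite big1 // => i _; have [dg Tgi] := Tg i.
by rewrite operZ // Tgi Pmu scale0r scaler0.
Qed.

(** [a] and [b] count the negative and the zero eigenvalues. Their eigenvectors span the test
    spaces; a larger space contains a nonzero vector orthogonal to them. The margin [d] is the
    spectral gap and later absorbs changes of the spectral parameter. *)
Lemma index_split : exists a b (d : R),
  [/\ 0 < d, hdim (espace (fun x => x < 0)) = a%:R%:E, hdim (ker_op T) = b%:R%:E &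
     b = 0%N -> forall u, dom T u -> d * hnorm u <= hnorm (T u)] /\
  [/\ exists L, [/\ lin_subspace L, L `<=` dom T, has_fam L a &
        forall u, L u -> rdot (T u) u <= - d * hnorm u ^+ 2],
      exists L, [/\ lin_subspace L, L `<=` dom T, has_fam L (a + b) &
        forall u, L u -> rdot (T u) u <= 0],
      forall L, lin_subspace L -> L `<=` dom T -> has_fam L a.+1 ->
        exists u, [/\ L u, u != 0 & 0 <= rdot (T u) u] &
      forall L, lin_subspace L -> L `<=` dom T -> has_fam L (a + b).+1 ->
        exists u, [/\ L u, u != 0 & d * hnorm u ^+ 2 <= rdot (T u) u]].
Proof.
have [d /andP[d0 d1] [dneg dpos]] := spectral_gap.
have [a [f [mu [of' Pmu Tf fe ef]]]] := @eig_fam (fun x => x < 0) 0 (fun _ h => h).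
have [b [h [eta [oh Peta Th he eh]]]] := @eig_fam (fun x => x = 0) 1 (fun x x0 => ltac:(by rewrite x0)).
pose g (i : 'I_(a + b)) := match fintype.split i with inl j => f j | inr j => h j end.
pose rho (i : 'I_(a + b)) := match fintype.split i with inl j => mu j | inr j => eta j end.
have Tg i : dom T (g i) /\ T (g i) = (rho i)%:C *: g i.
  by rewrite /g /rho; case: fintype.split => j; [exact: Tf|exact: Th].
have fh i j : '[f i, h j] = 0.
  have [n [-> hn]] := fe i; have [m [-> hm]] := he j; apply: eo.
  by apply/eqP => nm; have := Pmu i; rewrite hn nm -hm Peta ltxx.
have og : orthonormal_fam g.
  move=> i j; rewrite /g -(inj_eq (can_inj (@splitK a b))).
  case: (fintype.split i) => i'; case: (fintype.split j) => j' //.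
  by rewrite (dot_eq0C (fh _ _)).
have eg n : nu n <= 0 -> e n != 0 -> exists i, e n = g i.
  rewrite le_eqVlt => /orP[/eqP n0|n0] en.
    have [i ->] := eh n n0 en; exists (rshift a i).
    by rewrite /g (unsplitK (inr _ i)).
  have [i ->] := ef n n0 en; exists (lshift b i).
  by rewrite /g (unsplitK (inl _ i)).
have muD i : mu i <= - d.
  have [n [fn mn]] := fe i; rewrite mn; apply: dneg; last by rewrite -mn.
  by apply/eqP => e0; have := of' i i; rewrite fn e0 dot0l eqxx => /eqP; rewrite eq_sym oner_eq0.
have gapP u : dom T u -> (forall i, '[u, g i] = 0) -> d * hnorm u ^+ 2 <= rdot (T u) u.
  move=> du hu; apply: form_ge => // n nd.
  have [->|en] := eqVneq (e n) 0; first by rewrite dot0r.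
  have [n0|n0] := leP (nu n) 0; first by have [i ->] := eg n n0 en.
  by have := dpos n en n0; rewrite leNgt nd.
exists a, b, d; split; split => //.
- exact: hdim_espace of' Pmu fe ef.
- by rewrite ker_espace; exact: hdim_espace oh Peta he eh.
- move=> b0 u du.
  pose v := \sum_(i < a) '[u, f i] *: f i; pose w := u - v.
  have sv : span f v by eexists.
  have dv : dom T v by exact: (span_family_dom Tf).
  have dw : dom T w by apply: subspB => //; exact: dom_subspace.
  have wf i : '[w, f i] = 0 by rewrite dotBl dot_orthonormal // subrr.
  have wspan z : span f z -> rdot w z = 0.
    by move=> [x ->]; rewrite rdotC rdot_suml big1 // => i _; rewrite /rdot dotZl (dot_eq0C (wf i)) mulr0.
  have Fw : d * hnorm w ^+ 2 <= rdot (T w) w.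
    apply: gapP => // i; rewrite /g; case: fintype.split => // j.
    by have := ltn_ord j; rewrite {2}b0.
  have Fv := span_family_form of' Tf muD sv.
  have c1 : rdot w v = 0 by exact: wspan.
  have c2 : rdot (T w) v = 0 by rewrite sa_rdot // wspan //; exact: span_family_oper Tf _ sv.
  have c3 : rdot (T v) w = 0 by rewrite rdotC wspan //; exact: span_family_oper Tf _ sv.
  have uE : u = w + v by rewrite subrK.
  have nu2 : hnorm u ^+ 2 = hnorm w ^+ 2 + hnorm v ^+ 2 by rewrite uE hnormD2 c1 mulr0 addr0.
  (* [w - v] reverses the negative part and keeps the norm of [u]; testing [T u] against it gives
     [(T w, w) - (T v, v) >= d |u|^2]. *)
  have nwv : hnorm (w - v) = hnorm u.
    apply/eqP; rewrite -(@eqrXn2 _ 2) ?hnorm_ge0 //.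
    by rewrite nu2 hnormB2 c1 mulr0 subr0.
  have [->|u0] := eqVneq u 0; first by rewrite hnorm0 mulr0 hnorm_ge0.
  rewrite -(ler_pM2r (hnorm_gt0 u0)) -mulrA -expr2 -[X in _ <= _ * X]nwv.
  apply: le_trans (le_trans (ler_norm _) (rdot_cauchy _ _)).
  rewrite nu2 {1}uE operD // rdotBr !rdotDl c2 c3; lra.
- exists (span f); split; [exact: span_subspace|exact: span_family_dom Tf| |].
    by exists f; split; [exact: span_mem|exact: orthonormal_lin_indep].
  exact: span_family_form.
- exists (span g); split; [exact: span_subspace|exact: span_family_dom Tg| |].
    by exists g; split; [exact: span_mem|exact: orthonormal_lin_indep].
  move=> u su; rewrite -(mul0r (hnorm u ^+ 2)).
  apply: (span_family_form og Tg) su => i; rewrite /rho.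
  by case: fintype.split => j; [exact: ltW|rewrite Peta].
- move=> L hL LT [x [Lx hx]].
  have [u [su u0 hu]] := exists_orthogonal f (ltnSn a) hx.
  have Lu : L u by exact: span_sub su.
  exists u; split => //; rewrite -(mul0r (hnorm u ^+ 2)).
  by apply: form_ge => [|n n0]; [exact: LT|exact: (family_orth (P := fun x => x < 0) ef hu n0)].
- move=> L hL LT [x [Lx hx]].
  have [u [su u0 hu]] := exists_orthogonal g (ltnSn (a + b)) hx.
  have Lu : L u by exact: span_sub su.
  by exists u; split => //; apply: gapP => //; exact: LT.
Qed.

End eigenbasis_theory.

(** * The spectral measure *)

Section measure_facts.
Context {R : realType}.
Notation bor := (measurableTypeR R).
Variable m : {measure set bor -> \bar R}.
Hypotheses (mfin : (m setT < +oo)%E)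
  (sfin : (\int[m]_(x in setT) ((x : R) ^+ 2)%:E < +oo)%E).

Lemma integral_cst1 : (\int[m]_(x in setT) (1 : R)%:E = m setT)%E.
Proof. by rewrite integral_cst // mul1e. Qed.

Lemma integrable_sq1 : m.-integrable setT (fun x : bor => ((x : R) ^+ 2 + 1)%:E).
Proof.
apply/integrableP; split.
  by apply/measurable_EFinP; apply: measurable_funD => //; exact: measurable_funX.
under eq_integral do rewrite /= ger0_norm ?addr_ge0 ?sqr_ge0 // EFinD.
rewrite ge0_integralD //.
- by rewrite integral_cst1 lte_add_pinfty.
- by move=> x _; rewrite lee_fin sqr_ge0.
- by apply/measurable_EFinP; exact: measurable_funX.
Qed.

Lemma integrable_id : m.-integrable setT (fun x : bor => (x : R)%:E).
Proof.
apply: le_integrable integrable_sq1 => //.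
  by apply/measurable_EFinP.
move=> x _; rewrite /= lee_fin [leRHS]ger0_norm ?addr_ge0 ?sqr_ge0 //.
have h1 := sqr_ge0 ((x : R) - 1); have h2 := sqr_ge0 ((x : R) + 1).
have h3 := sqr_ge0 (x : R).
by rewrite ler_norml; move: h1 h2 h3; rewrite !expr2 => *; apply/andP; split; lra.
Qed.

(** Sums of Dirac measures are integrated below against nonnegative functions only; the
    sign-changing identity is recovered from [x^2 + x + 1] and [x^2 + 1]. *)
Lemma integral_id_split : (\int[m]_(x in setT) ((x : R) ^+ 2 + x + 1)%:E =
  \int[m]_(x in setT) (x : R)%:E + \int[m]_(x in setT) ((x : R) ^+ 2 + 1)%:E)%E.
Proof.
rewrite -integralD //; [|exact: integrable_id|exact: integrable_sq1].
by apply: eq_integral => x _; rewrite -EFinD; congr EFin; ring.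
Qed.

End measure_facts.

Lemma sq_id1_ge0 {R : realType} (x : R) : 0 <= x ^+ 2 + x + 1.
Proof.
have := sqr_ge0 (x + 2^-1); have := sqr_ge0 x; rewrite !expr2; lra.
Qed.

Lemma eseries_lim {R : realType} (a : nat -> R) (l : R) :
  \sum_(i < n) a i @[n --> \oo] --> l -> (\sum_(0 <= k <oo) (a k)%:E = l%:E)%E.
Proof.
move=> al; apply: cvg_lim => //.
have -> : (fun n => \sum_(0 <= i < n) (a i)%:E)%E = EFin \o (fun n => \sum_(i < n) a i).
  by apply/funext => n; rewrite /= sumEFin big_mkord.
by apply: cvg_EFin => //; exact: nearW.
Qed.

Lemma eq_cvgn {R : realType} (a b : nat -> R) (l : R) : (forall n, a n = b n) ->
  b n @[n --> \oo] --> l -> a n @[n --> \oo] --> l.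
Proof. by move=> ab bl; rewrite (_ : a = b) //; apply/funext. Qed.

Lemma ev_const_lim {R : realType} (a : nat -> R) (x l : R) :
  (exists N, forall n, (N <= n)%N -> a n = x) ->
  a n @[n --> \oo] --> l -> l = x.
Proof.
move=> [N ax] al; apply: (cvg_unique (@norm_hausdorff _ _) al).
by apply: cvg_near_cst; exists N => // n /= /ax.
Qed.

Section eigenbasis_measure.
Context {R : realType} {H : hilbertType R}.
Variables (T : operator H) (e : nat -> H) (nu : nat -> R).
Hypotheses (saT : selfadjoint T) (eb : eigenbasis T e nu).
Implicit Types (u v w : H) (P : R -> Prop).
Notation bor := (measurableTypeR R).

Let eo i j : i != j -> '[e i, e j] = 0. Proof. by case: eb => h ? ? ? ?; exact: h. Qed.

Let e01 n : e n = 0 \/ hnorm (e n) = 1. Proof. by case: eb. Qed.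

Definition coef u n : R := cabs '[u, e n] ^+ 2.

Lemma coef_ge0 u n : 0 <= coef u n.
Proof. by rewrite exprn_ge0 // cabs_ge0. Qed.

(** Increments of the partial sums are orthogonal, so their squared norms are increments of a
    bounded nondecreasing real sequence. *)
Lemma series_ex (c : nat -> R[i]) (M : R) :
  (forall m, \sum_(i < m) cabs (c i) ^+ 2 * hnorm (e i) ^+ 2 <= M) ->
  exists w, hcvg (fun m => \sum_(i < m) c i *: e i) w.
Proof.
move=> hM; pose s m := \sum_(i < m) c i *: e i.
pose S m := \sum_(i < m) cabs (c i) ^+ 2 * hnorm (e i) ^+ 2.
have s0 m j : (m <= j)%N -> '[s m, e j] = 0.
  move=> mj; rewrite /s dot_suml big1 // => i _.
  by rewrite dotZl eo ?mulr0 // neq_ltn (leq_trans (ltn_ord i) mj).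
have sS n k : hnorm (s (n + k)%N - s n) ^+ 2 = S (n + k)%N - S n.
  elim: k => [|k IH]; first by rewrite addn0 !subrr hnorm0 expr0n.
  have -> : s (n + k.+1)%N - s n = (s (n + k)%N - s n) + c (n + k)%N *: e (n + k)%N.
    by rewrite addnS /s big_ord_recr /= addrAC.
  rewrite pythagoras ?IH; last first.
    by rewrite dotZr dotBl !s0 ?leq_addr // subrr mulr0.
  by rewrite addnS {3}/S big_ord_recr /= -/(S _) hnormZC exprMn addrAC.
have Snd : nondecreasing_seq S.
  apply/nondecreasing_seqP => n; rewrite /S big_ord_recr /= lerDl.
  by rewrite mulr_ge0 ?exprn_ge0 ?cabs_ge0 ?hnorm_ge0.
have Sc : cvgn S.
  by apply: nondecreasing_is_cvgn => //; exists M => _ [m _ <-]; exact: hM.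
apply: hcomplete => ep e0; have e20 : 0 < ep ^+ 2 by rewrite exprn_gt0.
have [N _ hN] : \forall n \near \oo, limn S - ep ^+ 2 < S n.
  by move/cvgrPdist_lt: Sc => /(_ _ e20); apply: filterS => n; rewrite ltr_distlC => /andP[].
exists N => m n; wlog nm : m n / (n <= m)%N => [hw Nm Nn|Nm Nn].
  by case/orP: (leq_total n m) => ?; [exact: hw|rewrite hnormB; exact: hw].
rewrite -ltr_sqr ?nnegrE ?hnorm_ge0 ?(ltW e0) // -(subnKC nm) sS subnKC //.
have := hN _ Nn; have := nondecreasing_cvgn_le Snd Sc m; rewrite /=; lra.
Qed.

(** Bessel's inequality makes the expansion converge; its limit differs from [u] by a vector
    orthogonal to every [e n], which is 0. *)
Lemma epart_cvg u : hcvg (fun m => epart e m u) u.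
Proof.
have [|l hl] := @series_ex (fun i => '[u, e i]) (hnorm u ^+ 2).
  move=> m; apply: le_trans (_ : hnorm (epart e m u) ^+ 2 <= _); last first.
    by rewrite (norm_split eb m u) lerDl exprn_ge0 ?hnorm_ge0.
  rewrite (epart_norm eb); apply: ler_sum => i _.
  rewrite -[leRHS]mulr1; apply: ler_wpM2l; first by rewrite exprn_ge0 ?cabs_ge0.
  by case: (e01 i) => ->; rewrite ?hnorm0 ?expr0n ?expr1n.
suff lu : l = u by rewrite lu in hl.
apply/eqP; rewrite -subr_eq0; apply/eqP/(eig_complete eb) => n.
have rn (a : R[i]) : rdot (a *: (l - u)) (e n) = 0.
  have h := hcvg_rdot (v := e n) (hcvgZ a (hcvgD hl (hcvgZ (-1) (hcvg_cst u)))).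
  rewrite scaleN1r in h; apply: ev_const_lim h; exists n.+1 => m nm.
  by rewrite -/(epart e m u) /rdot dotZl dotBl (epart_dot eb) // subrr mulr0.
by apply: dot_rdot0; [have := rn 1; rewrite scale1r|exact: rn].
Qed.

Lemma parseval u : \sum_(i < n) coef u i @[n --> \oo] --> hnorm u ^+ 2.
Proof.
have -> : (fun n => \sum_(i < n) coef u i) = (fun n => hnorm (epart e n u) * hnorm (epart e n u)).
  by apply/funext => n; rewrite -expr2 (epart_norm eb).
by rewrite expr2; apply: cvgM; apply: hcvg_norm; exact: epart_cvg.
Qed.

Lemma eig_dom_sum u : dom T u ->
  \sum_(i < n) (nu i ^+ 2 * coef u i) @[n --> \oo] --> hnorm (T u) ^+ 2.
Proof.
move=> du; apply: eq_cvgn (parseval (u := T u)) => n.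
apply: eq_bigr => i _; rewrite /coef (eig_dot_oper saT eb) // cabsM cabsR.
by rewrite exprMn real_normK ?num_real.
Qed.

Lemma eig_form_sum u : dom T u ->
  \sum_(i < n) (nu i * coef u i) @[n --> \oo] --> rdot (T u) u.
Proof.
move=> du; apply: eq_cvgn (hcvg_rdotr (v := T u) (epart_cvg u)) => n; apply/esym.
rewrite rdotC epart_rdot; apply: eq_bigr => i _.
rewrite [X in _ * X]dotC (eig_dot_oper saT eb) // rmorphM mulrCA mulJ_cabs.
transitivity (complex.Re ((nu i)%:C * (coef u i)%:C)); last by rewrite ReZ.
congr (complex.Re (_ * _)); by apply/eqP; rewrite eq_complex /= oppr0 !eqxx.
Qed.

(** Both the partial expansions of [u] and their images under [T] converge, so closedness of [T]
    puts [u] in the domain. *)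
Lemma eig_dom_ex u (M : R) :
  (forall n, \sum_(i < n) (nu i ^+ 2 * coef u i) <= M) -> dom T u.
Proof.
move=> hM; have [|w hw] := @series_ex (fun i => (nu i)%:C * '[u, e i]) M.
  move=> m; apply: le_trans (hM m); apply: ler_sum => i _.
  rewrite cabsM cabsR exprMn real_normK ?num_real // -[leRHS]mulr1.
  apply: ler_wpM2l; first by rewrite mulr_ge0 ?sqr_ge0 ?coef_ge0.
  by case: (e01 i) => ->; rewrite ?hnorm0 ?expr0n ?expr1n.
have [] // := sa_closed saT _ (epart_cvg u) (m := w); first by move=> n; exact: (epart_dom saT eb).
by move: hw; congr (hcvg _ _); apply/funext => n; rewrite (epart_oper saT eb).
Qed.

Definition eig_measure u : {measure set bor -> \bar R} :=
  mseries (fun n => mscale (NngNum (coef_ge0 u n)) \d_(nu n : bor)) 0.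

Lemma eig_integral u (f : R -> R) (l : R) : measurable_fun (setT : set bor) (f : bor -> R) ->
  (forall x, 0 <= f x) ->
  \sum_(i < n) (f (nu i) * coef u i) @[n --> \oo] --> l ->
  (\int[eig_measure u]_(x in setT) (f x)%:E = l%:E)%E.
Proof.
move=> mf f0 hl; have mf' := (measurable_EFinP _ _).2 mf.
have f0' (t : bor) : [set: bor] t -> (0 <= (f t)%:E)%E by rewrite lee_fin.
rewrite (ge0_integral_measure_series _ measurableT f0' mf').
apply: etrans (eseries_lim hl); apply: eq_eseriesr => n _.
rewrite (ge0_integral_mscale _ measurableT _ mf' f0') (integral_dirac _ measurableT mf').
by rewrite diracT mul1e /= -EFinM mulrC.
Qed.

Lemma eig_integral_partial u (f : R -> R) m : measurable_fun (setT : set bor) (f : bor -> R) ->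
  (forall x, 0 <= f x) ->
  ((\sum_(i < m) (f (nu i) * coef u i))%:E <=
   \int[eig_measure u]_(x in setT) (f x)%:E)%E.
Proof.
move=> mf f0; have mf' := (measurable_EFinP _ _).2 mf.
have f0' (t : bor) : [set: bor] t -> (0 <= (f t)%:E)%E by rewrite lee_fin.
rewrite (ge0_integral_measure_series _ measurableT f0' mf').
rewrite -sumEFin -(big_mkord xpredT (fun i => (f (nu i) * coef u i)%:E)).
have E n : (f (nu n) * coef u n)%:E =
    (\int[mscale (NngNum (coef_ge0 u n)) \d_(nu n : bor)]_(x in setT) (f x)%:E)%E.
  rewrite (ge0_integral_mscale _ measurableT _ mf' f0') (integral_dirac _ measurableT mf').
  by rewrite diracT mul1e /= -EFinM mulrC.
under eq_bigr do rewrite E.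
by apply: nneseries_lim_ge => *; apply: integral_ge0 => *; rewrite lee_fin.
Qed.

Lemma eig_measureE u (I : set R) (v : H) : (forall n, I (nu n) -> '[v, e n] = '[u, e n]) ->
  (forall n, ~ I (nu n) -> '[v, e n] = 0) ->
  eig_measure u I = (hnorm v ^+ 2)%:E.
Proof.
move=> h1 h2; rewrite -(eseries_lim (parseval (u := v))).
rewrite /eig_measure /= /mseries; apply: eq_eseriesr => n _.
rewrite -[LHS]/((coef u n)%:E * \d_(nu n : bor) I)%E diracE; have [In|nI] := pselect (I (nu n)).
  by rewrite mem_set // mule1 /coef h1.
rewrite memNset // mule0 /coef h2 // (_ : cabs 0 = 0) ?expr0n //.
by rewrite -[0 : R[i]]/(0%:C) cabsR normr0.
Qed.

(** [E I] projects onto [espace e nu I], and Parseval's identity for [E I u] identifies the weighted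
    sum of Dirac masses with the scalar measure. *)
Lemma spectral_measure_ex : exists (E : set bor -> H -> H) mu,
  spectral_measure T E mu /\ forall I u, espace e nu I u -> E I u = u.
Proof.
have /choice[E hE] : forall I : set bor, exists P : H -> H, orth_proj (espace e nu I) P.
  by move=> I; apply: orth_proj_ex; [exact: espace_subspace|exact: espace_closed].
have sI I := espace_subspace e nu I.
have mE u I : eig_measure u I = (complex.Re '[E I u, u])%:E.
  rewrite -/(rdot _ _) (proj_rdot (hE I)) //.
  apply: eig_measureE => n nI; first by rewrite (projE (hE I)) //; exact: (espace_mem eb).
  exact: (projM (hE I)).
have muT u : (eig_measure u setT < +oo)%E by rewrite mE ltry.
have m2 : measurable_fun (setT : set bor) (fun x : bor => (x : R) ^+ 2).
  exact: measurable_funX.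
have m21 : measurable_fun (setT : set bor) (fun x : bor => (x : R) ^+ 2 + 1).
  exact: measurable_funD.
have m211 : measurable_fun (setT : set bor) (fun x : bor => (x : R) ^+ 2 + x + 1).
  by apply: measurable_funD => //; exact: measurable_funD.
have n2 (x : R) : 0 <= x ^+ 2 by exact: sqr_ge0.
have n21 (x : R) : 0 <= x ^+ 2 + 1 by rewrite addr_ge0.
exists E, eig_measure; split; last by move=> I u; exact: (proj_id (sI I) (hE I)).
split.
- move=> I _; exists (espace e nu I); split => //; exact: espace_closed.
- by move=> u; apply: (proj_id (sI _) (hE _)) => n nT; case: nT.
- by [].
- move=> u; split=> [du|hlt].
    by rewrite (@eig_integral u (fun x => x ^+ 2) _ m2 n2 (eig_dom_sum du)) ltry.
  apply: (@eig_dom_ex u (fine (\int[eig_measure u]_(x in setT) ((x : R) ^+ 2)%:E))) => n.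
  rewrite -lee_fin fineK; last first.
    by rewrite ge0_fin_numE //; apply: integral_ge0 => x _; rewrite lee_fin.
  exact: (@eig_integral_partial u (fun x => x ^+ 2) n m2 n2).
move=> u du.
have q1 := eig_dom_sum du; have q2 := eig_form_sum du; have q3 := parseval (u := u).
have s2 : (\int[eig_measure u]_(x in setT) ((x : R) ^+ 2)%:E < +oo)%E.
  by rewrite (@eig_integral u (fun x => x ^+ 2) _ m2 n2 q1) ltry.
have c1 : \sum_(i < n) ((nu i ^+ 2 + 1) * coef u i) @[n --> \oo] -->
    hnorm (T u) ^+ 2 + hnorm u ^+ 2.
  apply: eq_cvgn (cvgD q1 q3) => n /=.
  by rewrite -big_split /=; apply: eq_bigr => i _; ring.
have c2 : \sum_(i < n) ((nu i ^+ 2 + nu i + 1) * coef u i) @[n --> \oo] -->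
    hnorm (T u) ^+ 2 + rdot (T u) u + hnorm u ^+ 2.
  apply: eq_cvgn (cvgD (cvgD q1 q2) q3) => n /=.
  by rewrite fctE -!big_split /=; apply: eq_bigr => i _; ring.
have := integral_id_split (muT u) s2.
rewrite (@eig_integral u (fun x => x ^+ 2 + x + 1) _ m211 sq_id1_ge0 c2).
rewrite (@eig_integral u (fun x => x ^+ 2 + 1) _ m21 n21 c1).
have := integrable_fin_num measurableT (integrable_id (muT u) s2).
case: (\int[_]_(x in _) _)%E => [r| |] // _.
by rewrite -EFinD => -[h]; congr (_%:E); rewrite -/(rdot _ _); move: h; lra.
Qed.

End eigenbasis_measure.

(** * An arbitrary spectral measure and its action on eigenvectors *)

Section spectral_measure_uniqueness.
Context {R : realType} {H : hilbertType R}.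
Notation bor := (measurableTypeR R).
Variables (T : operator H) (E : set bor -> H -> H) (mu : H -> {measure set bor -> \bar R}).
Hypotheses (lT : linear_operator T)
  (symT : forall u v, dom T u -> dom T v -> '[T u, v] = '[u, T v])
  (sm : spectral_measure T E mu).
Implicit Types (u v w : H) (I J : set bor).

Let hE I : measurable I -> exists M, [/\ lin_subspace M, closed M & orth_proj M (E I)].
Proof. by case: sm => h _ _ _ _; exact: h. Qed.

Lemma smE u I : measurable I -> mu u I = (hnorm (E I u) ^+ 2)%:E.
Proof.
move=> mI; case: sm => _ _ h _ _; rewrite h // -/(rdot _ _).
by have [M [hM _ hP]] := hE mI; rewrite (proj_rdot hP).
Qed.

Lemma sm_add u I J : measurable I -> measurable J -> [disjoint I & J] ->
  hnorm (E (I `|` J) u) ^+ 2 = hnorm (E I u) ^+ 2 + hnorm (E J u) ^+ 2.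
Proof.
move=> mI mJ IJ; apply: EFin_inj; rewrite EFinD -!smE ?measureU //; last exact: measurableU.
exact/eqP.
Qed.

Lemma sm_idem u I : measurable I -> E I (E I u) = E I u.
Proof.
by move=> mI; have [M [hM _ hP]] := hE mI; apply: (proj_id hM hP); exact: (projM hP u).
Qed.

Lemma sm_le u I : measurable I -> hnorm (E I u) <= hnorm u.
Proof. by move=> mI; have [M [hM _ hP]] := hE mI; exact: (proj_le hP). Qed.

Lemma sm_full u I : measurable I -> hnorm u <= hnorm (E I u) -> E I u = u.
Proof.
move=> mI h; have [M [hM _ hP]] := hE mI; have := proj_pyth hP u.
have := sm_le u mI => h'; have -> : hnorm (E I u) = hnorm u by apply/eqP; rewrite eq_le h h'.
move=> /eqP; rewrite -subr_eq0 opprD addrA subrr add0r oppr_eq0 sqrf_eq0 => /eqP /hnorm_eq0.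
by move=> /eqP; rewrite subr_eq0 => /eqP.
Qed.

(** [spectral_measure] postulates single projections and scalar measures only. Additivity of the
    measure of [E I u] gives [|E (I]|[J) (E I u)|^2 = |E I u|^2 + |E J (E I u)|^2], and a projection
    cannot increase norms. *)
Lemma sm_disj u I J : measurable I -> measurable J -> [disjoint I & J] ->
  E (I `|` J) (E I u) = E I u /\ E J (E I u) = 0.
Proof.
move=> mI mJ IJ; have mU := measurableU _ _ mI mJ.
have h := sm_add (E I u) mI mJ IJ; rewrite sm_idem // in h.
have e1 : E (I `|` J) (E I u) = E I u.
  apply: sm_full => //; rewrite -ler_sqr ?nnegrE ?hnorm_ge0 // h lerDl.
  by rewrite exprn_ge0 ?hnorm_ge0.
split => //; apply: hnorm_eq0; apply/eqP; rewrite -sqrf_eq0.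
by move: h; rewrite e1 => /eqP; rewrite -subr_eq0 opprD addrA subrr add0r oppr_eq0.
Qed.

Lemma sm_lin (a : R[i]) u v I : measurable I -> E I (a *: u + v) = a *: E I u + E I v.
Proof. by move=> mI; have [M [hM _ hP]] := hE mI; exact: (projP hM hP). Qed.

Lemma sm_sym u v I : measurable I -> '[E I u, v] = '[u, E I v].
Proof. by move=> mI; have [M [hM _ hP]] := hE mI; exact: (proj_sym hP). Qed.

Lemma smD u v I : measurable I -> E I (u + v) = E I u + E I v.
Proof. by move=> mI; have := sm_lin 1 u v mI; rewrite !scale1r. Qed.

Lemma smB u v I : measurable I -> E I (u - v) = E I u - E I v.
Proof. by move=> mI; have := sm_lin (-1) v u mI; rewrite !scaleN1r addrC [X in _ = X]addrC. Qed.

(** For [z] in the range of [E (I]|[J)], additivity leaves [|E J z|] equal to [|z - E I z|]; since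
    [E J] kills [E I z], it must fix [z - E I z]. *)
Lemma sm_union u I J : measurable I -> measurable J -> [disjoint I & J] ->
  E (I `|` J) u = E I u + E J u.
Proof.
move=> mI mJ IJ; have mU := measurableU _ _ mI mJ.
have JI : [disjoint J & I] by rewrite disj_set_sym.
have sub v : E I (E (I `|` J) v) = E I v.
  apply: dot_inj => w; rewrite -!sm_sym //.
  by have [-> _] := sm_disj w mI mJ IJ.
have subJ v : E J (E (I `|` J) v) = E J v.
  apply: dot_inj => w; rewrite -!sm_sym //.
  by have [+ _] := sm_disj w mJ mI JI; rewrite setUC => ->.
set z := E (I `|` J) u.
have zz : E (I `|` J) z = z by exact: sm_idem.
have h : E J (z - E I z) = z - E I z.
  apply: sm_full => //; rewrite smB // (sm_disj z mI mJ IJ).2 subr0.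
  have [M [hM _ hP]] := hE mI; rewrite -ler_sqr ?nnegrE ?hnorm_ge0 //.
  have := sm_add z mI mJ IJ; rewrite zz (proj_pyth hP z); lra.
move: h; rewrite smB // (sm_disj z mI mJ IJ).2 subr0 /z sub subJ -/z => ->.
by rewrite addrC subrK.
Qed.

(** [I] is split into [I]&[J], which [E J] preserves, and [I]\[J], which it annihilates. *)
Lemma sm_comp u I J : measurable I -> measurable J -> E J (E I u) = E (I `&` J) u.
Proof.
move=> mI mJ; have mIJ := measurableI _ _ mI mJ; have mD := measurableD mI mJ.
have -> : E I u = E (I `&` J) u + E (I `\` J) u.
  rewrite -sm_union ?setUIDK //.
  by apply/disj_set2P; rewrite setDE setIACA setICr setI0.
have DJ : [disjoint I `\` J & J] by apply/disj_set2P; rewrite setIC setDIK.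
rewrite smD // (sm_disj u mD mJ DJ).2 addr0.
have mD' := measurableD mJ mI.
have [|+ _] := sm_disj u mIJ mD'.
  by apply/disj_set2P; rewrite [I `&` J]setIC setDE setIACA setICr setI0.
by rewrite setIC setUIDK.
Qed.

Lemma smT u : E setT u = u. Proof. by case: sm. Qed.

Lemma sm_mu_comp u I J : measurable I -> measurable J -> mu (E I u) J = mu u (I `&` J).
Proof.
by move=> mI mJ; rewrite !smE ?sm_comp //; exact: measurableI.
Qed.

Lemma sm_fin u : (mu u setT < +oo)%E.
Proof. by rewrite smE ?ltry. Qed.

Lemma sm_dom u : dom T u <-> (\int[mu u]_(x in setT) ((x : R) ^+ 2)%:E < +oo)%E.
Proof. by case: sm => _ _ _ h _; exact: h. Qed.

Lemma sm_form u : dom T u -> (\int[mu u]_(x in setT) (x : R)%:E = (rdot (T u) u)%:E)%E.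
Proof. by case: sm => _ _ _ _ h; exact: h. Qed.

Lemma sm_mu_split u I J : measurable I -> measurable J ->
  mu u J = (mu (E I u) J + mu (E (~` I) u) J)%E.
Proof.
move=> mI mJ; have mC := measurableC mI.
rewrite !sm_mu_comp // -measureU.
- by rewrite -setIUl setUv setTI.
- exact: measurableI.
- exact: measurableI.
- by rewrite setIACA setICr set0I.
Qed.

(* [f := E I u] satisfies [(T f, f) = nu |f|^2], although its spectral measure
   is carried by [I], where [x < nu]. *)
Lemma sm_eigenvector (I : set bor) (nu : R) u : measurable I -> (forall x : R, I x -> x < nu) ->
  dom T u -> T u = nu%:C *: u -> E I u = 0.
Proof.
move=> mI hI du Tu; have mC := measurableC mI.
pose f := E I u; pose g := E (~` I) u.
have uE : u = f + g.
  rewrite -{1}(smT u) -(setUv I) sm_union //.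
  by apply/disj_set2P; rewrite setICr.
have msum (h : bor -> \bar R) : (\int[mu u]_(x in setT) h x =
    \int[measure_add (mu f) (mu g)]_(x in setT) h x)%E.
  by apply: eq_measure_integral => J mJ _; rewrite [RHS]measure_addE; exact: sm_mu_split.
have m2 : measurable_fun (setT : set bor) (EFin \o (fun x : bor => (x : R) ^+ 2)).
  by apply/measurable_EFinP; exact: measurable_funX.
have sq : (\int[mu u]_(x in setT) ((x : R) ^+ 2)%:E =
   \int[mu f]_(x in setT) ((x : R) ^+ 2)%:E + \int[mu g]_(x in setT) ((x : R) ^+ 2)%:E)%E.
  by rewrite msum ge0_integral_measure_add // => x _; rewrite lee_fin sqr_ge0.
have sq0 w : (0 <= \int[mu w]_(x in setT) ((x : R) ^+ 2)%:E)%E.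
  by apply: integral_ge0 => x _; rewrite lee_fin sqr_ge0.
have fin := (sm_dom u).1 du; rewrite sq in fin.
have f2 : (\int[mu f]_(x in setT) ((x : R) ^+ 2)%:E < +oo)%E.
  by apply: le_lt_trans fin; rewrite leeDl.
have g2 : (\int[mu g]_(x in setT) ((x : R) ^+ 2)%:E < +oo)%E.
  by apply: le_lt_trans fin; rewrite leeDr.
have df : dom T f by exact/sm_dom.
have dg : dom T g by exact/sm_dom.
have If := integrable_id (sm_fin f) f2; have Ig := integrable_id (sm_fin g) g2.
have form : rdot (T u) u = rdot (T f) f + rdot (T g) g.
  by apply: EFin_inj; rewrite EFinD -!sm_form // msum (integral_measure_add measurableT If Ig).
have fu : rdot f u = hnorm f ^+ 2.
  by have [M [hM _ hP]] := hE mI; rewrite /f (proj_rdot hP).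
have ff : rdot (T f) f = nu * hnorm f ^+ 2.
  (* As [T u = nu u], [(T g, g) = (T u, u) - 2 nu |f|^2 + (T f, f)]; inserted in [form], this leaves
     [(T f, f) = nu |f|^2]. *)
  have gE : g = u - f by rewrite uE addrAC subrr add0r.
  move: form; rewrite gE operB // rdotBr !rdotBl.
  have -> : rdot (T f) u = nu * hnorm f ^+ 2 by rewrite /rdot symT // Tu -/(rdot _ _) rdotZr fu.
  have -> : rdot (T u) f = nu * hnorm f ^+ 2 by rewrite Tu rdotZl rdotC fu.
  lra.
have muC : mu f (~` I) = 0 by rewrite sm_mu_comp // setICr measure0.
have muT : mu f setT = (hnorm f ^+ 2)%:E by rewrite smE // smT.
have Ic : (mu f).-integrable setT (EFin \o (fun=> nu)).
  apply/integrableP; split; first exact/measurable_EFinP.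
  by rewrite integral_cst // muT -EFinM ltry.
have mh : measurable_fun (setT : set bor) (fun x : bor => nu - (x : R)).
  exact: measurable_funB.
have mh' := (measurable_EFinP _ _).2 mh.
have h0 : (\int[mu f]_(x in setT) (EFin \o (fun x : bor => nu - (x : R))%R) x = 0)%E.
  rewrite (integralB_EFin measurableT Ic If) sm_form // integral_cst // muT ff.
  by rewrite -EFinM subee.
(* [nu - x] is positive on [I], which carries [mu f], yet has integral 0; so it vanishes almost
   everywhere and [I] is a null set. *)
have : ae_eq (mu f) setT (EFin \o (fun x : bor => nu - (x : R))) (cst 0%E).
  apply/ae_eq_integral_abs => //; rewrite -h0; apply: ae_eq_integral => //.
    exact: measurableT_comp.
  exists (~` I); split => // x /= hx Ix; apply: hx => _.
  by rewrite ger0_norm // subr_ge0 ltW // hI.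
move=> [N [mN N0 hN]].
have IN : I `<=` N.
  move=> x Ix; apply: hN => /(_ Logic.I) /eqP; rewrite eqe subr_eq0 => /eqP nx.
  by have := hI _ Ix; rewrite nx ltxx.
have muI : mu f I = 0 := subset_measure0 mI mN IN N0.
have : mu f setT = 0.
  have -> : mu f setT = (mu f I + mu f (~` I))%E.
    by rewrite -measureU ?setUv ?setICr.
  by rewrite muI muC adde0.
rewrite muT => -[] /eqP; rewrite sqrf_eq0 => /eqP; exact: hnorm_eq0.
Qed.

End spectral_measure_uniqueness.

(** The hypothesis on [I] makes it a lower set, as are the half-lines used below: an eigenvalue
    outside [I] exceeds all of [I], so [sm_eigenvector] applies to any spectral measure. The other
    inclusion is the existence of one. *)
Lemma spectral_subspaceE {R : realType} {H : hilbertType R} (T : operator H)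
    (e : nat -> H) (nu : nat -> R) (I : set R) :
  selfadjoint T -> eigenbasis T e nu -> measurable (I : set (measurableTypeR R)) ->
  (forall x y : R, I x -> ~ I y -> x < y) ->
  spectral_subspace I T = espace e nu I.
Proof.
move=> saT eb mI hI; have lT : linear_operator T by case: saT.
apply/seteqP; split=> [u [E [mu [sm EI]]] n nI|u hu].
  have [de Te] : dom T (e n) /\ T (e n) = (nu n)%:C *: e n by case: eb.
  rewrite -EI (sm_sym sm) // (sm_eigenvector lT _ sm mI _ de Te) ?dot0r //.
    by move=> x y dx dy; exact: sa_sym.
  by move=> x Ix; exact: hI.
have [E [mu [sm EI]]] := spectral_measure_ex saT eb.
by exists E, mu; split => //; exact: EI.
Qed.

(** * The Schur complement *)

Section schur_operator.
Context {R : realType} {H Hhat : hilbertType R}.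
Variables (A : operator H) (B : {linear Hhat -> H}) (c : R).
Hypotheses (saA : selfadjoint A) (bbA : bounded_below A) (gcA : graph_compact A)
  (bB : bounded_op B).
Implicit Types (u v w : H) (l : R) (z : R[i]).

Definition BBs u := B (adjoint B u).

Lemma BBsP (a : R[i]) u v : BBs (a *: u + v) = a *: BBs u + BBs v.
Proof. by rewrite /BBs adjointP // linearP. Qed.

Lemma BBs_sym u v : '[BBs u, v] = '[u, BBs v].
Proof. by rewrite /BBs adjointE // adjointEr. Qed.

Lemma BBs_form u : '[BBs u, u] = (hnorm (adjoint B u) ^+ 2)%:C.
Proof. by rewrite /BBs adjointE // dotuu. Qed.

Lemma BBs_bound : exists2 M : R, 0 <= M & (forall u, hnorm (BBs u) <= M * hnorm u) /\
  (forall u, hnorm (adjoint B u) ^+ 2 <= M * hnorm u ^+ 2).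
Proof.
have [M M0 hM] := bounded_nonneg bB; have hM' := adjoint_bound bB M0 hM.
exists (M ^+ 2); first exact: sqr_ge0.
split=> u; last by rewrite -exprMn ler_pXn2r ?nnegrE ?hnorm_ge0 // mulr_ge0 ?hnorm_ge0 // ltW.
apply: le_trans (hM _) _; rewrite expr2 -mulrA; apply: ler_wpM2l; first exact: ltW.
exact: hM'.
Qed.

Definition schur_pert z u := - z *: u - (c%:C - z)^-1 *: BBs u.

Lemma schurE z : schur A B c z = perturb A (schur_pert z).
Proof. by congr Operator; apply/funext => u; rewrite /schur_pert scaleNr addrA. Qed.

Lemma schur_pertP z (a : R[i]) u v :
  schur_pert z (a *: u + v) = a *: schur_pert z u + schur_pert z v.
Proof.
rewrite /schur_pert BBsP !scalerDr opprD addrACA scalerN !scalerA.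
by rewrite ![a * _]mulrC.
Qed.

Lemma schur_pert_adj z u v : '[schur_pert z u, v] = '[u, schur_pert (Num.conj z) v].
Proof.
rewrite /schur_pert dotBl dotBr !dotZl !dotZr BBs_sym.
rewrite rmorphN fmorphV rmorphB /= !conjCK.
have -> : Num.conj c%:C = c%:C :> R[i] by apply/eqP; rewrite eq_complex /= oppr0 !eqxx.
by [].
Qed.

Lemma schur_pert_bound z : exists M : R, forall u, hnorm (schur_pert z u) <= M * hnorm u.
Proof.
have [M M0 [hM _]] := BBs_bound; exists (cabs (- z) + cabs (c%:C - z)^-1 * M) => u.
apply: le_trans (hnormD _ _) _; rewrite hnormN !hnormZC mulrDl -mulrA.
by rewrite lerD2l; apply: ler_wpM2l; [exact: cabs_ge0|exact: hM].
Qed.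

Lemma conjR l : Num.conj l%:C = l%:C :> R[i].
Proof. by apply/eqP; rewrite eq_complex /= oppr0 !eqxx. Qed.

Lemma schur_selfadjoint l : selfadjoint (schur A B c l%:C).
Proof.
have [M hM] := schur_pert_bound l%:C.
rewrite schurE; apply: (perturb_selfadjoint saA (schur_pertP l%:C) (schur_pert_adj l%:C)).
by move=> u; rewrite conjR.
Qed.

Lemma schur_bounded_below l : bounded_below (schur A B c l%:C).
Proof.
have [M hM] := schur_pert_bound l%:C.
by rewrite schurE; exact: perturb_bounded_below hM bbA.
Qed.

Lemma schur_graph_compact l : graph_compact (schur A B c l%:C).
Proof.
have [M hM] := schur_pert_bound l%:C.
by rewrite schurE; exact: perturb_graph_compact hM gcA.
Qed.

(** The adjoint of S(z) is S at the conjugate point, whence the kernel condition there. *)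
Lemma schur_resolvent z (d : R) : 0 < d ->
  (forall u, dom A u -> d * hnorm u <= hnorm (schur A B c z u)) ->
  (forall u, dom A u -> schur A B c (Num.conj z) u = 0 -> u = 0) ->
  resolvent_set (schur A B c z) 0.
Proof.
rewrite !schurE => d0 hd hk; have [M hM] := schur_pert_bound z.
have sj := perturb_surjective saA (schur_pertP z) (schur_pert_adj z) hM d0 hd hk.
have [||K hK] := @bounded_inverse_ex _ _ (perturb A (schur_pert z)) d _ d0 hd => //.
  exact: (perturb_linear saA (schur_pertP z)).
exact: bounded_inverse_sub0 hK.
Qed.

Lemma schur_dot z u : dom A u -> '[schur A B c z u, u] =
  (rdot (A u) u)%:C - z * (hnorm u ^+ 2)%:C -
  (c%:C - z)^-1 * (hnorm (adjoint B u) ^+ 2)%:C.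
Proof. by move=> du; rewrite /schur /= !dotBl !dotZl BBs_form dotuu sa_real. Qed.

(** With y = Im z, Im (S(z) u, u) is [- y (|u|^2 + |B^* u|^2 / |c - z|^2)]: both terms have the same
    sign, so the first alone bounds it from below. *)
Lemma schur_nonreal z : complex.Im z != 0 -> forall u, dom A u ->
  `|complex.Im z| * hnorm u <= hnorm (schur A B c z u).
Proof.
move=> z0 u du; have [->|u0] := eqVneq u 0; first by rewrite hnorm0 mulr0 hnorm_ge0.
rewrite -(ler_pM2r (hnorm_gt0 u0)) -mulrA -expr2.
apply: le_trans (dot_cauchy _ _); rewrite schur_dot //.
set a := rdot _ _; set n2 := hnorm u ^+ 2; set b := hnorm _ ^+ 2.
have n20 : 0 <= n2 by rewrite exprn_ge0 ?hnorm_ge0.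
have b0 : 0 <= b by rewrite exprn_ge0 ?hnorm_ge0.
have Im_le (w : R[i]) : `|complex.Im w| <= cabs w.
  rewrite -ler_sqr ?nnegrE ?cabs_ge0 // real_normK ?num_real // cabs2 lerDr.
  exact: sqr_ge0.
apply: le_trans (Im_le _); case: z z0 => x y /= y0.
set N := (c - x) ^+ 2 + (0 - y) ^+ 2.
have N0 : 0 < N.
  by rewrite ltr_wpDl ?sqr_ge0 // sub0r sqrrN exprn_even_gt0.
have -> : 0 - (x * 0 + y * n2) - ((c - x) / N * 0 + - ((0 - y) / N) * b) =
   - (y * (n2 + b / N)) by field; rewrite gt_eqF.
rewrite normrN normrM ler_wpM2l // ger0_norm; last first.
  by rewrite addr_ge0 // divr_ge0 // ltW.
by rewrite lerDl divr_ge0 // ltW.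
Qed.

Lemma schur_resolvent_nonreal z : complex.Im z != 0 ->
  resolvent_set (schur A B c z) 0.
Proof.
move=> z0; apply: (schur_resolvent (d := `|complex.Im z|)); first by rewrite normr_gt0.
  exact: schur_nonreal.
move=> u du Su; apply: hnorm_eq0; apply/eqP.
have ImJ : complex.Im (Num.conj z) = - complex.Im z by case: (z).
have z0' : complex.Im (Num.conj z) != 0 by rewrite ImJ oppr_eq0.
have := schur_nonreal z0' du; rewrite Su hnorm0 pmulr_rle0 ?normr_gt0 // => h.
by rewrite eq_le h hnorm_ge0.
Qed.

Definition sform l u : R :=
  rdot (A u) u - l * hnorm u ^+ 2 - (c - l)^-1 * hnorm (adjoint B u) ^+ 2.

Lemma schur_form l u : dom A u -> rdot (schur A B c l%:C u) u = sform l u.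
Proof.
move=> du; rewrite {1}/rdot schur_dot // -rmorphB -fmorphV -!rmorphM -!rmorphB //.
Qed.

(** Existence of a subspace of dimension at least [n]: this compares different [l] without first
    knowing the counts to be finite, which comes with [schur_counts]. *)
Definition neg_dim l n := exists L : set H, [/\ lin_subspace L, L `<=` dom A,
  has_fam L n & forall u, L u -> u != 0 -> sform l u < 0].

Definition npos_dim l n := exists L : set H, [/\ lin_subspace L, L `<=` dom A,
  has_fam L n & forall u, L u -> u != 0 -> sform l u <= 0].

(** The unbounded term [(A u, u)] cancels in the difference; what remains is controlled by [|u|^2]
    and the bounded [|B^* u|^2]. *)
Lemma sform_near l (d : R) : l != c -> 0 < d -> exists2 ep : R, 0 < ep &
  forall l', `|l' - l| < ep -> forall u, `|sform l' u - sform l u| <= d * hnorm u ^+ 2.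
Proof.
move=> lc d0; have [M M0 [_ hM]] := BBs_bound.
have cl0 : 0 < `|c - l| by rewrite normr_gt0 subr_eq0 eq_sym.
(* Bounds [1 + M / |(c - l) (c - l')|] as soon as [|l' - l| < |c - l| / 2], which keeps [l'] away
   from the pole. *)
pose K := 1 + 2 * M / `|c - l| ^+ 2.
have K0 : 0 < K by rewrite ltr_pwDl // divr_ge0 ?exprn_ge0 // mulr_ge0.
exists (Num.min (`|c - l| / 2) (d / K)); first by rewrite lt_min !divr_gt0.
move=> l'; rewrite lt_min => /andP[h1 h2] u.
have cl' : `|c - l| / 2 <= `|c - l'|.
  have -> : c - l' = (c - l) - (l' - l) by ring.
  by have := lerB_dist (c - l) (l' - l); lra.
have cl'0 : 0 < `|c - l'| by apply: lt_le_trans cl'; rewrite divr_gt0.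
have e1 : c - l != 0 by rewrite -normr_gt0.
have e2 : c - l' != 0 by rewrite -normr_gt0.
have -> : sform l' u - sform l u = - (l' - l) * (hnorm u ^+ 2 +
    ((c - l) * (c - l'))^-1 * hnorm (adjoint B u) ^+ 2).
  by rewrite /sform; field; rewrite e1 e2.
rewrite normrM normrN.
have n0 : 0 <= hnorm u ^+ 2 by rewrite exprn_ge0 ?hnorm_ge0.
have b0 : 0 <= hnorm (adjoint B u) ^+ 2 by rewrite exprn_ge0 ?hnorm_ge0.
apply: (@le_trans _ _ (`|l' - l| * (K * hnorm u ^+ 2))).
  apply: ler_wpM2l => //; apply: le_trans (ler_normD _ _) _.
  have -> : K * hnorm u ^+ 2 = hnorm u ^+ 2 + 2 * M / `|c - l| ^+ 2 * hnorm u ^+ 2.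
    by rewrite /K; ring.
  rewrite ger0_norm // lerD2l normrM normfV normrM (ger0_norm b0).
  apply: (@le_trans _ _ ((`|c - l| * (`|c - l| / 2))^-1 * (M * hnorm u ^+ 2))).
    apply: ler_pM => //.
    by rewrite lef_pV2 ?posrE ?mulr_gt0 ?divr_gt0 // ler_wpM2l.
  have -> : (`|c - l| * (`|c - l| / 2))^-1 * (M * hnorm u ^+ 2) =
    2 * M / `|c - l| ^+ 2 * hnorm u ^+ 2 by field; rewrite gt_eqF.
  by [].
rewrite mulrA; apply: ler_wpM2r => //.
by rewrite -ler_pdivlMr // ltW.
Qed.

(** [index_split] applied to S(l). Its margin [d] yields the last clause: the form is at most
    [- d |u|^2] on the negative space, and at least [d |u|^2] at some nonzero vector of any space of
    dimension above [a + b]. *)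
Lemma schur_counts l : l != c -> exists a b : nat,
  [/\ hdim (spectral_subspace `]-oo, 0[ (schur A B c l%:C)) = a%:R%:E,
      hdim (ker_op (schur A B c l%:C)) = b%:R%:E &
      b = 0%N -> resolvent_set (schur A B c l%:C) 0] /\
  [/\ forall n, neg_dim l n <-> (n <= a)%N,
      forall n, npos_dim l n <-> (n <= a + b)%N &
      exists2 ep : R, 0 < ep & forall l', `|l' - l| < ep ->
        npos_dim l' a /\ ~ neg_dim l' (a + b).+1].
Proof.
move=> lc; have saS := schur_selfadjoint l.
have [e [nu eb]] := spectral_theorem saS (schur_bounded_below l) (@schur_graph_compact l).
have [a [b [d [[d0 ha hb hr] [h1 h2 h3 h4]]]]] := index_split saS eb.
have formE u : dom A u -> rdot (schur A B c l%:C u) u = sform l u by exact: schur_form.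
have n0 u : u != 0 -> 0 < hnorm u ^+ 2 by move=> u0; rewrite exprn_gt0 // hnorm_gt0.
exists a, b; split; split.
- rewrite (spectral_subspaceE saS eb); last 1 first.
  + by move=> x y; rewrite /= !in_itv /= => x0 /negP; rewrite -leNgt; exact: lt_le_trans.
  + by rewrite -ha.
  + exact: measurable_itv.
- exact: hb.
- move=> b0; apply: (schur_resolvent d0); first exact: hr.
  rewrite conjR => u du Su; apply: hnorm_eq0; apply/eqP.
  by have := hr b0 u du; rewrite Su hnorm0 pmulr_rle0 // => h; rewrite eq_le h hnorm_ge0.
- move=> n; split=> [[L [hL LA Ln Lneg]]|na].
    rewrite leqNgt; apply/negP => an.
    have [u [Lu u0 hu]] := h3 L hL LA (has_fam_le an Ln).
    by have := Lneg u Lu u0; rewrite -formE ?ltNge ?hu //; exact: LA.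
  have [L [hL LA La Lneg]] := h1; exists L; split => //; first exact: has_fam_le La.
  move=> u Lu u0; rewrite -formE; last exact: LA.
  by apply: le_lt_trans (Lneg u Lu) _; rewrite mulNr oppr_lt0 mulr_gt0 // n0.
- move=> n; split=> [[L [hL LA Ln Lneg]]|na].
    rewrite leqNgt; apply/negP => an.
    have [u [Lu u0 hu]] := h4 L hL LA (has_fam_le an Ln).
    have := Lneg u Lu u0; rewrite -formE; last exact: LA.
    by rewrite leNgt (lt_le_trans _ hu) // mulr_gt0 // n0.
  have [L [hL LA La Lneg]] := h2; exists L; split => //; first exact: has_fam_le La.
  by move=> u Lu u0; rewrite -formE; [exact: Lneg|exact: LA].
(* Half of the margin is spent on moving [l], the other half keeps the signs. *)
have [|ep ep0 hep] := @sform_near l (d / 2) lc; first by rewrite divr_gt0.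
exists ep => // l' /hep hl'; split.
  have [L [hL LA La Lneg]] := h1; exists L; split => // u Lu u0.
  have := Lneg u Lu; rewrite formE; last exact: LA.
  have := hl' u; rewrite ler_norml => /andP[_]; have := mulr_gt0 d0 (n0 u u0).
  by lra.
move=> [L [hL LA Ln Lneg]].
have [u [Lu u0 hu]] := h4 L hL LA Ln.
have := Lneg u Lu u0; move: hu; rewrite formE; last exact: LA.
have := hl' u; rewrite ler_norml => /andP[+ _]; have := mulr_gt0 d0 (n0 u u0).
by lra.
Qed.

(** The difference of the forms is [(l' - l) (|u|^2 + |B^* u|^2 / ((c - l) (c - l')))], and the
    product in the denominator is positive when both points lie on one side of [c]. *)
Lemma sform_decr l l' u : u != 0 -> l < l' -> l' < c \/ c < l -> sform l' u < sform l u.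
Proof.
move=> u0 ll' hc; rewrite -subr_gt0.
have pos : 0 < (c - l) * (c - l').
  case: hc => h; first by rewrite mulr_gt0 // subr_gt0 // (lt_trans ll').
  by rewrite -mulrNN mulr_gt0 // oppr_gt0 subr_lt0 // (lt_trans h).
have e1 : c - l != 0 by apply: contraTneq pos => ->; rewrite mul0r ltxx.
have e2 : c - l' != 0 by apply: contraTneq pos => ->; rewrite mulr0 ltxx.
have -> : sform l u - sform l' u = (l' - l) * (hnorm u ^+ 2 +
    ((c - l) * (c - l'))^-1 * hnorm (adjoint B u) ^+ 2).
  by rewrite /sform; field; rewrite e1 e2.
rewrite mulr_gt0 ?subr_gt0 // ltr_wpDr ?exprn_gt0 ?hnorm_gt0 //.
by rewrite mulr_ge0 ?exprn_ge0 ?hnorm_ge0 // invr_ge0 ltW.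
Qed.

(** Multiplication by [c - l] clears the pole and leaves a quadratic polynomial in [l] with roots
    [p1] and [p2]; the square root is at least half the distance of the Rayleigh quotient from [c],
    so [c] lies between the roots. *)
Lemma pm_sform l u : u != 0 -> l != c ->
  [/\ p1 A B c u <= c, c <= p2 A B c u &
    (c - l) * sform l u = hnorm u ^+ 2 * ((l - p1 A B c u) * (l - p2 A B c u))].
Proof.
move=> u0 lc; rewrite /p1 /p2 /pm -/(rdot (A u) u).
have n0 : 0 < hnorm u ^+ 2 by rewrite exprn_gt0 // hnorm_gt0.
set a := rdot (A u) u / _; set b := hnorm (adjoint B u) ^+ 2 / _.
have b0 : 0 <= b by rewrite divr_ge0 ?exprn_ge0 ?hnorm_ge0.
set X := 4^-1 * _ + b.
have X0 : 0 <= X by rewrite addr_ge0 // mulr_ge0 // ?invr_ge0 // sqr_ge0.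
set r := Num.sqrt X; have r2 : r ^+ 2 = X by rewrite sqr_sqrtr.
have r0 : 0 <= r by exact: sqrtr_ge0.
have hr : `|2^-1 * (a - c)| <= r.
  rewrite -ler_sqr ?nnegrE // r2 real_normK ?num_real // /X exprMn.
  by rewrite (_ : 2^-1 ^+ 2 = 4^-1) ?lerDl //; field.
move: hr; rewrite ler_norml => /andP[hr1 hr2]; split; [lra|lra|].
have -> : (l - (2^-1 * (a + c) + -1 * r)) * (l - (2^-1 * (a + c) + 1 * r)) =
  (l - 2^-1 * (a + c)) ^+ 2 - r ^+ 2 by ring.
rewrite r2 /X /sform /a /b; field.
apply/andP; split; first exact: lt0r_neq0 (hnorm_gt0 u0).
by rewrite subr_eq0 eq_sym.
Qed.

Lemma sform_p1 l u : u != 0 -> l < c ->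
  (sform l u < 0 <-> p1 A B c u < l) /\ (sform l u <= 0 <-> p1 A B c u <= l).
Proof.
move=> u0 lc; have [h1 h2 h] := pm_sform u0 (negbT (lt_eqF lc)).
have n0 : 0 < hnorm u ^+ 2 by rewrite exprn_gt0 // hnorm_gt0.
have cl : 0 < c - l by rewrite subr_gt0.
have lp : l - p2 A B c u < 0 by rewrite subr_lt0 (lt_le_trans lc).
split; (split=> hh; [rewrite -subr_gt0 || rewrite -subr_ge0|]).
- have : (c - l) * sform l u < 0 by rewrite pmulr_rlt0.
  by rewrite h pmulr_rlt0 // nmulr_llt0.
- have : (c - l) * sform l u < 0 by rewrite h pmulr_rlt0 // nmulr_llt0 // subr_gt0.
  by rewrite pmulr_rlt0.
- have : (c - l) * sform l u <= 0 by rewrite pmulr_rle0.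
  by rewrite h pmulr_rle0 // nmulr_lle0.
- have : (c - l) * sform l u <= 0 by rewrite h pmulr_rle0 // nmulr_lle0 // subr_ge0.
  by rewrite pmulr_rle0.
Qed.

Lemma sform_p2 l u : u != 0 -> c < l ->
  (sform l u < 0 <-> p2 A B c u < l) /\ (sform l u <= 0 <-> p2 A B c u <= l).
Proof.
move=> u0 lc; have [h1 h2 h] := pm_sform u0 (negbT (gt_eqF lc)).
have n0 : 0 < hnorm u ^+ 2 by rewrite exprn_gt0 // hnorm_gt0.
have cl : c - l < 0 by rewrite subr_lt0.
have lp : 0 < l - p1 A B c u by rewrite subr_gt0 (le_lt_trans h1).
split; (split=> hh; [rewrite -subr_gt0 || rewrite -subr_ge0|]).
- have : 0 < (c - l) * sform l u by rewrite nmulr_rgt0.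
  by rewrite h pmulr_rgt0 // pmulr_rgt0.
- have : 0 < (c - l) * sform l u by rewrite h pmulr_rgt0 // pmulr_rgt0 // subr_gt0.
  by rewrite nmulr_rgt0.
- have : 0 <= (c - l) * sform l u by rewrite nmulr_rge0.
  by rewrite h pmulr_rge0 // pmulr_rge0.
- have : 0 <= (c - l) * sform l u by rewrite h pmulr_rge0 // pmulr_rge0 // subr_ge0.
  by rewrite nmulr_rge0.
Qed.

End schur_operator.

(** * Counting functions and eigenvalue branches *)

Section counting_function.
Context {R : realType}.
Variables (J : set R) (km kp : R -> nat) (kappa : nat) (l0 : R).
Hypotheses (Jconv : forall x y z, J x -> J z -> x <= y <= z -> J y)
  (kmp : forall x, J x -> (km x <= kp x)%N)
  (kmono : forall x y, J x -> J y -> x < y -> (kp x <= km y)%N)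
  (ksemi : forall x, J x -> exists2 ep : R, 0 < ep & forall y, `|y - x| < ep ->
     [/\ J y, (km y <= kp x)%N & (km x <= kp y)%N])
  (J0 : J l0) (k0 : (kp l0 <= kappa)%N)
  (kk : forall x, J x -> (kappa <= km x)%N).

Let S j : set R := [set x | J x /\ (j + kappa <= kp x)%N].

Let kp_homo x y : J x -> J y -> x <= y -> (kp x <= kp y)%N.
Proof.
move=> Jx Jy; rewrite le_eqVlt => /orP[/eqP -> //|xy].
exact: leq_trans (kmono Jx Jy xy) (kmp Jy).
Qed.

(** The place where the count reaches [j + kappa]. The offset skips the [kappa] levels already
    present at the lower end of [J], which correspond to no point of [J]. *)
Definition jump j : R := inf (S j).

Let S_gt j x : (0 < j)%N -> S j x -> l0 < x.
Proof.
move=> j0 [Jx hx]; rewrite ltNge; apply/negP => xl.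
have := leq_trans hx (leq_trans (kp_homo Jx J0 xl) k0).
by rewrite -{2}[kappa]add0n leq_add2r leqNgt j0.
Qed.

(** [l0] keeps the infimum inside [J]. If [km] had already reached the level there, points slightly
    to the left would belong to [S j]; and points of [S j] slightly to the right pass their bound on
    to [kp] at the infimum. *)
Lemma jumpP j : (0 < j)%N -> (exists x, S j x) ->
  [/\ J (jump j), (km (jump j) < j + kappa)%N & (j + kappa <= kp (jump j))%N].
Proof.
move=> j0 [x1 Sx1].
have hS : has_inf (S j).
  by split; [exists x1|exists l0 => x /(S_gt j0)/ltW].
have inf_le x : S j x -> jump j <= x by move=> Sx; apply: ge_inf => //; case: hS.
have l0_le : l0 <= jump j by apply: lb_le_inf; [exists x1|move=> x /(S_gt j0)/ltW].
have Jj : J (jump j).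
  by apply: (Jconv J0 (proj1 Sx1)); rewrite l0_le inf_le.
have [ep ep0 hep] := ksemi Jj.
split => //.
  rewrite ltnNge; apply/negP => hk.
  have [|Jy _ ky] := hep (jump j - ep / 2).
    by rewrite addrAC subrr add0r normrN ger0_norm; lra.
  have := inf_le (jump j - ep / 2); rewrite leNgt => /(_ (conj Jy (leq_trans hk ky))).
  by move/negP; apply; lra.
have [x Sx xlt] := inf_adherent ep0 hS.
have xge := inf_le _ Sx; case: Sx => Jx kx.
(* A point strictly to the right of [x], as [kmono] needs, but still within [ep] of the infimum. *)
pose y := (x + (jump j + ep)) / 2.
have [|Jy kmy _] := hep y.
  have : x < jump j + ep by [].
  by rewrite /y ltr_norml; move: xge ep0 => *; apply/andP; split; lra.
apply: leq_trans kx (leq_trans (kmono Jx Jy _) kmy).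
by have : x < jump j + ep by []; rewrite /y; lra.
Qed.

Lemma jump_eq j x : J x -> (km x < j + kappa <= kp x)%N -> jump j = x.
Proof.
move=> Jx /andP[h1 h2].
have j0 : (0 < j)%N.
  by have := leq_ltn_trans (kk Jx) h1; rewrite -{1}[kappa]add0n ltn_add2r.
have Sx : S j x by [].
have [Jj _ h3] := jumpP j0 (ex_intro _ x Sx).
have jx : jump j <= x by apply: ge_inf => //; exists l0 => y /(S_gt j0)/ltW.
apply/eqP; rewrite eq_le jx /= leNgt; apply/negP => xj.
by have := leq_trans h3 (kmono Jj Jx xj); rewrite leqNgt h1.
Qed.

Lemma jump_le j x : (0 < j)%N -> J x -> (exists y, S j y) ->
  (jump j <= x) = (j + kappa <= kp x)%N.
Proof.
move=> j0 Jx ej; have [Jj h1 h2] := jumpP j0 ej; apply/idP/idP => h.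
  exact: leq_trans h2 (kp_homo Jj Jx h).
by apply: ge_inf => //; exists l0 => y /(S_gt j0)/ltW.
Qed.

(** An index [j] sits at [x] exactly when [km x < j + kappa <= kp x], so every point is repeated as
    often as the count jumps there. *)
Lemma counting_sequence : exists (n : \bar R),
  [/\ is_enat n,
      forall j, index_range n j -> [/\ J (jump j), (km (jump j) < j + kappa)%N &
        (j + kappa <= kp (jump j))%N],
      nondecr_on (index_range n) jump &
      forall x, J x -> counting [set j | index_range n j /\ jump j = x] =
        (kp x - km x)%N%:R%:E :> \bar R] /\
  [/\ forall x j, J x -> (km x < j + kappa <= kp x)%N -> index_range n j /\ jump j = x,
      n = +oo%E <-> (forall m, exists2 x, J x & (m <= kp x)%N) &
      n = +oo%E -> forall x, J x -> exists N, forall j, (N <= j)%N -> J (jump j) /\ x < jump j].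
Proof.
pose Pj j := exists x, S j x.
have Pdown i j : (i <= j)%N -> Pj j -> Pj i.
  by move=> ij [x [Jx hx]]; exists x; split => //; apply: leq_trans hx; rewrite leq_add2r.
(* Either every level is reached, or [n] is the predecessor of the least unreached one; level 0 is
   reached at [l0], so that predecessor makes sense. *)
have [n [en hn ninf]] : exists n : \bar R, [/\ is_enat n,
    forall j, index_range n j <-> (0 < j)%N /\ Pj j &
    n = +oo%E <-> forall j, Pj j].
  have [h|/existsNP[j0 nPj0]] := pselect (forall j, Pj j).
    exists +oo%E; split => //; first by left.
    move=> j; split=> [[jp _]|[jp _]]; split => //; exact: leey.
  have ex : exists j, `[< ~ Pj j >] by exists j0; apply/asboolP.
  have := ex_minnP ex => -[m /asboolP nPm mmin].
  have P0 : Pj 0%N.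
    by exists l0; split => //; rewrite add0n; exact: leq_trans (kk J0) (kmp J0).
  have m0 : (0 < m)%N by case: m nPm {mmin}.
  have Pm j : (j <= m.-1)%N -> Pj j.
    move=> jm; apply: contrapT => nP; have := mmin j; rewrite (asboolT nP) => /(_ isT).
    by rewrite leqNgt -(prednK m0) ltnS jm.
  exists m.-1%:R%:E; split.
  - by right; exists m.-1.
  - move=> j; split=> [[jp]|[jp Pjj]]; rewrite ?lee_fin ?ler_nat.
      by move=> jm; split => //; exact: Pm.
    split => //; rewrite lee_fin ler_nat -ltnS prednK // ltnNge; apply/negP => mj.
    by apply: nPm; exact: Pdown Pjj.
  - by split=> [//|h]; case: nPj0; exact: h.
exists n; split; split => //.
- by move=> j /hn[j0 /(jumpP j0)].
- move=> i j /hn[i0 Pi] /hn[j0 Pjj] ij.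
  have [Jj _ h] := jumpP j0 Pjj.
  by rewrite (jump_le i0 Jj Pi); apply: leq_trans h; rewrite leq_add2r.
- move=> x Jx.
  (* The indices sitting at [x] are consecutive, from [km x - kappa + 1] to [kp x - kappa]. *)
  have -> : [set j | index_range n j /\ jump j = x] =
      [set (km x - kappa + i).+1 | i in `I_(kp x - km x)].
    apply/seteqP; split=> j /=.
      move=> [/hn[j0 Pjj] jx]; have [_ h1 h2] := jumpP j0 Pjj; rewrite jx in h1 h2.
      exists (j.-1 - (km x - kappa))%N; move: h1 h2 (kk Jx) (kmp Jx) j0; lia.
    move=> [i hi <-].
    have hk : (km x < (km x - kappa + i).+1 + kappa <= kp x)%N.
      by move: hi (kk Jx) (kmp Jx); lia.
    split; last exact: jump_eq.
    apply/hn; split => //; exists x; split => //; by case/andP: hk.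
  have hc : card_eq [set (km x - kappa + i).+1 | i in `I_(kp x - km x)] `I_(kp x - km x).
    by apply: inj_card_eq => a b _ _ /eqP; rewrite eqSS eqn_add2l => /eqP.
  rewrite /counting asboolT; last by apply/finite_setP; exists (kp x - km x)%N.
  by rewrite (card_fset_set hc).
- move=> x j Jx hk; split; last exact: jump_eq.
  apply/hn; split; last by exists x; split => //; case/andP: hk.
  case/andP: hk => h1 _.
  by have := leq_ltn_trans (kk Jx) h1; rewrite -{1}[kappa]add0n ltn_add2r.
- rewrite ninf; split=> [h m|h j].
    have [x [Jx hx]] := h m; exists x => //; apply: leq_trans hx; exact: leq_addr.
  by have [x Jx hx] := h (j + kappa)%N; exists x.
- move=> /ninf h x Jx; exists (kp x).+1 => j hj.
  have j0 : (0 < j)%N by exact: leq_ltn_trans hj.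
  have [Jj h1 h2] := jumpP j0 (h j); split => //.
  rewrite ltNge (jump_le j0 Jx (h j)) -ltnNge.
  by apply: leq_trans hj _; exact: leq_addr.
Qed.

End counting_function.

(** * Eigenvalue branches on either side of the pole *)

Section branches.
Context {R : realType} {H Hhat : hilbertType R}.
Variables (A : operator H) (B : {linear Hhat -> H}) (c : R).
Hypotheses (saA : selfadjoint A) (bbA : bounded_below A) (gcA : graph_compact A)
  (bB : bounded_op B).
Implicit Types (u v w : H) (l x y : R).

Let lA : linear_operator A. Proof. by case: saA. Qed.

Local Notation neg_dim := (neg_dim A B c).
Local Notation npos_dim := (npos_dim A B c).
Local Notation sform := (sform A B c).

Lemma has_fam1_neq0 (L : set H) n : has_fam L n.+1 -> exists2 u, L u & u != 0.
Proof.
move=> [e [Le he]]; exists (e ord0) => //; apply/eqP => e0.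
have := he (fun i => (i == ord0)%:R); rewrite (bigD1 ord0) //= e0 scaler0 add0r big1.
  by move=> /(_ erefl ord0) /eqP; rewrite eqxx oner_eq0.
by move=> i /negbTE ->; rewrite scale0r.
Qed.

Lemma ker_nonzero (T : operator H) b : hdim (ker_op T) = b.+1%:R%:E ->
  exists u, [/\ dom T u, u != 0 & T u = 0].
Proof.
move=> h; have : has_fam (ker_op T) b.+1 by apply/hdim_geP; rewrite h.
by move=> /has_fam1_neq0[u [du Tu] u0]; exists u.
Qed.

(** Without a [d]-dimensional negative space, every [d]-dimensional space contains a vector with
    [pm >= l]; a nonpositive one of dimension [d] has [pm <= l] throughout, so [l] is its
    maximum. *)
Lemma minmax_of_counts sgn l (d : nat) : (0 < d)%N ->
  (forall u, u != 0 -> (sform l u < 0 <-> pm A B c sgn u < l) /\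
     (sform l u <= 0 <-> pm A B c sgn u <= l)) ->
  ~ neg_dim l d -> npos_dim l d -> is_minmax (dom A) d (pm A B c sgn) l.
Proof.
move=> d0 hp nneg [L [hL LA [e [Le he]] Lneg]].
have Lbig (M : set H) : lin_subspace M -> M `<=` dom A -> has_fam M d ->
    exists u, [/\ M u, u != 0 & l <= pm A B c sgn u].
  move=> hM MA Md; apply: contrapT => h; apply: nneg; exists M; split => // u Mu u0.
  apply/(hp u u0).1; rewrite ltNge; apply/negP => lu; apply: h.
  by exists u.
split.
  exists (span e).
    split; [exact: span_subspace| |exact: hdim_span].
    by apply: subset_trans LA; exact: span_sub.
  have sL : span e `<=` L by exact: span_sub.
  have ub u : span e u -> u != 0 -> pm A B c sgn u <= l.
    by move=> su u0; apply/(hp u u0).2; apply: Lneg => //; exact: sL.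
  have [||u [su u0 lu]] := Lbig (span e) (span_subspace e).
  - exact: subset_trans LA.
  - by exists e; split => // i; exact: span_mem.
  split; last by move=> _ [v [sv v0] <-]; exact: ub.
  by exists u => //; apply/eqP; rewrite eq_le lu ub.
move=> M [hM MA Md]; case: d d0 Md Lbig {nneg e Le he} => // d _ Md Lbig.
have [m hm] := pm_has_max c lA bB sgn hM MA Md.
exists m => //; have [|u [Mu u0 lu]] := Lbig M hM MA; first by apply/hdim_geP; rewrite Md.
by apply: le_trans lu _; apply: hm.2; exists u.
Qed.

Section branch.
Variables (J : set R) (sgn : R) (kappa : nat) (l0 : R).
Hypotheses (Jc : forall x, J x -> x != c)
  (Jside : forall x y, J x -> J y -> x < y -> y < c \/ c < x)
  (Jconv : forall x y z, J x -> J z -> x <= y <= z -> J y)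
  (Jopen : forall x, J x -> exists2 ep : R, 0 < ep & forall y, `|y - x| < ep -> J y)
  (hp : forall x, J x -> forall u, u != 0 -> (sform x u < 0 <-> pm A B c sgn u < x) /\
     (sform x u <= 0 <-> pm A B c sgn u <= x))
  (J0 : J l0) (k0 : ~ npos_dim l0 kappa.+1) (kk : forall x, J x -> neg_dim x kappa).

(** Common to both sides of [c]: [sgn] selects the functional, and [k0] with [kk] says that both
    counts equal [kappa] at [l0]. *)
Lemma branch : exists (n : \bar R) (l : nat -> R),
  [/\ is_enat n, forall j, index_range n j -> J (l j), nondecr_on (index_range n) l &
      forall x, J x -> counting [set j | index_range n j /\ l j = x] =
        hdim (ker_op (schur A B c x%:C))] /\
  [/\ forall x, J x -> resolvent_set (schur A B c x%:C) 0 \/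
        exists j, index_range n j /\ l j = x,
      forall j, index_range n j -> exists u,
        [/\ dom A u, u != 0 & schur A B c (l j)%:C u = 0],
      forall j, index_range n j -> is_minmax (dom A) (j + kappa) (pm A B c sgn) (l j),
      n = +oo%E <-> (forall m, exists2 x, J x & npos_dim x m) &
      n = +oo%E -> forall x, J x -> exists N, forall j, (N <= j)%N -> J (l j) /\ x < l j].
Proof.
(* Pairs of the negative index and the kernel dimension, with a dummy value at the pole. *)
have /choice[k hk] : forall x, exists k : nat * nat, x != c ->
  [/\ hdim (ker_op (schur A B c x%:C)) = k.2%:R%:E &
      k.2 = 0%N -> resolvent_set (schur A B c x%:C) 0] /\
  [/\ forall n, neg_dim x n <-> (n <= k.1)%N,
      forall n, npos_dim x n <-> (n <= k.1 + k.2)%N &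
      exists2 ep : R, 0 < ep & forall y, `|y - x| < ep ->
        npos_dim y k.1 /\ ~ neg_dim y (k.1 + k.2).+1].
  move=> x; have [->|xc] := eqVneq x c; first by exists (0, 0)%N.
  have [a [b [[_ h2 h3] h]]] := schur_counts saA bbA gcA bB xc.
  by exists (a, b).
pose km x := (k x).1; pose kp x := ((k x).1 + (k x).2)%N.
have negDP x n : J x -> neg_dim x n <-> (n <= km x)%N.
  by move=> Jx; have [_ [h _ _]] := hk x (Jc Jx); exact: h.
have nposP x n : J x -> npos_dim x n <-> (n <= kp x)%N.
  by move=> Jx; have [_ [_ h _]] := hk x (Jc Jx); exact: h.
have kmp x : J x -> (km x <= kp x)%N by move=> _; exact: leq_addr.
have kmono x y : J x -> J y -> x < y -> (kp x <= km y)%N.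
  move=> Jx Jy xy; apply/negDP => //; have [L [h1 h2 h3 h4]] := (nposP x _ Jx).2 (leqnn _).
  exists L; split => // u Lu u0; apply: lt_le_trans (h4 u Lu u0).
  exact: sform_decr (Jside Jx Jy xy).
have ksemi x : J x -> exists2 ep : R, 0 < ep & forall y, `|y - x| < ep ->
     [/\ J y, (km y <= kp x)%N & (km x <= kp y)%N].
  move=> Jx; have [ep1 e1 h1] := Jopen Jx.
  have [_ [_ _ [ep2 e2 h2]]] := hk x (Jc Jx).
  exists (Num.min ep1 ep2); first by rewrite lt_min e1.
  move=> y; rewrite lt_min => /andP[y1 y2]; have Jy := h1 y y1.
  have [n1 n2] := h2 y y2; split => //; last exact/nposP.
  by rewrite leqNgt; apply/negP => hh; apply: n2; exact/negDP.
have kl0 : (kp l0 <= kappa)%N.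
  by rewrite leqNgt; apply/negP => h; apply: k0; apply/nposP.
have kkm x : J x -> (kappa <= km x)%N by move=> Jx; apply/negDP => //; exact: kk.
have [n [[en hn nd cnt] [surj ninf tend]]] :=
  counting_sequence Jconv kmp kmono ksemi J0 kl0 kkm.
have kpm x : (kp x - km x)%N = (k x).2 by rewrite /kp /km addKn.
exists n, (jump J kp kappa); split; split => //.
- by move=> j /hn[].
- by move=> x Jx; rewrite cnt // kpm; have [[-> _] _] := hk x (Jc Jx).
- move=> x Jx; have [[_ hr] _] := hk x (Jc Jx).
  have [b0|b0] := eqVneq (k x).2 0%N; first by left; exact: hr.
  right; exists (kp x - kappa)%N; apply: surj => //.
  have := kkm x Jx; rewrite /kp /km; move: b0; lia.
- move=> j /hn[Jj h1 h2]; have [[hker _] _] := hk _ (Jc Jj).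
  have b0 : (0 < (k (jump J kp kappa j)).2)%N.
    by rewrite -kpm subn_gt0; exact: leq_trans h2.
  have := @ker_nonzero (schur A B c (jump J kp kappa j)%:C)
    (k (jump J kp kappa j)).2.-1.
  by rewrite prednK // => /(_ hker).
- move=> j jr; have [Jj h1 h2] := hn j jr; have j0 : (0 < j)%N by case: jr.
  apply: minmax_of_counts; [by rewrite addn_gt0 j0|exact: hp| |exact/nposP].
  by move=> /(negDP _ _ Jj); rewrite leqNgt h1.
- rewrite ninf; split=> h m; have [x Jx hx] := h m; exists x => //; exact/nposP.
Qed.

End branch.

Lemma lower_branch_start : exists2 l0, l0 < c & ~ npos_dim l0 1.
Proof.
have [M M0 [_ hM]] := BBs_bound bB; case: bbA => g hg.
(* The bound [c - 1] limits the [B] term to [M |u|^2]; the bound [g - M - 1] then leaves a form of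
   at least [|u|^2]. *)
pose l0 := Num.min (c - 1) (g - M - 1).
have l1 : l0 <= c - 1 by rewrite ge_min lexx.
have l2 : l0 <= g - M - 1 by rewrite ge_min lexx orbT.
exists l0; first by lra.
move=> [L [hL LA /has_fam1_neq0[u Lu u0] /(_ u Lu u0)]].
rewrite leNgt => /negP; apply; rewrite /sform.
have := hg u (LA u Lu); rewrite -/(rdot (A u) u).
have n0 : 0 < hnorm u ^+ 2 by rewrite exprn_gt0 // hnorm_gt0.
have b0 : 0 <= hnorm (adjoint B u) ^+ 2 by rewrite exprn_ge0 ?hnorm_ge0.
have cl : 0 < c - l0 by lra.
have : (c - l0)^-1 * hnorm (adjoint B u) ^+ 2 <= M * hnorm u ^+ 2.
  apply: le_trans (hM u); rewrite ler_pdivrMl //.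
  by rewrite -[leLHS]mul1r; apply: ler_wpM2r => //; lra.
have : l0 * hnorm u ^+ 2 <= (g - M - 1) * hnorm u ^+ 2 by rewrite ler_pM2r.
by move: n0; lra.
Qed.

(** By monotonicity the negative count is eventually constant as [l] decreases to [c], and the
    nonpositive count agrees with it there. Hence the kernel is trivial near [c], which yields the
    resolvent condition in [is_index_shift]. *)
Lemma index_shift_spec : exists2 l0, c < l0 &
  [/\ ~ npos_dim l0 (index_shift A B c).+1,
      forall x, c < x -> neg_dim x (index_shift A B c) &
      forall x, c < x < l0 -> forall n, neg_dim x n -> (n <= index_shift A B c)%N].
Proof.
(* The least such [n] is the limit count: minimality gives negative spaces of that dimension at all
   [x > c], and the failure at [x1] bounds nonpositive spaces on [(c, x1)]. The finite count at
   [c + 1] shows that some [n] exists. *)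
have ex0 : exists n, `[< exists2 x, c < x & ~ neg_dim x n.+1 >].
  have c1 : c + 1 != c by rewrite -subr_eq0 addrAC subrr add0r oner_eq0.
  have [a [b [_ [h _ _]]]] := schur_counts saA bbA gcA bB c1.
  exists a; apply/asboolP; exists (c + 1); first by lra.
  by move=> /h; rewrite ltnn.
have := ex_minnP ex0 => -[k /asboolP[x1 cx1 nx1] kmin].
have kneg x : c < x -> neg_dim x k.
  move=> cx; apply: contrapT => nx.
  case: k nx kmin {nx1} => [|k] nx kmin.
    apply: nx; exists [set 0]; split.
    - by split=> // a u v -> ->; rewrite scaler0 addr0.
    - by move=> _ ->; case: (dom_subspace lA).
    - exact: has_fam0.
    - by move=> u ->; rewrite eqxx.
  have : (k.+1 <= k)%N by apply: kmin; apply/asboolP; exists x.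
  by rewrite ltnn.
have data x : c < x < x1 -> x != c /\ forall n, npos_dim x n -> (n <= k)%N.
  move=> /andP[cx xx1]; split=> [|n [L [h1 h2 h3 h4]]]; first by rewrite gt_eqF.
  rewrite leqNgt; apply/negP => kn; apply: nx1.
  exists L; split => //; first exact: has_fam_le h3.
  move=> u Lu u0; apply: lt_le_trans (h4 u Lu u0).
  by apply: sform_decr => //; right.
have ish : is_index_shift A B c k.
  exists x1 => //; split=> x hx; have [xc hn] := data x hx.
    have [a [b [[_ _ hr] [h1 h2 _]]]] := schur_counts saA bbA gcA bB xc.
    split; first by case=> /eqP; rewrite (negbTE xc).
    apply: hr; have ka : (k <= a)%N by apply/h1; apply: kneg; case/andP: hx.
    have : (a + b <= k)%N by apply: hn; apply/h2.
    by move: ka; lia.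
  have [a [b [[h0 _ hr] [h1 h2 _]]]] := schur_counts saA bbA gcA bB xc.
  rewrite h0; congr (_%:R%:E).
  have ka : (k <= a)%N by apply/h1; apply: kneg; case/andP: hx.
  have : (a + b <= k)%N by apply: hn; apply/h2.
  by move: ka; lia.
(* The chosen value and [k] are both the dimension of the same spectral subspace at a point close
   enough to [c] for both. *)
have kE : index_shift A B c = k.
  have [a1 ca1 [_ h1]] : is_index_shift A B c (index_shift A B c).
    by apply: getPex; exists k.
  have [a2 ca2 [_ h2]] := ish.
  pose x := (c + Num.min a1 a2) / 2.
  have cm : c < Num.min a1 a2 by rewrite lt_min ca1.
  have m1 : Num.min a1 a2 <= a1 by rewrite ge_min lexx.
  have m2 : Num.min a1 a2 <= a2 by rewrite ge_min lexx orbT.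
  have x1' : c < x < a1 by rewrite /x; apply/andP; split; lra.
  have x2' : c < x < a2 by rewrite /x; apply/andP; split; lra.
  have := h1 x x1'; rewrite h2 // => -[] /eqP; rewrite eqr_nat => /eqP ->.
  by [].
(* The midpoint lies strictly below [x1], so that even nonpositive spaces have dimension at most [k]
   there. *)
rewrite kE; exists ((c + x1) / 2); first by lra.
have hx : c < (c + x1) / 2 < x1 by apply/andP; split; lra.
split => //.
  by move=> /(data _ hx).2; rewrite ltnn.
move=> x /andP[cx xl] n hn.
have hx' : c < x < x1 by rewrite cx /=; case/andP: hx => _; exact: lt_trans.
apply: (data _ hx').2; case: hn => L [h1 h2 h3 h4]; exists L; split => // u Lu u0.
exact/ltW/h4.
Qed.

End branches.

(** * Operators with closed range *)

Section uniform_boundedness.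
Context {R : realType} {H : hilbertType R}.
Implicit Types (u v w x y : H).

(** A step of length [r] along [v], with the sign that increases the absolute value of the product
    with [v]. *)
Lemma dodge x v (r : R) : 0 <= r ->
  exists2 y, hnorm (y - x) <= r & r * hnorm v <= `|rdot y v|.
Proof.
move=> r0; have [->|v0] := eqVneq v 0.
  by exists x; rewrite ?subrr hnorm0 // mulr0.
have nv := hnorm_gt0 v0; pose h := (r / hnorm v)%:C *: v.
have hn : hnorm h = r.
  by rewrite hnormZ ger0_norm ?divr_ge0 ?hnorm_ge0 // divfK // gt_eqF.
have hv : rdot h v = r * hnorm v.
  by rewrite rdotZl rdotuu expr2 mulrA divfK // gt_eqF.
have [xv|xv] := leP 0 (rdot x v).
  exists (x + h); first by rewrite addrAC subrr add0r hn.
  by rewrite rdotDl hv ger0_norm ?lerDr // addr_ge0 // mulr_ge0 // ltW.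
exists (x - h); first by rewrite addrAC subrr add0r hnormN hn.
rewrite rdotBl hv -normrN; apply: le_trans (ler_norm _).
by rewrite opprB lerDl oppr_ge0 ltW.
Qed.

(* Gliding hump: the steps of [z] are at most [4 ^- k], so [|x - z k|] is too
   small to absorb [|(z k, w (f k))| >= 4 ^- k * |w (f k)| > 2 k]. *)
Lemma uniform_boundedness (w : nat -> H) :
  (forall y, exists C : R, forall n, `|rdot y (w n)| <= C) ->
  exists M : R, forall n, hnorm (w n) <= M.
Proof.
move=> hb; apply: contrapT => /forallNP unb.
pose q (k : nat) : R := 4^-1 ^+ k.
have q0 k : 0 < q k by rewrite exprn_gt0 // invr_gt0.
have qS k : q k.+1 = q k / 4 by rewrite /q exprSr.
have /choice[f hf] : forall k : nat, exists n, 2 * k%:R / q k < hnorm (w n).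
  move=> k; apply: contrapT => /forallNP h; apply: (unb (2 * k%:R / q k)) => n.
  by rewrite leNgt; apply/negP; exact: h.
have /choice[nxt hnxt] : forall p : nat * H, exists y,
    hnorm (y - p.2) <= q p.1 /\ q p.1 * hnorm (w (f p.1)) <= `|rdot y (w (f p.1))|.
  by move=> p; have [y] := dodge p.2 (w (f p.1)) (ltW (q0 p.1)); exists y.
pose z := fix z (k : nat) : H := if k is j.+1 then nxt (k, z j) else 0.
have z1 k : hnorm (z k.+1 - z k) <= q k.+1 by have [] := hnxt (k.+1, z k).
have z2 k : q k.+1 * hnorm (w (f k.+1)) <= `|rdot (z k.+1) (w (f k.+1))|.
  by have [] := hnxt (k.+1, z k).
have zz k i : hnorm (z (k + i)%N - z k) <= q k / 3 - q (k + i)%N / 3.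
  elim: i => [|i IH]; first by rewrite addn0 !subrr hnorm0.
  apply: le_trans (hnorm_triangle _ (z (k + i)%N) _) _.
  by rewrite addnS; have := z1 (k + i)%N; rewrite !qS; move: IH; lra.
have zle k m : (k <= m)%N -> hnorm (z m - z k) <= q k / 3.
  by move=> km; have := zz k (m - k)%N; rewrite subnKC //; have := q0 m; lra.
have qlim (ep : R) : 0 < ep -> exists N, q N < ep.
  move=> ep0; have : q k @[k --> \oo] --> (0 : R).
    by apply: cvg_expr; rewrite ger0_norm ?invr_ge0 // invf_lt1 // ltr1n.
  move=> /cvgrPdist_lt/(_ _ ep0)[N _ hN]; exists N.
  by have := hN N (leqnn N); rewrite /= sub0r normrN ger0_norm // ltW.
have [ep ep0|x hx] := @hcomplete _ _ z.
  have [N hN] := qlim _ ep0; exists N => m n Nm Nn.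
  apply: le_lt_trans (hnorm_triangle _ (z N) _) _; rewrite (hnormB (z N)).
  by have := zle _ _ Nm; have := zle _ _ Nn; have := q0 N; lra.
have xz k : hnorm (x - z k) <= q k / 3.
  apply/ler_addgt0Pr => ep ep0; have /hcvgP/(_ _ ep0)[N hN] := hx.
  apply: le_trans (hnorm_triangle _ (z (maxn N k)) _) _.
  rewrite (hnormB x); have := hN _ (leq_maxl N k); have := zle _ _ (leq_maxr N k).
  by lra.
have [C hC] := hb x.
pose k := (Num.truncn C).+1; have Ck : C < k%:R := truncnS_gt C.
have := hC (f k).
have -> : rdot x (w (f k)) = rdot (z k) (w (f k)) - rdot (z k - x) (w (f k)).
  by rewrite rdotBl; ring.
have h1 := lerB_dist (rdot (z k) (w (f k))) (rdot (z k - x) (w (f k))).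
have h2 := z2 (Num.truncn C); rewrite -/k in h2.
have h3 := rdot_cauchy (z k - x) (w (f k)).
have h4 : hnorm (z k - x) * hnorm (w (f k)) <= q k / 3 * hnorm (w (f k)).
  by apply: ler_wpM2r; [exact: hnorm_ge0|rewrite hnormB].
have h5 : 2 * k%:R < q k * hnorm (w (f k)) by rewrite [ltRHS]mulrC -ltr_pdivrMr //; exact: hf.
have k0 : 0 <= k%:R :> R by [].
by move=> h6; lra.
Qed.

End uniform_boundedness.

Section closed_range.
Context {R : realType} {H Hhat : hilbertType R}.
Variable B : {linear Hhat -> H}.
Hypotheses (bB : bounded_op B) (cB : closed (range B)).

Lemma range_subspace : lin_subspace (range B).
Proof.
split; first by exists 0; rewrite ?linear0.
by move=> a _ _ [x _ <-] [y _ <-]; exists (a *: x + y); rewrite ?linearP.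
Qed.

Lemma range_orth u : (forall y, range B y -> '[u, y] = 0) <-> adjoint B u = 0.
Proof.
split=> [h|h _ [x _ <-]]; last by rewrite adjointEr // h dot0l.
apply: hnorm_eq0; apply/eqP; rewrite -sqrf_eq0 -rdotuu /rdot -adjointEr //.
by rewrite h //; exists (adjoint B u).
Qed.

(** A violating sequence, scaled to [|B^* w| = 1], is unbounded in norm but weakly bounded: writing
    [y = B x + r] with [r] in the kernel of [B^*], [(y, w n) = (x, B^* w n)] is at most [|x|].
    Closedness of the range provides this decomposition. *)
Lemma adjoint_bounded_below : exists2 d : R, 0 < d &
  forall u, (forall y, adjoint B y = 0 -> '[u, y] = 0) ->
    d * hnorm u ^+ 2 <= hnorm (adjoint B u) ^+ 2.
Proof.
apply: contrapT => hno.
have /choice[u hu] : forall n : nat, exists u,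
    (forall y, adjoint B y = 0 -> '[u, y] = 0) /\
    hnorm (adjoint B u) ^+ 2 < n.+1%:R^-1 * hnorm u ^+ 2.
  move=> n; apply: contrapT => /forallNP h; apply: hno.
  exists n.+1%:R^-1; first by rewrite invr_gt0.
  by move=> u uk; rewrite leNgt; apply/negP => hlt; apply: (h u).
have B0 n : 0 < hnorm (adjoint B (u n)).
  have [h1 h2] := hu n; apply: hnorm_gt0; apply/eqP => b0.
  have := h1 _ b0; rewrite dotuu => /complexI n0.
  by move: h2; rewrite n0 b0 hnorm0 mulr0 expr0n ltxx.
pose w n := (hnorm (adjoint B (u n)))^-1%:C *: u n.
have [y|M hM] := @uniform_boundedness _ _ w.
  have [p Rp hp] := projection_ex y range_subspace cB.
  case: (Rp) => x _ xp; exists (hnorm x) => n.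
  have [h1 _] := hu n.
  have -> : rdot y (w n) = rdot x (adjoint B (w n)).
    rewrite {2}/rdot -adjointE // xp -/(rdot p _).
    have -> : y = p + (y - p) by rewrite addrC subrK.
    rewrite rdotDl [X in _ + X](_ : _ = 0) ?addr0 //.
    rewrite /rdot /w dotZr (dot_eq0C (h1 _ _)) ?mulr0 //.
    by apply/range_orth.
  apply: le_trans (rdot_cauchy _ _) _.
  have -> : adjoint B (w n) = (hnorm (adjoint B (u n)))^-1%:C *: adjoint B (u n).
    by have := adjointP bB (hnorm (adjoint B (u n)))^-1%:C (u n) 0; rewrite adjoint0 // !addr0.
  rewrite hnormZ ger0_norm ?invr_ge0 ?hnorm_ge0 // mulVf ?mulr1 //.
  by rewrite gt_eqF.
(* An index with [M^2 < n + 1], whereas [|w n|^2] exceeds [n + 1]. *)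
pose n := Num.truncn (M ^+ 2).
have [_ h2] := hu n; have := hM n.
rewrite /w hnormZ ger0_norm ?invr_ge0 ?hnorm_ge0 //.
rewrite ler_pdivrMl // => h3.
have M0 : 0 <= M.
  rewrite -(pmulr_rge0 _ (B0 n)); apply: le_trans h3; exact: hnorm_ge0.
have h4 : hnorm (u n) ^+ 2 <= hnorm (adjoint B (u n)) ^+ 2 * M ^+ 2.
  rewrite -exprMn ler_pXn2r ?nnegrE ?hnorm_ge0 //.
  by rewrite mulr_ge0 // hnorm_ge0.
have h5 : M ^+ 2 < n.+1%:R := truncnS_gt _.
have b2 : 0 < hnorm (adjoint B (u n)) ^+ 2 by rewrite exprn_gt0.
move: h2; rewrite ltr_pdivlMl // => h2.
have := lt_le_trans h2 h4; rewrite mulrC ltr_pM2l // => h6.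
by have := lt_trans h6 h5; rewrite ltxx.
Qed.

End closed_range.

(** * The index shift *)

Section finite_dimension.
Context {R : realType}.
Implicit Types H : hilbertType R.

Lemma hdim_le H1 H2 (L : set H1) (M : set H2) :
  (forall n, has_fam L n -> has_fam M n) -> (hdim L <= hdim M)%E.
Proof. by move=> h; apply: ub_ereal_sup => _ [n hn <-]; apply/hdim_geP; exact: h. Qed.

Lemma no_fam_span H (S : set H) m : lin_subspace S -> ~ has_fam S m ->
  exists r (e : 'I_r -> H), (r < m)%N /\ S = span e.
Proof.
move=> hS hm; elim: m hm => [|m IH] hm; first by case: hm; exact: has_fam0.
have [h|/IH[r [e [rm Se]]]] := pselect (has_fam S m); last by exists r, e; rewrite ltnW.
by have [e [_ _ ->]] := finite_dim_span hS h hm; exists m, e.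
Qed.

Lemma span_orth H r (e : 'I_r -> H) u : (forall i, '[u, e i] = 0) ->
  forall v, span e v -> '[u, v] = 0.
Proof.
by move=> h _ [a ->]; rewrite dot_sumr big1 // => i _; rewrite dotZr h mulr0.
Qed.

Lemma no_fam_orth H (S : set H) m (x : 'I_m -> H) : lin_subspace S -> ~ has_fam S m ->
  lin_indep x -> exists u, [/\ span x u, u != 0 & forall v, S v -> '[u, v] = 0].
Proof.
move=> hS hm hx; have [r [e [rm ->]]] := no_fam_span hS hm.
have [u [su u0 hu]] := exists_orthogonal e rm hx.
by exists u; split => //; exact: span_orth.
Qed.

Lemma orth_closure H (S : set H) u : (forall v, S v -> '[u, v] = 0) ->
  forall w, closure S w -> '[u, w] = 0.
Proof.
move=> hu w /closureP hw; apply: cabs_eq0; apply/eqP; rewrite eq_le cabs_ge0 andbT.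
apply/ler_addgt0Pr => ep ep0; rewrite add0r.
have u1 : 0 < hnorm u + 1 by rewrite ltr_wpDl // hnorm_ge0.
have [v Sv hv] := hw (ep / (hnorm u + 1)) (divr_gt0 ep0 u1).
have -> : '[u, w] = '[u, w - v] by rewrite dotBr (hu v Sv) subr0.
apply: le_trans (dot_cauchy _ _) _.
apply: (@le_trans _ _ ((hnorm u + 1) * hnorm (w - v))).
  by rewrite ler_wpM2r ?hnorm_ge0 // lerDl.
by rewrite mulrC -ler_pdivlMr // ltW.
Qed.

(** If [S] had smaller dimension, some nonzero combination of the [x i] would be orthogonal to [S],
    hence to its closure, hence to itself. *)
Lemma has_fam_closure H (S : set H) m : lin_subspace S ->
  has_fam (closure S) m -> has_fam S m.
Proof.
move=> hS [x [Sx hx]]; apply: contrapT => hm.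
have [u [[a ua] /eqP u0 hu]] := no_fam_orth hS hm hx; apply: u0.
apply: hnorm_eq0; apply/eqP; rewrite -sqrf_eq0 -rdotuu /rdot {1}ua dot_suml big1 //.
move=> i _; rewrite dotZl (dot_eq0C (orth_closure hu (Sx i))) mulr0 //.
Qed.

Lemma dense_closureT H (S : set H) : dense S -> closure S = setT.
Proof.
by move=> dS; apply/seteqP; split=> // u _; apply/closureP => ep /(denseP dS u).
Qed.

Section linear_functions.
Variables (H1 H2 : hilbertType R) (F : H1 -> H2).
Hypothesis linF : forall (a : R[i]) u v, F (a *: u + v) = a *: F u + F v.

Lemma linear_fun0 : F 0 = 0.
Proof. by have := linF (-1) 0 0; rewrite !scaleN1r addr0 oppr0 addNr. Qed.

Lemma linear_fun_sum n (a : 'I_n -> R[i]) (x : 'I_n -> H1) :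
  F (\sum_(i < n) a i *: x i) = \sum_(i < n) a i *: F (x i).
Proof.
elim/big_rec2: _ => [|i y z _ <-]; first exact: linear_fun0.
exact: linF.
Qed.

Lemma image_subspace L : lin_subspace L -> lin_subspace (F @` L).
Proof.
move=> hL; split; first by exists 0; [case: hL|exact: linear_fun0].
move=> a _ _ [u Lu <-] [v Lv <-]; exists (a *: u + v) => //.
by case: hL => _; apply.
Qed.

Lemma lin_indep_image n (x : 'I_n -> H1) : lin_indep (F \o x) -> lin_indep x.
Proof.
by move=> hx a ha; apply: hx; rewrite -(linear_fun_sum a) ha linear_fun0.
Qed.

(** Rank and nullity: if the images of the family are dependent, the same relation among its vectors
    gives a nonzero kernel element. *)
Lemma no_fam_kernel L n : lin_subspace L -> has_fam L n -> ~ has_fam (range F) n ->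
  exists u, [/\ L u, u != 0 & F u = 0].
Proof.
move=> hL [x [Lx hx]] hn; apply: contrapT => h; apply: hn.
exists (F \o x); split=> [i|a ha i]; first by exists (x i).
apply/eqP; apply: contrapT => /negP ai; apply: h.
exists (\sum_(j < n) a j *: x j); split; last by rewrite linear_fun_sum.
- by apply: subsp_sum => // j _; exact: subspZ.
- by apply: lin_indep_neq0 => //; exists i.
Qed.

End linear_functions.
End finite_dimension.

Section low_spectrum.
Context {R : realType} {H : hilbertType R}.
Variables (A : operator H) (c : R).
Hypotheses (saA : selfadjoint A) (bbA : bounded_below A) (gcA : graph_compact A).

(** Only finitely many eigenvalues lie below [c + 1]; [d] is a lower bound, at most 1, for the
    distance from [c] to those above it. *)
Lemma low_spectral_subspace : exists k (f : 'I_k -> H) (d : R),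
  let V := spectral_subspace `]-oo, c] A in
  [/\ 0 < d, lin_subspace V, hdim V = k%:R%:E, orthonormal_fam f & V = span f] /\
  [/\ V `<=` dom A, forall u, V u -> V (A u),
      forall u, V u -> rdot (A u) u <= c * hnorm u ^+ 2 &
      forall u, dom A u -> (forall v, V v -> '[u, v] = 0) ->
        (c + d) * hnorm u ^+ 2 <= rdot (A u) u].
Proof.
have lA : linear_operator A by case: saA.
have [e [nu eb]] := spectral_theorem saA bbA gcA.
have Itv x : (x \in `]-oo, c]) = (x <= c) by rewrite in_itv.
have VE : spectral_subspace `]-oo, c] A = espace e nu [set` `]-oo, c]].
  apply: spectral_subspaceE => //.
  by move=> x y; rewrite /= !Itv => xc /negP; rewrite -ltNge; exact: le_lt_trans.
have [|k [f [mu [og Pmu Tf fe ef]]]] := @eig_fam _ _ A e nu eb [set` `]-oo, c]] (c + 1).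
  by move=> x; rewrite /= Itv => xc; rewrite (le_lt_trans xc) // ltrDl.
have [k' [f' [mu' [_ Pmu' _ fe' ef']]]] :=
   @eig_fam _ _ A e nu eb (fun x => c < x /\ x < c + 1) (c + 1) (fun _ h => h.2).
have [i|d /andP[d0 d1] hd] := @min_positive R _ (fun i => mu' i - c).
  by rewrite subr_gt0; case: (Pmu' i).
have same n m : e n != 0 -> e n = e m -> n = m.
  case: eb => eo e01 _ _ _ en nm; apply/eqP; apply: contraNT en => /eo.
  rewrite -nm dotuu => /complexI/eqP; rewrite sqrf_eq0 => /eqP/hnorm_eq0 ->.
  exact: eqxx.
have gap n : e n != 0 -> c < nu n -> c + d <= nu n.
  move=> en cn; have [n1|n1] := ltP (nu n) (c + 1); last by move: n1 d1; lra.
  have [i ei] := ef' n (conj cn n1) en; have [m [gm mum]] := fe' i.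
  have nm : n = m by apply: same => //; rewrite ei.
  by have := hd i; rewrite mum -nm; lra.
have sp : espace e nu [set` `]-oo, c]] = span f.
  apply/seteqP; split=> [u hu|]; last first.
    apply: span_sub; first exact: espace_subspace.
    by move=> i; have [n [-> hn]] := fe i; apply: (espace_mem eb); rewrite -hn.
  exists (fun i => '[u, f i]); apply/eqP; rewrite -subr_eq0; apply/eqP/(eig_complete eb) => n.
  have [Pn|nP] := pselect (nu n \in `]-oo, c]); last first.
    rewrite dotBl hu // dot_suml big1 ?subrr // => i _; rewrite dotZl.
    have [j [-> muj]] := fe i; case: eb => eo _ _ _ _; rewrite eo ?mulr0 //.
    by apply/eqP => jn; apply: nP; rewrite -jn -muj; exact: Pmu.
  apply: (family_orth ef) Pn => i.
  by rewrite dotBl dot_orthonormal // subrr.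
exists k, f, d; rewrite VE /=; split; split => //.
- exact: espace_subspace.
- exact: (hdim_espace eb og Pmu fe ef).
- by rewrite sp; exact: (span_family_dom saA Tf).
- by move=> u; rewrite sp; exact: (span_family_oper saA Tf).
- move=> u; rewrite sp; apply: (span_family_form saA og Tf) => i.
  by have := Pmu i; rewrite /= Itv.
- move=> u du hu; apply: (form_ge saA eb) => // n ncd.
  have [->|en] := eqVneq (e n) 0; first by rewrite dot0r.
  apply: hu; apply: (espace_mem eb); rewrite /= Itv leNgt.
  by apply/negP => /(gap n en); rewrite leNgt ncd.
Qed.

End low_spectrum.

Section index_shift_bounds.
Context {R : realType} {H Hhat : hilbertType R}.
Variables (A : operator H) (B : {linear Hhat -> H}) (c : R).
Hypotheses (saA : selfadjoint A) (bbA : bounded_below A) (gcA : graph_compact A)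
  (bB : bounded_op B).

Let lA : linear_operator A. Proof. by case: saA. Qed.

Local Notation V := (spectral_subspace `]-oo, c] A).
Local Notation kappa2 := (index_shift A B c).

(** Taken at [l = c + d]: orthogonally to [V] the form of [A] is at least [l |u|^2] and the [B] term
    is nonnegative, so a negative space cannot have larger dimension than [V]. *)
Lemma index_shift_le_dim : (kappa2%:R%:E <= hdim V)%E.
Proof.
have [k [f [d [[d0 hV -> of' Vf] [VA AV _ Vge]]]]] := low_spectral_subspace c saA bbA gcA.
rewrite lee_fin ler_nat leqNgt; apply/negP => kk.
have [l0 _ [_ /(_ (c + d)) hneg _]] := index_shift_spec c saA bbA gcA bB.
have [|L [hL LA [x [Lx hx]] Lneg]] := hneg; first by rewrite ltrDl.
have [u [su u0 hu]] := exists_orthogonal f kk hx.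
have Lu : L u by exact: (span_sub hL Lx).
have := Lneg u Lu u0; rewrite ltNge => /negP; apply.
have := Vge u (LA u Lu); rewrite Vf => /(_ (span_orth hu)).
have : 0 <= d^-1 * hnorm (adjoint B u) ^+ 2.
  by rewrite mulr_ge0 ?exprn_ge0 ?hnorm_ge0 // invr_ge0 ltW.
rewrite /sform opprD addrA subrr add0r invrN mulNr opprK; lra.
Qed.

Lemma index_shift_eq0 : (forall u, dom A u -> u != 0 ->
  c * hnorm u ^+ 2 < complex.Re '[A u, u]) -> kappa2 = 0%N.
Proof.
move=> hA; have := index_shift_le_dim.
have [k [f [d [[d0 hV -> of' Vf] [VA AV Vle _]]]]] := low_spectral_subspace c saA bbA gcA.
rewrite lee_fin ler_nat; case: k f of' Vf => [|k] f of' Vf; first by rewrite leqn0 => /eqP.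
have Vf0 : V (f ord0) by rewrite Vf; exact: span_mem.
have f0 : f ord0 != 0.
  apply/eqP => h; have := of' ord0 ord0; rewrite h dot0l eqxx => /eqP.
  by rewrite eq_sym oner_eq0.
by have := hA _ (VA _ Vf0) f0; rewrite -/(rdot _ _) ltNge Vle.
Qed.

Section projections.
Hypothesis cB : closed (range B).
Variables P Q : H -> H.
Hypotheses (hP : orth_proj V P) (hQ : orth_proj [set u | adjoint B u = 0] Q).

Let hV : lin_subspace V.
Proof. by have [k [f [d [[_ ? _ _ _] _]]]] := low_spectral_subspace c saA bbA gcA. Qed.

Let hK : lin_subspace [set u | adjoint B u = 0].
Proof.
by split=> [|a u v /= hu hv]; rewrite /= ?adjoint0 // adjointP // hu hv scaler0 addr0.
Qed.

(** [V] is invariant under [A], so the cross terms between [P u] and [u - P u] vanish. *)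
Lemma form_proj_ge : exists (g : R) (d : R), 0 < d /\ forall u, dom A u ->
  g * hnorm (P u) ^+ 2 + (c + d) * hnorm (u - P u) ^+ 2 <= rdot (A u) u.
Proof.
have [k [f [d [[d0 _ _ _ _] [VA AV _ Vge]]]]] := low_spectral_subspace c saA bbA gcA.
case: bbA => g hg; exists g, d; split => // u du.
have [Pu orth] := hP u; have dP := VA _ Pu.
have dR : dom A (u - P u) by apply: subspB => //; exact: dom_subspace.
have -> : rdot (A u) u = rdot (A (P u)) (P u) + rdot (A (u - P u)) (u - P u).
  have x1 : rdot (u - P u) (A (P u)) = 0 by rewrite /rdot orth //; exact: AV.
  have x2 : rdot (A (u - P u)) (P u) = 0 by rewrite sa_rdot.
  have Au : A u = A (P u) + A (u - P u) by rewrite -operD // addrC subrK.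
  have uE : rdot (A u) u = rdot (A u) (P u) + rdot (A u) (u - P u).
    by rewrite -rdotDr addrC subrK.
  by rewrite uE Au !rdotDl x2 (rdotC (A (P u)) (u - P u)) x1; ring.
by apply: lerD; [exact: hg|apply: Vge].
Qed.

(** A negative space of dimension above the rank contains [u != 0] with [P Q u = 0]. Then
    [P u = P (u - Q u)], so the [B] term, large near [c], compensates the only negative
    contribution, that of [P u]. *)
Lemma index_shift_le_rank : (kappa2%:R%:E <= hdim (range (P \o Q)))%E.
Proof.
apply/hdim_geP; apply: contrapT => hno.
have [b b0 hb] := adjoint_bounded_below bB cB.
have [g [d [d0 hgd]]] := form_proj_ge.
have K0 : 0 < `|g - c| + 1 by rewrite ltr_wpDl.
(* [h <= d] settles the part of the form off [V]; [h <= b / (|g - c| + 1)] makes the [B] term at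
   least [(|g - c| + 1) |P u|^2], and [h <= 1] lets this absorb [(g - c - h) |P u|^2]. *)
pose h := Num.min (Num.min d 1) (b / (`|g - c| + 1)).
have h0 : 0 < h by rewrite !lt_min d0 ltr01 divr_gt0.
have hd : h <= d by rewrite !ge_min lexx.
have h1 : h <= 1 by rewrite !ge_min lexx orbT.
have hb' : `|g - c| + 1 <= h^-1 * b.
  by rewrite mulrC ler_pdivlMr // mulrC -ler_pdivlMr // ge_min lexx orbT.
have [l0 _ [_ /(_ (c + h)) hneg _]] := index_shift_spec c saA bbA gcA bB.
have [|L [hL LA Lf Lneg]] := hneg; first by rewrite ltrDl.
have lin a u v : (P \o Q) (a *: u + v) = a *: (P \o Q) u + (P \o Q) v.
  by rewrite /= (projP hK hQ) (projP hV hP).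
have [u [Lu u0 /= PQu]] := no_fam_kernel lin hL Lf hno.
have := Lneg u Lu u0; rewrite ltNge => /negP; apply.
have [Qu orth] := hQ u; rewrite /= in Qu.
have Buy : adjoint B u = adjoint B (u - Q u) by rewrite adjointB // Qu subr0.
have Py : P u = P (u - Q u).
  by rewrite addrC -scaleN1r (projP hV hP) PQu scaler0 add0r.
have y1 : hnorm (P u) ^+ 2 <= hnorm (u - Q u) ^+ 2.
  by rewrite Py ler_sqr ?nnegrE ?hnorm_ge0 //; exact: (proj_le hP).
have y2 : b * hnorm (u - Q u) ^+ 2 <= hnorm (adjoint B u) ^+ 2.
  by rewrite Buy; apply: hb => y hy; exact: orth.
have y3 : (`|g - c| + 1) * hnorm (P u) ^+ 2 <= h^-1 * hnorm (adjoint B u) ^+ 2.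
  have hi : 0 <= h^-1 by rewrite invr_ge0 ltW.
  apply: le_trans (ler_wpM2l hi y2).
  rewrite [leRHS]mulrA; apply: le_trans (ler_wpM2l (ltW K0) y1) _.
  by rewrite ler_wpM2r ?exprn_ge0 ?hnorm_ge0.
have := hgd u (LA u Lu); rewrite /sform opprD addrA subrr add0r invrN mulNr opprK.
rewrite (proj_pyth hP u).
have p0 : 0 <= hnorm (P u) ^+ 2 by rewrite exprn_ge0 ?hnorm_ge0.
have r0 : 0 <= hnorm (u - P u) ^+ 2 by rewrite exprn_ge0 ?hnorm_ge0.
have z1 : 0 <= (d - h) * hnorm (u - P u) ^+ 2 by rewrite mulr_ge0 // subr_ge0.
have z2 : 0 <= (1 - h) * hnorm (P u) ^+ 2 by rewrite mulr_ge0 // subr_ge0.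
have z3 : 0 <= (`|g - c| + (g - c)) * hnorm (P u) ^+ 2.
  by rewrite mulr_ge0 // -lerBlDr sub0r -normrN ler_norm.
lra.
Qed.

Lemma rank_le_dim_ker :
  (hdim (range (P \o Q)) <= Order.min (hdim V) (hdim [set u | adjoint B u = 0%R]))%E.
Proof.
rewrite le_min; apply/andP; split.
  by apply: hdim_sub => _ [u _ <-]; exact: (projM hP).
apply: hdim_le => n [x [Rx hx]].
have /choice[y hy] : forall i, exists y, True /\ P (Q y) = x i.
  by move=> i; have [y _ <-] := Rx i; exists y.
exists (Q \o y); split.
  by move=> i; exact: (projM hQ).
apply: (lin_indep_image (projP hV hP)) => a; rewrite /= => ha; apply: hx.
by rewrite -[RHS]ha; apply: eq_bigr => i _; have [_ <-] := hy i.
Qed.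

End projections.
End index_shift_bounds.

Section counts_at_infinity.
Context {R : realType} {H Hhat : hilbertType R}.
Variables (A : operator H) (B : {linear Hhat -> H}) (c : R).
Hypotheses (saA : selfadjoint A) (bbA : bounded_below A) (gcA : graph_compact A)
  (bB : bounded_op B).

Let lA : linear_operator A. Proof. by case: saA. Qed.

Lemma form_bound u (C : R) : hnorm (A u) <= C -> rdot (A u) u <= C * hnorm u.
Proof.
move=> h; apply: le_trans (ler_norm _) _; apply: le_trans (rdot_cauchy _ _) _.
by rewrite ler_wpM2r ?hnorm_ge0.
Qed.

(** Density of the domain provides subspaces of [dom A] of any dimension, and [A] is bounded on
    each, so the form is nonpositive there for large [l]. *)
Lemma upper_counts_infinite :
  (forall m, exists2 x, c < x & npos_dim A B c x m) <-> hdim [set: H] = +oo%E.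
Proof.
rewrite hdim_infty; split=> h m.
  by have [x _ [L [_ _ Lm _]]] := h m; exact: has_fam_sub Lm.
have hD := dom_subspace lA.
have : has_fam (dom A) m.
  apply: has_fam_closure => //; rewrite dense_closureT //; by case: saA.
move=> /(has_fam_orthonormal hD)[g [dg og]].
have [C C0 hC] := span_hnorm_le (A \o g) og.
have [M M0 [_ hM]] := BBs_bound bB.
have c1 : c <= `|c| := ler_norm c.
(* At distance at least 1 from [c] the [B] term is at most [M |u|^2], and [l >= C + M] outweighs
   both it and [(A u, u)]. *)
exists (`|c| + 1 + C + M); first by lra.
exists (span g); split; [exact: span_subspace|exact: span_sub| |].
  by exists g; split; [exact: span_mem|exact: orthonormal_lin_indep].
move=> u [a ua] _.
have : hnorm (A u) <= C * hnorm u.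
  rewrite {1}ua oper_sum //; last by move=> i _; exact: subspZ.
  rewrite (eq_bigr (fun i => a i *: (A \o g) i)) ?ua //.
  by move=> i _; rewrite operZ.
move=> /form_bound; rewrite -mulrA -expr2 /sform => hA.
set l := _ + M; have cl : 1 <= l - c by rewrite /l; lra.
have -> : (c - l)^-1 = - (l - c)^-1 by rewrite -invrN opprB.
have b0 : 0 <= hnorm (adjoint B u) ^+ 2 by rewrite exprn_ge0 ?hnorm_ge0.
have n0 : 0 <= hnorm u ^+ 2 by rewrite exprn_ge0 ?hnorm_ge0.
have : (l - c)^-1 * hnorm (adjoint B u) ^+ 2 <= M * hnorm u ^+ 2.
  apply: le_trans (hM u); rewrite ler_pdivrMl; last by lra.
  by rewrite -[leLHS]mul1r; apply: ler_wpM2r.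
have : (C + M) * hnorm u ^+ 2 <= l * hnorm u ^+ 2.
  by apply: ler_wpM2r => //; rewrite /l; have := normr_ge0 c; lra.
by move: hA; lra.
Qed.

(** Otherwise some nonzero combination [u] of preimages is orthogonal to the image of the domain;
    then [B u] is orthogonal to the dense [dom A], so [B u = 0], against the independence of the
    [y i]. *)
Lemma adjoint_dom_fam m : has_fam (range B) m -> has_fam (adjoint B @` dom A) m.
Proof.
move=> [y [Ry hy]]; apply: contrapT => hm.
have /choice[x hx] : forall i, exists x, True /\ B x = y i.
  by move=> i; have [x _ <-] := Ry i; exists x.
have linB (a : R[i]) u v : B (a *: u + v) = a *: B u + B v by rewrite linearP.
have BxE : B \o x = y by apply/funext => i; have [] := hx i.
have ix : lin_indep x by apply: (lin_indep_image linB); rewrite BxE.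
have hS := image_subspace (adjointP bB) (dom_subspace lA).
have [u [[a ua] /eqP u0 hu]] := no_fam_orth hS hm ix; apply: u0.
have Bu : B u = 0.
  apply: (@rdot0_dense _ _ (dom A)); first by case: saA.
  by move=> v dv; rewrite rdotC /rdot adjointE // hu //; exists v.
rewrite ua big1 // => i _; rewrite (hy a) ?scale0r //.
by rewrite -[RHS]Bu ua (linear_fun_sum linB) -BxE.
Qed.

(** For finite rank, a vector orthogonal to the range of [B] and to the first [m] eigenvectors of
    [A] has form at least [(c - x) |u|^2], which bounds the counts uniformly in [x < c]. The
    converse uses vectors of [dom A] with orthonormal images under [B^*]. *)
Lemma lower_counts_infinite :
  (forall m, exists2 x, x < c & npos_dim A B c x m) <-> hdim (closure (range B)) = +oo%E.
Proof.
rewrite hdim_infty; split=> h.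
  move=> r; apply: contrapT => hr.
  have [|r' [e' [rr Be]]] := @no_fam_span _ _ (range B) r (range_subspace B).
    by move=> h'; apply: hr; apply: has_fam_sub h'; exact: subset_closure.
  have [e [nu [_ _ _ _ /(_ c)[m hm]]]] := spectral_theorem saA bbA gcA.
  have [x xc [L [hL LA [w [Lw hw]] Lneg]]] := h (r + m)%N.
  pose g (i : 'I_(r' + m)) := match fintype.split i with inl j => e' j | inr j => e j end.
  have rm : (r' + m < r + m)%N by rewrite ltn_add2r.
  have [u [su u0 hu]] := exists_orthogonal g rm hw.
  have Lu : L u by exact: (span_sub hL Lw).
  have Bu : adjoint B u = 0.
    apply/range_orth => //; rewrite Be; apply: span_orth => i.
    by have := hu (unsplit (inl i)); rewrite /g unsplitK.
  have := hm u (LA u Lu); have := Lneg u Lu u0.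
  rewrite /sform Bu hnorm0 expr0n mulr0 subr0 => h1 h2.
  have n0 : 0 < hnorm u ^+ 2 by rewrite exprn_gt0 // hnorm_gt0.
  have : 0 < (c - x) * hnorm u ^+ 2 by rewrite mulr_gt0 // subr_gt0.
  have : c * hnorm u ^+ 2 <= rdot (A u) u.
    apply: h2 => i im; have := hu (unsplit (inr (Ordinal im))).
    by rewrite /g unsplitK.
  by move: h1; lra.
move=> m; have hD := dom_subspace lA.
have := adjoint_dom_fam (has_fam_closure (range_subspace B) (h m)).
have hS := image_subspace (adjointP bB) hD.
move=> /(has_fam_orthonormal hS)[f [Sf of']].
have /choice[x hx] : forall i, exists x, dom A x /\ adjoint B x = f i.
  by move=> i; have [x dx <-] := Sf i; exists x.
have xE : adjoint B \o x = f by apply/funext => i; have [] := hx i.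
have dx i : dom A (x i) by have [] := hx i.
have [C C0 hC] := span_hnorm_le x of'.
have [C' C'0 hC'] := span_hnorm_le (A \o x) of'.
(* On the span of [x], with [c - 1 <= l], [(A u, u) - l |u|^2] is at most [K |B^* u|^2]; the choice
   of [l] below gives the [B] term the coefficient [K + 1]. *)
pose K := C' * C + (`|c| + 1) * C ^+ 2.
have K0 : 0 <= K.
  by rewrite addr_ge0 ?mulr_ge0 ?addr_ge0 ?exprn_ge0 // ltW.
have K1 : 1 <= K + 1 by rewrite lerDr.
have K2 : 0 < K + 1 by rewrite (lt_le_trans ltr01).
pose l := c - (K + 1)^-1.
exists l; first by rewrite ltrBlDr ltrDl invr_gt0.
exists (span x); split; [exact: span_subspace|exact: span_sub| |].
  exists x; split; first exact: span_mem.
  by apply: (lin_indep_image (adjointP bB)); rewrite xE; exact: orthonormal_lin_indep.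
move=> u [a ua] _.
have Bu : adjoint B u = \sum_(i < m) a i *: f i.
  by rewrite ua (linear_fun_sum (adjointP bB)) -xE.
have h1 : hnorm u <= C * hnorm (adjoint B u) by rewrite Bu {1}ua.
have h2 : hnorm (A u) <= C' * hnorm (adjoint B u).
  rewrite Bu {1}ua oper_sum //; last by move=> i _; exact: subspZ.
  rewrite (eq_bigr (fun i => a i *: (A \o x) i)) //.
  by move=> i _; rewrite operZ.
set b := hnorm (adjoint B u) in h1 h2 *; have b0 : 0 <= b := hnorm_ge0 _.
rewrite /sform -/b.
have -> : (c - l)^-1 = K + 1 by rewrite /l opprB addrC subrK invrK.
have h3 : rdot (A u) u <= C' * C * b ^+ 2.
  apply: le_trans (form_bound h2) _.
  have -> : C' * C * b ^+ 2 = C' * b * (C * b) by ring.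
  by rewrite ler_wpM2l // mulr_ge0 // ltW.
have n0 := hnorm_ge0 u.
have h4 : hnorm u ^+ 2 <= C ^+ 2 * b ^+ 2.
  by rewrite -exprMn ler_sqr ?nnegrE // mulr_ge0 // ltW.
have lb : - l <= `|c| + 1.
  have : (K + 1)^-1 <= 1 by rewrite invf_le1.
  by have := ler_norm (- c); rewrite normrN /l; lra.
have h5 : - l * hnorm u ^+ 2 <= (`|c| + 1) * (C ^+ 2 * b ^+ 2).
  apply: (@le_trans _ _ ((`|c| + 1) * hnorm u ^+ 2)).
    by rewrite ler_wpM2r // exprn_ge0.
  by rewrite ler_wpM2l // addr_ge0.
have : K * b ^+ 2 = C' * C * b ^+ 2 + (`|c| + 1) * (C ^+ 2 * b ^+ 2) by rewrite /K; ring.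
have := exprn_ge0 2 b0.
by move: h3 h5; lra.
Qed.

End counts_at_infinity.

(** * The two branches and the structure of the spectrum *)

Section branches_of_spectrum.
Context {R : realType} {H Hhat : hilbertType R}.
Variables (A : operator H) (B : {linear Hhat -> H}) (c : R).
Hypotheses (saA : selfadjoint A) (bbA : bounded_below A) (gcA : graph_compact A)
  (bB : bounded_op B).

Lemma neg_dim0 l : neg_dim A B c l 0.
Proof.
exists [set 0]; split.
- by split=> // a u v -> ->; rewrite scaler0 addr0.
- by move=> _ ->; case: saA => -[[]].
- exact: has_fam0.
- by move=> u ->; rewrite eqxx.
Qed.

Lemma lower_branch : exists (n : \bar R) (l : nat -> R),
  [/\ is_enat n, forall j, index_range n j -> l j < c, nondecr_on (index_range n) l &
      forall x, x < c -> counting [set j | index_range n j /\ l j = x] =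
        hdim (ker_op (schur A B c x%:C))] /\
  [/\ forall x, x < c -> resolvent_set (schur A B c x%:C) 0 \/
        exists j, index_range n j /\ l j = x,
      forall j, index_range n j -> exists u,
        [/\ dom A u, u != 0 & schur A B c (l j)%:C u = 0],
      forall j, index_range n j -> is_minmax (dom A) (j + 0) (p1 A B c) (l j),
      n = +oo%E <-> (forall m, exists2 x, x < c & npos_dim A B c x m) &
      n = +oo%E -> forall x, x < c -> exists N, forall j, (N <= j)%N -> l j < c /\ x < l j].
Proof.
have [l0 l0c k0] := lower_branch_start c bbA bB.
apply: (@branch _ _ _ A B c saA bbA gcA bB [set x | x < c] (-1) 0 l0) => //=.
- by move=> x xc; rewrite lt_eqF.
- by move=> x y _ yc _; left.
- by move=> x y z _ zc /andP[_ yz]; exact: le_lt_trans zc.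
- move=> x xc; exists (c - x); first by rewrite subr_gt0.
  by move=> y; rewrite ltr_norml => /andP[_]; rewrite ltrBlDr subrK.
- by move=> x xc u u0; exact: sform_p1.
- by move=> x _; exact: neg_dim0.
Qed.

Lemma upper_branch : exists (n : \bar R) (l : nat -> R),
  [/\ is_enat n, forall j, index_range n j -> c < l j, nondecr_on (index_range n) l &
      forall x, c < x -> counting [set j | index_range n j /\ l j = x] =
        hdim (ker_op (schur A B c x%:C))] /\
  [/\ forall x, c < x -> resolvent_set (schur A B c x%:C) 0 \/
        exists j, index_range n j /\ l j = x,
      forall j, index_range n j -> exists u,
        [/\ dom A u, u != 0 & schur A B c (l j)%:C u = 0],
      forall j, index_range n j ->
        is_minmax (dom A) (j + index_shift A B c) (p2 A B c) (l j),
      n = +oo%E <-> (forall m, exists2 x, c < x & npos_dim A B c x m) &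
      n = +oo%E -> forall x, c < x -> exists N, forall j, (N <= j)%N -> c < l j /\ x < l j].
Proof.
have [l0 l0c [k0 kk _]] := index_shift_spec c saA bbA gcA bB.
apply: (@branch _ _ _ A B c saA bbA gcA bB [set x | c < x] 1 (index_shift A B c) l0) => //=.
- by move=> x xc; rewrite gt_eqF.
- by move=> x y cx _ _; right.
- by move=> x y z cx _ /andP[xy _]; exact: lt_le_trans xy.
- move=> x xc; exists (x - c); first by rewrite subr_gt0.
  by move=> y; rewrite ltr_norml => /andP[+ _]; rewrite opprB ltrBrDr subrK.
- by move=> x xc u u0; exact: sform_p2.
Qed.

Lemma eigenvector_spectrum (x : R) : x != c ->
  (exists u, [/\ dom A u, u != 0 & schur A B c x%:C u = 0]) ->
  schur_spectrum A B c x%:C /\ schur_point_spectrum A B c x%:C.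
Proof.
move=> xc [u [du u0 Su]]; have xC : x%:C <> c%:C by case=> /eqP; rewrite (negbTE xc).
split; split => //; last by exists u; rewrite scale0r.
move=> [K [_ _ /(_ u du) /=]]; rewrite scale0r subr0.
by move: Su; rewrite /= => ->; rewrite linear0 => /esym/eqP; rewrite (negbTE u0).
Qed.

Lemma spectrum_real z : schur_spectrum A B c z ->
  exists2 x : R, x != c & z = x%:C /\ ~ resolvent_set (schur A B c x%:C) 0.
Proof.
move=> [zc hz]; have [iz|iz] := eqVneq (complex.Im z) 0; last first.
  by case: hz; exact: schur_resolvent_nonreal.
have zE : z = (complex.Re z)%:C by case: z iz {zc hz} => a b /= ->.
exists (complex.Re z); last by rewrite -zE.
by apply/eqP => h; apply: zc; rewrite zE h.
Qed.

End branches_of_spectrum.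

Theorem theorem3p9 (R : realType) (H Hhat : hilbertType R)
  (sepH : separable_space H) (sepHhat : separable_space Hhat)
  (A : operator H) (saA : selfadjoint A) (crA : compact_resolvent A)
  (bbA : bounded_below A)
  (B : {linear Hhat -> H}) (bdB : bounded_op B) (B0 : exists x, B x != 0)
  (c : R) :
  let N := hdim (spectral_subspace `]-oo, c] A) in
  let kappa2 := index_shift A B c in
  exists (n1 n2 : \bar R) (l1 l2 : nat -> R),
    [/\ is_enat n1, is_enat n2,
        (forall j, index_range n1 j -> l1 j < c) /\ nondecr_on (index_range n1) l1 &
        (forall j, index_range n2 j -> c < l2 j) /\ nondecr_on (index_range n2) l2] /\
    [/\ schur_spectrum A B c =
          [set (l1 j)%:C | j in index_range n1] `|` [set (l2 j)%:C | j in index_range n2],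
        schur_spectrum A B c = schur_point_spectrum A B c,
        forall x : R, x < c ->
          counting [set j | index_range n1 j /\ l1 j = x] =
          hdim (ker_op (schur A B c x%:C)) &
        forall x : R, c < x ->
          counting [set j | index_range n2 j /\ l2 j = x] =
          hdim (ker_op (schur A B c x%:C))] /\
    [/\ forall j, index_range n1 j -> is_minmax (dom A) j (p1 A B c) (l1 j),
        forall j, index_range n2 j ->
          is_minmax (dom A) (j + kappa2) (p2 A B c) (l2 j),
        (kappa2%:R%:E <= N)%E &
        (forall u, dom A u -> u != 0 ->
           c * hnorm u ^+ 2 < complex.Re '[A u, u]) -> kappa2 = 0%N] /\
    [/\ closed (range B) ->
          forall P Q : H -> H,
            orth_proj (spectral_subspace `]-oo, c] A) P ->
            orth_proj [set u | adjoint B u = 0] Q ->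
            (kappa2%:R%:E <= hdim (range (P \o Q)))%E /\
            (hdim (range (P \o Q)) <=
               Order.min N (hdim [set u | adjoint B u = 0%R]))%E,
        (n2 = +oo%E <-> hdim [set: H] = +oo%E) /\
          (n2 = +oo%E -> l2 @ \oo --> +oo) &
        (n1 = +oo%E <-> hdim (closure (range B)) = +oo%E) /\
          (n1 = +oo%E -> l1 @ \oo --> c)].

Proof.
have gcA := compact_resolvent_graph crA.
move=> N kappa2.
have [n1 [l1 [[en1 lt1 nd1 cnt1] [sp1 ev1 mm1 inf1 lim1]]]] := lower_branch c saA bbA gcA bdB.
have [n2 [l2 [[en2 lt2 nd2 cnt2] [sp2 ev2 mm2 inf2 lim2]]]] := upper_branch c saA bbA gcA bdB.
have in1 j : index_range n1 j ->
    schur_spectrum A B c (l1 j)%:C /\ schur_point_spectrum A B c (l1 j)%:C.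
  by move=> hj; apply: eigenvector_spectrum; [rewrite lt_eqF // lt1|exact: ev1].
have in2 j : index_range n2 j ->
    schur_spectrum A B c (l2 j)%:C /\ schur_point_spectrum A B c (l2 j)%:C.
  by move=> hj; apply: eigenvector_spectrum; [rewrite gt_eqF // lt2|exact: ev2].
have out z : schur_spectrum A B c z ->
    ([set (l1 j)%:C | j in index_range n1] `|` [set (l2 j)%:C | j in index_range n2]) z.
  move=> /(spectrum_real saA bdB)[x xc [-> hx]].
  move: xc; rewrite neq_lt => /orP[xc|xc].
    by left; have [//|[j [hj <-]]] := sp1 x xc; exists j.
  by right; have [//|[j [hj <-]]] := sp2 x xc; exists j.
exists n1, n2, l1, l2; split; [by []|split; [|split]].
- split => //.
  + apply/seteqP; split=> [z /out //|_ [[j hj <-]|[j hj <-]]].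
    * by case: (in1 j hj).
    * by case: (in2 j hj).
  + apply/seteqP; split=> [z /out [[j hj <-]|[j hj <-]]|z [zc [u [du u0 Su]]]].
    * by case: (in1 j hj).
    * by case: (in2 j hj).
    * split => // -[K [_ _ /(_ u du) /=]].
      move: Su; rewrite /= => ->; rewrite subrr linear0 => /esym/eqP.
      by rewrite (negbTE u0).
- split => //.
  + by move=> j /mm1; rewrite addn0.
  + exact: index_shift_le_dim.
  + exact: index_shift_eq0.
split.
- move=> cB P Q hP hQ; split; first exact: index_shift_le_rank.
  exact: rank_le_dim_ker.
- split; first by rewrite inf2; exact: upper_counts_infinite.
  move=> /lim2 h; apply/cvgryPgt => x.
  (* [lim2] only speaks of points beyond [c], hence the maximum with [c + 1]. *)
  have [|M hM] := h (Num.max x (c + 1)); first by rewrite lt_max ltrDl ltr01 orbT.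
  by exists M => // j /= /hM[_]; apply: le_lt_trans; rewrite le_max lexx.
- split; first by rewrite inf1; exact: lower_counts_infinite.
  move=> /lim1 h; apply/cvgrPdist_lt => ep ep0.
  have [|M hM] := h (c - ep); first by rewrite ltrBlDr ltrDl.
  exists M => // j /= /hM[lc]; rewrite ger0_norm ?subr_ge0 ?ltW //; lra.
Qed.
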